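(* Let $N\ge1$ be an integer, $s\in(0,1)$, $N>2s$, and let $V\in C(\mathbb{R}^N,[0,+\infty))$. Assume that one of the following two conditions holds: (1) $2<p<2+\frac{2s}{N-2s}$ and $\lim_{|x|\to\infty}(1+|x|^{2s})V(x)=0$; (2) for some $\omega\in(0,2s]$, $2<p<2+\frac{\omega}{N+2s-\omega}$ and $\sup_{x\in\mathbb{R}^N}(1+|x|^\omega)V(x)<+\infty$. Then for every $\varepsilon>0$ the equation $$\varepsilon^{2s}(-\Delta)^su+Vu=u^{p-1},\quad u>0,\quad\text{in }\mathbb{R}^N$$ has no positive weak solution.
   Context: Here $2_s^*=\frac{2N}{N-2s}$ and $(-\Delta)^su(x)=2\,\mathrm{P.V.}\int_{\mathbb{R}^N}\frac{u(x)-u(y)}{|x-y|^{N+2s}}\,dy$. Define $$H^s_{V,\varepsilon}(\mathbb{R}^N)=\Big\{u\in L^{2_s^*}(\mathbb{R}^N):\iint_{\mathbb{R}^{2N}}\frac{|u(x)-u(y)|^2}{|x-y|^{N+2s}}\,dx\,dy+\int_{\mathbb{R}^N}V(x)u^2\,dx<\infty\Big\}.$$ A positive weak solution is a function $u\in H^s_{V,\varepsilon}(\mathbb{R}^N)$, $u>0$, such that for all $\varphi\in H^s_{V,\varepsilon}(\mathbb{R}^N)$ $$\varepsilon^{2s}\iint_{\mathbb{R}^{2N}}\frac{(u(x)-u(y))(\varphi(x)-\varphi(y))}{|x-y|^{N+2s}}\,dx\,dy+\int_{\mathbb{R}^N}Vu\varphi\,dx=\int_{\mathbb{R}^N}|u|^{p-2}u\varphi\,dx.$$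 *)

(* Defs.v *)
From HB Require Import structures.
From mathcomp Require Import all_boot all_order all_algebra.
From mathcomp Require Import all_classical all_reals all_analysis.
From mathcomp Require Import measurable_realfun.
Set Implicit Arguments.
Unset Strict Implicit.
Unset Printing Implicit Defensive.
Import Order.TTheory GRing.Theory Num.Theory.
Import numFieldNormedType.Exports.
Local Open Scope classical_set_scope.
Local Open Scope ring_scope.

(* Row vectors carry the sigma-algebra generated by the coordinates, as the
   library does for tuples; over R it contains the open sets
   (open_measurable_rV), hence is the Borel sigma-algebra of R^n. *)
Definition rV_display : measure_display -> measure_display.
Proof. exact. Qed.

Section rV_measurable.
Context {d} {T : measurableType d} (n : nat).

Let coord (i : 'I_n) (x : 'rV[T]_n) : T := x ord0 i.

Let rV_set0 : g_sigma_preimage coord set0.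
Proof. exact: sigma_algebra0. Qed.

Let rV_setC A : g_sigma_preimage coord A -> g_sigma_preimage coord (~` A).
Proof. exact: sigma_algebraC. Qed.

Let rV_bigcup (F : _^nat) : (forall i, g_sigma_preimage coord (F i)) ->
  g_sigma_preimage coord (\bigcup_i (F i)).
Proof. exact: sigma_algebra_bigcup. Qed.

HB.instance Definition _ := @isMeasurable.Build (rV_display d)
  'rV[T]_n (g_sigma_preimage coord) rV_set0 rV_setC rV_bigcup.

End rV_measurable.


Section rV_cons.
Context {d} {T : measurableType d} (n : nat).

Definition rV_cons (z : T * 'rV[T]_n) : 'rV[T]_n.+1 :=
  row_mx (const_mx z.1 : 'rV_1) z.2.

Lemma rV_cons0 z : rV_cons z ord0 ord0 = z.1.
Proof.
rewrite (_ : ord0 = lshift n ord0 :> 'I_(1 + n)); last exact/val_inj.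
by apply: etrans (row_mxEl _ _ _ _) _; rewrite mxE.
Qed.

Lemma rV_consS z i : rV_cons z ord0 (lift ord0 i) = z.2 ord0 i.
Proof. by rewrite -rshift1; exact: row_mxEr. Qed.

Lemma measurable_rV_coord m (i : 'I_m) :
  measurable_fun [set: 'rV[T]_m] (fun x => x ord0 i).
Proof.
move=> _ Y mY; rewrite setTI; apply: sub_sigma_algebra => /=.
rewrite -bigcup_seq/=; exists i => /=; first by rewrite mem_index_enum.
by exists Y => //; rewrite setTI.
Qed.

Lemma measurable_fun_rVP d' (T' : measurableType d') m (f : T' -> 'rV[T]_m) :
  measurable_fun [set: T'] f <->
  forall i, measurable_fun [set: T'] (fun t => f t ord0 i).
Proof.
split=> [mf i|mf].
  by apply: (measurableT_comp (measurable_rV_coord i)).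
have mC : @measurable _ 'rV[T]_m `<=` [set C | measurable (f @^-1` C)].
  apply: smallest_sub.
    split => /=.
    - by rewrite preimage_set0.
    - by move=> A mA; rewrite setTD preimage_setC; exact: measurableC.
    - by move=> F mF; rewrite preimage_bigcup; exact: bigcupT_measurable.
  rewrite -bigcup_seq => A [i _ [B mB <-]] /=.
  by rewrite setTI; have := mf i measurableT B mB; rewrite setTI.
by move=> _ C sC; rewrite setTI; exact: mC.
Qed.

Lemma measurable_rV_cons : measurable_fun [set: T * 'rV[T]_n] rV_cons.
Proof.
apply/measurable_fun_rVP => i; have [j ->|->] := unliftP ord0 i.
  under eq_fun do rewrite rV_consS.
  exact: (measurableT_comp (measurable_rV_coord j) measurable_snd).
by under eq_fun do rewrite rV_cons0; exact: measurable_fst.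
Qed.

HB.instance Definition _ :=
  isMeasurableFun.Build _ _ _ _ rV_cons measurable_rV_cons.

Definition rV_behead (x : 'rV[T]_n.+1) : 'rV[T]_n :=
  \row_i x ord0 (lift ord0 i).

Lemma measurable_rV_behead : measurable_fun [set: 'rV[T]_n.+1] rV_behead.
Proof.
apply/measurable_fun_rVP => i; under eq_fun do rewrite mxE.
exact: measurable_rV_coord.
Qed.

Lemma rV_consK (x : 'rV[T]_n.+1) : rV_cons (x ord0 ord0, rV_behead x) = x.
Proof.
apply/rowP => i; have [j ->|->] := unliftP ord0 i.
  by rewrite rV_consS mxE.
by rewrite rV_cons0.
Qed.

Lemma rV_beheadK (z : T * 'rV[T]_n) :
  ((rV_cons z) ord0 ord0, rV_behead (rV_cons z)) = z.
Proof.
case: z => t x; rewrite rV_cons0; congr pair.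
by apply/rowP => i; rewrite mxE rV_consS.
Qed.

End rV_cons.

Lemma sigma_finite_product d1 d2 (T1 : measurableType d1)
    (T2 : measurableType d2) (R : realType)
    (m1 : {sigma_finite_measure set T1 -> \bar R})
    (m2 : {sigma_finite_measure set T2 -> \bar R}) :
  sigma_finite setT (m1 \x m2)%E.
Proof.
have /sigma_finiteP[F [TF ndF Foo]] := sigma_finiteT m1.
have /sigma_finiteP[G [TG ndG Goo]] := sigma_finiteT m2.
exists (fun n => F n `*` G n).
  rewrite -setXTT TF TG predeqE => -[x y]; split.
    move=> [/= [n _ Fnx] [k _ Gky]]; exists (maxn n k) => //; split.
    - by move: x Fnx; exact/subsetPset/ndF/leq_maxl.
    - by move: y Gky; exact/subsetPset/ndG/leq_maxr.
  by move=> [n _ []/= ? ?]; split; exists n.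
move=> k; have [? ?] := Foo k; have [? ?] := Goo k.
split; first exact: measurableX.
by rewrite product_measure1E// lte_mul_pinfty// ge0_fin_numE.
Qed.

Section lebesgue_rV_step.
Context {R : realType} (n : nat).
Variable mu : {sigma_finite_measure set 'rV[R]_n -> \bar R}.
Let cons : measurableTypeR R * 'rV[R]_n -> 'rV[R]_n.+1 := @rV_cons _ R n.

Definition lebesgue_rV_step : set 'rV[R]_n.+1 -> \bar R :=
  pushforward (lebesgue_measure \x mu)%E cons.

Let step0 : lebesgue_rV_step set0 = 0%E.
Proof. by rewrite /lebesgue_rV_step /pushforward preimage_set0 measure0. Qed.

Let step_ge0 A : (0 <= lebesgue_rV_step A)%E.
Proof. by rewrite /lebesgue_rV_step /pushforward; exact: measure_ge0. Qed.

Let mcons : measurable_fun [set: measurableTypeR R * 'rV[R]_n] cons.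
Proof. exact: measurable_rV_cons. Qed.

Let step_sigma_additive : semi_sigma_additive lebesgue_rV_step.
Proof.
pose c : {mfun (measurableTypeR R * 'rV[R]_n)%type >-> 'rV[R]_n.+1} :=
  HB.pack cons (isMeasurableFun.Build _ _ _ _ _ mcons).
exact: (@measure_semi_sigma_additive _ _ _ (pushforward (lebesgue_measure \x mu)%E c)).
Qed.

HB.instance Definition _ := isMeasure.Build _ _ _ lebesgue_rV_step
  step0 step_ge0 step_sigma_additive.

Let step_sigma_finite : sigma_finite setT lebesgue_rV_step.
Proof.
have [F TF Foo] := sigma_finite_product (@lebesgue_measure R) mu.
pose g (x : 'rV[R]_n.+1) : measurableTypeR R * 'rV[R]_n :=
  (x ord0 ord0, rV_behead x).
have mg : measurable_fun setT g.
  apply: measurable_fun_pair; last exact: measurable_rV_behead.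
  exact: measurable_rV_coord.
exists (fun k => g @^-1` F k); first by rewrite -preimage_bigcup -TF.
move=> k; have [mF Fk] := Foo k; split.
  by rewrite -[X in measurable X]setTI; exact: mg.
rewrite /lebesgue_rV_step /pushforward -comp_preimage.
by rewrite (_ : g \o cons = id)//; apply/funext => z; exact: rV_beheadK.
Qed.

HB.instance Definition _ :=
  Measure_isSigmaFinite.Build _ _ _ lebesgue_rV_step step_sigma_finite.

End lebesgue_rV_step.

(* Lebesgue measure on R^n; it is characterised by lebesgue_rV_box. *)
Fixpoint lebesgue_rV {R : realType} (n : nat) :
    {sigma_finite_measure set 'rV[R]_n -> \bar R} :=
  if n is m.+1 then lebesgue_rV_step (lebesgue_rV m)
  else \d_(0 : 'rV[R]_0).


Lemma open_measurable_rV (R : realType) n (A : set 'rV[R]_n) :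
  open A -> measurable A.
Proof.
move=> oA.
pose B (q : 'rV[rat]_n) (k : nat) : set 'rV[R]_n :=
  \bigcap_(i in [set: 'I_n])
    ((fun x => x ord0 i) @^-1` (ball (ratr (q ord0 i) : R) k.+1%:R^-1)).
have -> : A = \bigcup_q \bigcup_(k in [set k | B q k `<=` A]) B q k.
  rewrite eqEsubset; split=> [x Ax|x [q _ [k]]]; last by move=> /[apply].
  have /nbhs_ballP[e /= e0 xeA] : nbhs x A by exact: open_nbhs_nbhs.
  have [k] := ltr_add_invr (divr_gt0 e0 (ltr0n R 2)).
  rewrite add0r => ke.
  have /choice[q xq] (i : 'I_n) : exists q : rat,
      ball (x ord0 i) k.+1%:R^-1 (ratr q : R).
    have k0 : x ord0 i < x ord0 i + k.+1%:R^-1 by rewrite ltrDl.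
    have [q] := rat_in_itvoo k0.
    rewrite in_itv/= => /andP[q1 q2]; exists q.
    by rewrite -ball_normE /= distrC ger0_norm ?subr_ge0 1?ltW// ltrBlDl.
  exists (\row_i q i) => //; exists k.
    move=> y By; apply: xeA; split=> // i j; rewrite (ord1 i).
    rewrite (splitr e); apply: (@ball_triangle _ _ (ratr (q j) : R)).
      exact: (le_ball (ltW ke)).
    by apply: (le_ball (ltW ke)); have := By j I; rewrite /= mxE.
  by move=> i _ /=; rewrite mxE; apply: ball_sym.
apply: countable_bigcupT_measurable => [|q]; first exact: countableP.
apply: bigcup_measurable => k _.
apply: fin_bigcap_measurable => // i _.
rewrite -[X in measurable X]setTI.
by apply: measurable_rV_coord => //; exact: measurable_ball.
Qed.

Lemma lebesgue_rV_box (R : realType) n (A : 'I_n -> set R) :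
  (forall i, measurable (A i)) ->
  lebesgue_rV n [set x | forall i, A i (x ord0 i)] =
  (\prod_(i < n) lebesgue_measure (A i))%E.
Proof.
elim: n A => [A _|n IH A mA].
  rewrite big_ord0 /= diracE mem_set//=.
  by move=> -[].
rewrite big_ord_recl -IH => [|i]; last exact: mA.
rewrite [lebesgue_rV n.+1]/= /lebesgue_rV_step /pushforward.
rewrite -product_measure1E; [|exact: mA|]; last first.
  rewrite (_ : [set _ | _] = \bigcap_(i in [set: 'I_n])
    ((fun x => x ord0 i) @^-1` (A (lift ord0 i)))); last first.
    by apply/seteqP; split => [x Ax i _|x Ax i]; [exact: Ax|exact: (Ax i I)].
  apply: fin_bigcap_measurable => // i _.
  by rewrite -[X in measurable X]setTI; apply: measurable_rV_coord.
rewrite [X in _ = _ X](_ : _ = @rV_cons _ R n @^-1`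
  [set x | forall i, A i (x ord0 i)])//.
apply/seteqP; split => -[t x] /= => [[At Ax] i|Ax].
  have [j ->|->] := unliftP ord0 i; first by rewrite rV_consS; exact: Ax.
  by rewrite rV_cons0.
by split=> [|i]; [have := Ax ord0|have := Ax (lift ord0 i)];
  rewrite ?rV_cons0 ?rV_consS.
Qed.

(* The library norm on row vectors is the sup norm, so the Euclidean norm is
   defined separately; both induce the library topology on 'rV[R]_n. *)
Definition enorm {R : realType} {n : nat} (x : 'rV[R]_n) : R :=
  Num.sqrt (\sum_(i < n) x ord0 i ^+ 2).

(* The filter of neighbourhoods of |x| -> oo. *)
Definition enorm_pinfty {R : realType} {n : nat} : set_system 'rV[R]_n :=
  filter_from [set: R] (fun r => [set x | r < enorm x]).

Section fractional_schroedinger.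
Context {R : realType} {N : nat}.
Implicit Types (s p eps : R) (V u phi : 'rV[R]_N -> R).

Let mu := @lebesgue_rV R N.

Definition critical_exponent (n : nat) s : R := 2 * n%:R / (n%:R - 2 * s).

(* On the diagonal, a null set when N >= 1, the quotients are 0 / 0 = 0. *)
Definition gagliardo_form s u phi : \bar R :=
  (\int[mu \x mu]_z
     ((u z.1 - u z.2) * (phi z.1 - phi z.2) /
      enorm (z.1 - z.2) `^ (N%:R + 2 * s))%:E)%E.

Definition gagliardo_seminorm2 s u : \bar R :=
  (\int[mu \x mu]_z
     (`|u z.1 - u z.2| ^+ 2 / enorm (z.1 - z.2) `^ (N%:R + 2 * s))%:E)%E.

Definition HsV s V : set ('rV[R]_N -> R) :=
  [set u | u \in Lfun mu (critical_exponent N s)%:E /\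
    (gagliardo_seminorm2 s u + \int[mu]_x (V x * u x ^+ 2)%:E < +oo)%E].

(* Elements of L^{2*} are classes modulo a.e. equality, whence u > 0 a.e.
   The identity is in \bar R: the left-hand side is finite by Cauchy-Schwarz,
   so that the right-hand integrand, on which membership in the space gives no
   integrability, is forced to be integrable. The library sets
   +oo - oo = -oo, so a divergent right-hand side never satisfies it. *)
Definition positive_weak_solution s V p eps u : Prop :=
  [/\ HsV s V u,
      {ae mu, forall x, 0 < u x} &
      forall phi, HsV s V phi ->
        ((eps `^ (2 * s))%:E * gagliardo_form s u phi +
         \int[mu]_x (V x * u x * phi x)%:E =
         \int[mu]_x (`|u x| `^ (p - 2) * u x * phi x)%:E)%E].

End fractional_schroedinger.

(* Main.v *)
Require Import Defs.
From HB Require Import structures.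
From mathcomp Require Import all_boot all_order all_algebra.
From mathcomp Require Import all_classical all_reals all_analysis.
From mathcomp Require Import measurable_realfun.
From mathcomp Require Import ring lra.
Set Implicit Arguments.
Unset Strict Implicit.
Unset Printing Implicit Defensive.
Import Order.TTheory GRing.Theory Num.Theory.
Import numFieldNormedType.Exports.
Local Open Scope classical_set_scope.
Local Open Scope ring_scope.

(** Write K(z) = |z|^(-N-2s), c = eps^(2s), q = p - 2, and suppose that u > 0
    solves the equation.  Everything is expressed through the mass
    m(r) of u in the ball of radius r, which two kinds of test functions bound
    in incompatible ways.

    The first one is eta^2 / (u + t), where eta is a cutoff equal to 1 on the
    ball B of radius r.  Picone's inequality bounds its energy against u by the
    energy of eta, and on B x B, where eta is constant, it leaves a negative
    remainder.  If V <= C |x|^(-omega) with omega <= 2s this gives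
    [harnack_inequality]: the integral of u^(q+1) / (u + t) over B, plus
    r^(-N-2s) m(r) times the integral of 1 / (u + t) over B, is at most
    C r^(N-omega).  The first integrand is at least t^q / 2 where u >= t, and
    2 t / (u + t) is at least 1 elsewhere; choosing t^q of order r^(-omega)
    leads to [ball_mass_bound]: m(r) <= C r^gamma for
    gamma = N + 2s - omega - omega / q.
    The condition on p in the second alternative says exactly that gamma < 0,
    which is absurd since m is nondecreasing and positive.

    In the first alternative omega = 2s and the condition on p only says that
    gamma < 2s.  The equation is then tested with
    phi_r = max(0, |x|^d - rho^d - r^(d-e) |x|^e), where 0 < d < e < 2s.
    For such exponents (-Delta)^s |x|^d = - C_d |x|^(d-2s) with C_d > 0, so
    outside the ball of radius rho, where V is a small multiple of |x|^(-2s),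
    the first power absorbs the potential; taking the maximum with 0 has a
    favourable sign.  There remains
      integral of u^(q+1) phi_r <= C r^(d-e) m(r) <= C r^(d-e+gamma),
    and the right side tends to 0 if e - d > gamma, while phi_r is bounded from
    below on a fixed annulus: this is [slow_ball_mass_absurd].

    The action on powers is computed without principal values.  The double
    integrals are restricted to the pairs (x, y) with |y| > l |x| or
    |x| > l |y|, where l > 1.  There the kernel is bounded by a multiple of
    max(|x|, |y|)^(-N-2s), so that all integrals converge absolutely, and the
    region is invariant under similarities, so that homogeneity and rotation
    invariance of Lebesgue measure determine the operator on powers up to a
    constant ([far_operator_npow]).  The constant is read off by pairing with a
    radially decreasing cutoff ([far_const_bounds]); this uses N > 2s, which
    makes |x|^(d-2s) locally integrable.  The pairs that are missing when l
    tends to 1 have equal norms and do not contribute for a radial test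
    function ([form_bump_limit]). *)

(** * Affine invariance of Lebesgue measure *)

Section affine1.
Context {R : realType}.
Local Open Scope ereal_scope.
Local Notation leb := (@lebesgue_measure R).

Lemma measurable_affine1 (c a : R) :
  measurable_fun [set: measurableTypeR R]
    ((fun t => c * t + a)%R : _ -> measurableTypeR R).
Proof. by apply: measurable_funD => //; apply: measurable_funM. Qed.

Lemma lebesgue_measure_affine (c a : R) (A : set (measurableTypeR R)) :
  (c != 0)%R -> measurable A ->
  `|c|%:E * leb ((fun t => c * t + a)%R @^-1` A) = leb A.
Proof.
move=> c0 mA.
have c1 : (0 < `|c|)%R by rewrite normr_gt0.
pose g := (fun t => c * t + a)%R : measurableTypeR R -> measurableTypeR R.
pose m : {measure set (measurableTypeR R) -> \bar R} :=
  mscale (NngNum (ltW c1)) (pushforward leb g).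
rewrite -[LHS]/(m (measurable_affine1 c a) A); apply/esym/lebesgue_measure_unique => // _ [[x y] _ <-].
rewrite -[RHS]/(`|c|%:E * leb (g @^-1` `]x, y])).
have [cp|cn|] := ltgtP 0%R c; last by move/esym/eqP; rewrite (negbTE c0).
  rewrite (_ : g @^-1` _ =
      `] ((x - a) / c)%R, ((y - a) / c)%R]%classic); last first.
    apply/seteqP; split => t /=; by rewrite !in_itv/= ltr_pdivrMr// ler_pdivlMr//
      ltrBlDr lerBrDr (mulrC t).
  rewrite !lebesgue_measure_itv/= !lte_fin ltr_pM2r ?invr_gt0// ltrBlDr subrK.
  case: ifPn => xy; last by rewrite mule0.
  by rewrite -!EFinD -EFinM gtr0_norm//; congr EFin; field.
rewrite (_ : g @^-1` _ =
    `[ ((y - a) / c)%R, ((x - a) / c)%R[%classic); last first.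
  apply/seteqP; split => t /=; by rewrite !in_itv/= ler_ndivrMr// ltr_ndivlMr//
    lerBrDr ltrBlDr (mulrC t) andbC.
rewrite !lebesgue_measure_itv/= !lte_fin ltr_nM2r ?invr_lt0// ltrBlDr subrK.
case: ifPn => xy; last by rewrite mule0.
by rewrite -!EFinD -EFinM ltr0_norm//; congr EFin; field.
Qed.

Lemma ge0_integral_affine1 (c a : R) (f : measurableTypeR R -> \bar R) :
  (c != 0)%R -> measurable_fun setT f -> (forall t, 0 <= f t) ->
  `|c|%:E * \int[leb]_t f (c * t + a)%R = \int[leb]_t f t.
Proof.
move=> c0 mf f0.
have c1 : (0 < `|c|)%R by rewrite normr_gt0.
pose g := (fun t => c * t + a)%R : measurableTypeR R -> measurableTypeR R.
have mg : measurable_fun setT g := measurable_affine1 c a.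
have := ge0_integral_pushforward (measurable_affine1 c a) leb measurableT mf
  (fun _ _ => f0 _).
rewrite preimage_setT => <-.
rewrite -(@ge0_integral_mscale _ _ _ (pushforward leb g) _ measurableT (NngNum (ltW c1)) f mf)//.
apply: eq_measure_integral => A mA _.
by rewrite /= /mscale/= /pushforward/= lebesgue_measure_affine.
Qed.

End affine1.

Section rV_integral.
Context {R : realType}.
Local Open Scope ereal_scope.
Local Notation leb := (@lebesgue_measure R).

Lemma ge0_integral_rV_cons n (f : 'rV[R]_n.+1 -> \bar R) :
  measurable_fun setT f -> (forall x, 0 <= f x) ->
  \int[lebesgue_rV n.+1]_x f x =
  \int[leb]_t \int[lebesgue_rV n]_x f (rV_cons (t, x)).
Proof.
move=> mf f0.
have mc := @measurable_rV_cons _ (measurableTypeR R) n.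
have := @ge0_integral_pushforward _ _ (measurableTypeR R * 'rV[R]_n)%type 'rV[R]_n.+1 R
  (@rV_cons _ R n) mc (leb \x lebesgue_rV n) setT f measurableT mf
  (fun _ _ => f0 _).
rewrite preimage_setT.
rewrite (fubini_tonelli1 (f \o @rV_cons _ R n : measurableTypeR R * 'rV[R]_n -> _)).
- by move=> <-.
- exact: (measurableT_comp mf mc).
- by move=> x; exact: f0.
Qed.

Lemma measurable_rV_affine n (c : R) (a : 'rV[R]_n) :
  measurable_fun [set: 'rV[R]_n] (fun x => c *: x + a)%R.
Proof.
apply/measurable_fun_rVP => i; under eq_fun do rewrite !mxE.
apply: measurable_funD => //; apply: measurable_funM => //.
exact: measurable_rV_coord.
Qed.

(** Induction on the dimension, Tonelli's theorem splitting off the first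
    coordinate. *)
Lemma ge0_integral_affine n (c : R) (a : 'rV[R]_n) (f : 'rV[R]_n -> \bar R) :
  (c != 0)%R -> measurable_fun setT f -> (forall x, 0 <= f x) ->
  (`|c| ^+ n)%:E * \int[lebesgue_rV n]_x f (c *: x + a)%R =
  \int[lebesgue_rV n]_x f x.
Proof.
move=> c0; elim: n a f => [a f mf f0|n IH a f mf f0].
  rewrite expr0 mul1e; apply: eq_integral => x _.
  by congr f; apply/rowP => -[].
rewrite !ge0_integral_rV_cons//; last exact: (measurableT_comp mf (measurable_rV_affine c a)).
pose g (t : measurableTypeR R) := \int[lebesgue_rV n]_x f (rV_cons (t, x)).
have mfc : measurable_fun setT (f \o @rV_cons _ R n : measurableTypeR R * 'rV[R]_n -> _).
  exact: (measurableT_comp mf (@measurable_rV_cons _ (measurableTypeR R) n)).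
have mg : measurable_fun setT g.
  by apply: (measurable_fun_fubini_tonelli_F (m2 := lebesgue_rV n) _ mfc) => z; exact: f0.
have g0 t : 0 <= g t by apply: integral_ge0.
rewrite -[RHS](@ge0_integral_affine1 _ c (a ord0 ord0) _ c0 mg g0).
rewrite exprS EFinM -muleA; congr (_ * _).
have E (t : measurableTypeR R) : (`|c| ^+ n)%:E * (\int[lebesgue_rV n]_x f (c *: rV_cons (t, x) + a)%R) =
    g (c * t + a ord0 ord0)%R.
  rewrite /g -(IH (rV_behead a) (fun x => f (rV_cons ((c * t + a ord0 ord0)%R : measurableTypeR R, x)))); last 2 first.
  - by have := measurable_fun_pair2 ((c * t + a ord0 ord0)%R : measurableTypeR R) mfc; exact.
  - by move=> x; exact: f0.
  congr (_ * _); apply: eq_integral => x _; congr f.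
  apply/rowP => i; rewrite [LHS]mxE [X in (X + _)%R]mxE.
  have [j ->|->] := unliftP ord0 i; last by rewrite !rV_cons0.
  by rewrite !rV_consS/= !mxE.
rewrite -ge0_integralZl//; first exact: eq_integral.
  apply: (measurable_fun_fubini_tonelli_F (m2 := lebesgue_rV n)
    (fun z : measurableTypeR R * 'rV[R]_n => f (c *: rV_cons z + a)%R)) => [|z];
    last exact: f0.
  apply: (measurableT_comp mf).
  apply: (measurableT_comp (measurable_rV_affine c a)).
  exact: (@measurable_rV_cons _ (measurableTypeR R) n).
by move=> t _; apply: integral_ge0.
Qed.

End rV_integral.

(** * Euclidean norm, reflections and rotation invariance *)

Section euclid.
Context {R : realType} {N : nat}.
Implicit Types (x y v : 'rV[R]_N) (c t : R).

Definition dot x y : R := \sum_(i < N) x ord0 i * y ord0 i.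

Lemma dotC x y : dot x y = dot y x.
Proof. by apply: eq_bigr => i _; rewrite mulrC. Qed.

Lemma dotDl x y v : dot (x + y) v = dot x v + dot y v.
Proof. by rewrite -big_split; apply: eq_bigr => i _; rewrite mxE mulrDl. Qed.

Lemma dotZl c x v : dot (c *: x) v = c * dot x v.
Proof. by rewrite mulr_sumr; apply: eq_bigr => i _; rewrite mxE mulrA. Qed.

Lemma dotNl x v : dot (- x) v = - dot x v.
Proof. by rewrite -scaleN1r dotZl mulN1r. Qed.

Lemma dotBl x y v : dot (x - y) v = dot x v - dot y v.
Proof. by rewrite dotDl dotNl. Qed.

Lemma dotBr x y v : dot v (x - y) = dot v x - dot v y.
Proof. by rewrite dotC dotBl !(dotC v). Qed.

Lemma dotDr x y v : dot v (x + y) = dot v x + dot v y.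
Proof. by rewrite dotC dotDl !(dotC v). Qed.

Lemma dotZr c x v : dot v (c *: x) = c * dot v x.
Proof. by rewrite dotC dotZl (dotC v). Qed.

Lemma dot_ge0 x : 0 <= dot x x.
Proof. by apply: sumr_ge0 => i _; rewrite -expr2 sqr_ge0. Qed.

Lemma dot_eq0 x : (dot x x == 0) = (x == 0).
Proof.
apply/idP/idP => [|/eqP->]; last by rewrite -(scale0r 0) dotZl mul0r.
rewrite psumr_eq0 => [/allP xx|i _]; last by rewrite -expr2 sqr_ge0.
apply/eqP/rowP => i; rewrite mxE; apply/eqP.
by have := xx i (mem_index_enum _); rewrite mulf_eq0 orbb.
Qed.

Lemma enormE x : enorm x = Num.sqrt (dot x x).
Proof. by congr Num.sqrt; apply: eq_bigr => i _; rewrite expr2. Qed.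

Lemma enorm_ge0 x : 0 <= enorm x. Proof. exact: sqrtr_ge0. Qed.

Lemma sqr_enorm x : enorm x ^+ 2 = dot x x.
Proof. by rewrite enormE sqr_sqrtr// dot_ge0. Qed.

Lemma enorm_eq0 x : (enorm x == 0) = (x == 0).
Proof. by rewrite -sqrf_eq0 sqr_enorm dot_eq0. Qed.

Lemma enorm0 : enorm (0 : 'rV[R]_N) = 0.
Proof. by apply/eqP; rewrite enorm_eq0. Qed.

Lemma enorm_gt0 x : (0 < enorm x) = (x != 0).
Proof. by rewrite lt_def enorm_ge0 andbT enorm_eq0. Qed.

Lemma enormZ c x : enorm (c *: x) = `|c| * enorm x.
Proof.
by rewrite !enormE dotZl dotZr mulrA -expr2 sqrtrM ?sqr_ge0// sqrtr_sqr.
Qed.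

Lemma enormN x : enorm (- x) = enorm x.
Proof. by rewrite -scaleN1r enormZ normrN1 mul1r. Qed.

Lemma enorm_distC x y : enorm (x - y) = enorm (y - x).
Proof. by rewrite -enormN opprB. Qed.

Lemma dot_le_enorm x y : dot x y <= enorm x * enorm y.
Proof.
have [->|y0] := eqVneq y 0.
  by rewrite enorm0 mulr0 -(scale0r 0) dotZr mul0r.
have B0 : 0 < dot y y by rewrite lt_def dot_eq0 y0 dot_ge0.
have : 0 <= dot y y * (dot x x * dot y y - dot x y ^+ 2).
  rewrite [X in 0 <= X](_ : _ =
    dot (dot y y *: x - dot x y *: y) (dot y y *: x - dot x y *: y)) ?dot_ge0//.
  by rewrite !dotBl !dotBr !dotZl !dotZr (dotC y x); ring.
rewrite pmulr_rge0// subr_ge0 => H.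
rewrite (le_trans (ler_norm _))// -(@ler_pXn2r _ 2) ?nnegrE ?mulr_ge0 ?enorm_ge0//.
by rewrite exprMn !sqr_enorm -normrX ger0_norm ?sqr_ge0.
Qed.

Lemma enormD x y : enorm (x + y) <= enorm x + enorm y.
Proof.
rewrite -(@ler_pXn2r _ 2) ?nnegrE ?addr_ge0 ?enorm_ge0//.
rewrite sqr_enorm sqrrD !sqr_enorm dotDl !dotDr (dotC y x).
by have := dot_le_enorm x y; lra.
Qed.

Lemma enorm_lipschitz x y : `|enorm x - enorm y| <= enorm (x - y).
Proof.
have H (a b : 'rV[R]_N) : enorm a - enorm b <= enorm (a - b).
  by rewrite lerBlDr; have := enormD (a - b) b; rewrite subrK.
by rewrite ler_norml lerNl opprB H andbT enorm_distC H.
Qed.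

Lemma coord_le_enorm x i : `|x ord0 i| <= enorm x.
Proof.
rewrite -(@ler_pXn2r _ 2) ?nnegrE ?enorm_ge0// sqr_enorm -normrX ger0_norm ?sqr_ge0//.
rewrite /dot (bigD1 i)//= -expr2 lerDl.
by apply: sumr_ge0 => j _; rewrite -expr2 sqr_ge0.
Qed.

Lemma enorm_le_sum x : enorm x <= \sum_(i < N) `|x ord0 i|.
Proof.
rewrite -(@ler_pXn2r _ 2) ?nnegrE ?enorm_ge0 ?sumr_ge0// sqr_enorm /dot.
suff [//] : 0 <= \sum_(i < N) `|x ord0 i| /\
  \sum_(i < N) x ord0 i * x ord0 i <= (\sum_(i < N) `|x ord0 i|) ^+ 2.
elim/big_ind2: _ => [|a b c d [b0 ab] [d0 cd]|i _]; first by rewrite expr0n.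
- split; first by rewrite addr_ge0.
  by rewrite sqrrD; have := mulr_ge0 b0 d0; lra.
- by split => //; rewrite -expr2 -normrX ger0_norm ?sqr_ge0.
Qed.

(** For [v = 0] the division by zero makes this the identity, so that
    dilations are covered by the statements about similarities. *)
Definition householder v x : 'rV[R]_N := x - (2 * dot x v / dot v v) *: v.

Lemma householder_dot v x y : dot (householder v x) (householder v y) = dot x y.
Proof.
rewrite /householder; have [->|v0] := eqVneq v 0; first by rewrite !scaler0 !subr0.
have B0 : dot v v != 0 by rewrite dot_eq0.
by rewrite !dotBl !dotBr !dotZl !dotZr (dotC v y); field.
Qed.

Lemma enorm_householder v x : enorm (householder v x) = enorm x.
Proof. by rewrite !enormE householder_dot. Qed.

Lemma householderK v : involutive (householder v).
Proof.
move=> x; rewrite {1}/householder; have [->|v0] := eqVneq v 0.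
  by rewrite scaler0 subr0 /householder scaler0 subr0.
have B0 : dot v v != 0 by rewrite dot_eq0.
rewrite /householder dotBl dotZl -addrA -opprD -scalerDl.
rewrite [X in X *: v](_ : _ = 0) ?scale0r ?subr0//.
by field.
Qed.

Lemma householderB v x y : householder v (x - y) = householder v x - householder v y.
Proof.
rewrite /householder dotBl mulrBr mulrBl scalerBl !opprD !opprK.
by rewrite addrACA.
Qed.

Lemma householder_move x y : enorm x = enorm y -> householder (x - y) x = y.
Proof.
move=> xy; rewrite /householder; have [->|v0] := eqVneq x y.
  by rewrite subrr scaler0 subr0.
have E : dot x x = dot y y by rewrite -!sqr_enorm xy.
have -> : 2 * dot x (x - y) = dot (x - y) (x - y).
  by rewrite !dotBl !dotBr (dotC y x) -E; ring.
by rewrite divff ?scale1r ?subKr// dot_eq0 subr_eq0.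
Qed.

End euclid.

Section measurability.
Context {R : realType} {N : nat}.

Lemma measurable_dot d (T : measurableType d) (f g : T -> 'rV[R]_N) :
  measurable_fun setT f -> measurable_fun setT g ->
  measurable_fun setT (fun t => dot (f t) (g t)).
Proof.
move=> /measurable_fun_rVP mf /measurable_fun_rVP mg.
by apply: measurable_sum => i; exact: measurable_funM.
Qed.

Lemma measurable_enorm : measurable_fun setT (@enorm R N).
Proof.
apply: (eq_measurable_fun (fun x => (dot x x) `^ (2^-1))).
  by move=> x _; rewrite enormE powR12_sqrt// dot_ge0.
by apply: (measurableT_comp (measurable_powR _)); apply: measurable_dot; exact: measurable_id.
Qed.

Lemma measurable_rVD d (T : measurableType d) (f g : T -> 'rV[R]_N) :
  measurable_fun setT f -> measurable_fun setT g ->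
  measurable_fun setT (fun t => f t + g t).
Proof.
move=> /measurable_fun_rVP mf /measurable_fun_rVP mg.
apply/measurable_fun_rVP => i; under eq_fun do rewrite mxE.
exact: measurable_funD.
Qed.

Lemma measurable_rVZ d (T : measurableType d) (c : T -> R) (f : T -> 'rV[R]_N) :
  measurable_fun setT c -> measurable_fun setT f ->
  measurable_fun setT (fun t => c t *: f t).
Proof.
move=> mc /measurable_fun_rVP mf.
apply/measurable_fun_rVP => i; under eq_fun do rewrite mxE.
exact: measurable_funM.
Qed.

Lemma measurable_rVB d (T : measurableType d) (f g : T -> 'rV[R]_N) :
  measurable_fun setT f -> measurable_fun setT g ->
  measurable_fun setT (fun t => f t - g t).
Proof.
move=> mf mg; apply: measurable_rVD => //.
rewrite (_ : (fun t => - g t) = (fun t => (-1 : R) *: g t)); last first.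
  by apply/funext => t; rewrite scaleN1r.
exact: measurable_rVZ.
Qed.

Lemma measurable_householder (v : 'rV[R]_N) : measurable_fun setT (householder v).
Proof.
apply: measurable_rVB; first exact: measurable_id.
apply: measurable_rVZ => //.
apply: measurable_funM => //; apply: measurable_funM => //.
by apply: measurable_dot => //; exact: measurable_id.
Qed.

Lemma measurable_box (A : 'I_N -> set R) : (forall i, measurable (A i)) ->
  measurable [set x : 'rV[R]_N | forall i, A i (x ord0 i)].
Proof.
move=> mA; rewrite (_ : [set _ | _] = \bigcap_(i in [set: 'I_N])
  ((fun x : 'rV[R]_N => x ord0 i) @^-1` A i)); last first.
  by apply/seteqP; split => [x Ax i _|x Ax i]; [exact: Ax|exact: (Ax i I)].
apply: fin_bigcap_measurable => // i _.
by rewrite -[X in measurable X]setTI; apply: measurable_rV_coord.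
Qed.

Definition eball (r : R) : set 'rV[R]_N := [set x | enorm x <= r].

Lemma measurable_eball r : measurable (eball r).
Proof.
rewrite -[X in measurable X]setTI.
rewrite (_ : eball r = @enorm R N @^-1` `]-oo, r]); first exact: measurable_enorm.
by apply/seteqP; split => x /=; rewrite in_itv/=.
Qed.

End measurability.

Section invariance.
Context {R : realType} {N : nat}.
Local Open Scope ereal_scope.
Local Notation mu := (@lebesgue_rV R N).
Implicit Types (f g : 'rV[R]_N -> \bar R).

Let cube (d : R) : set 'rV[R]_N :=
  [set x | forall i : 'I_N, `[(- d)%R, d]%classic (x ord0 i)].

Let measurable_cube d : measurable (cube d).
Proof.
by apply: (measurable_box (A := fun=> `[(-d)%R, d]%classic)) => _; exact: measurable_itv.
Qed.

Let lebesgue_cube d : (0 <= d)%R -> mu (cube d) = ((d + d) ^+ N)%:E.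
Proof.
move=> d0; have -> := lebesgue_rV_box (A := fun=> `[(-d)%R, d]%classic)
  (fun=> measurable_itv _).
rewrite (eq_bigr (fun=> (d + d)%:E)) => [|i _].
  by rewrite prodEFin prodr_const card_ord.
rewrite lebesgue_measure_itv/= lte_fin.
case: ifPn => [_|]; first by rewrite -EFinD opprK.
by rewrite -leNgt => ?; congr EFin; lra.
Qed.

Lemma eball_fin r : mu (eball r) < +oo.
Proof.
have [r0|r0] := leP 0%R r; last first.
  rewrite (_ : eball r = set0) ?measure0//.
  by apply/seteqP; split => // x /=; rewrite /eball/= leNgt (lt_le_trans r0)// enorm_ge0.
apply: (@le_lt_trans _ _ (mu (cube r))); last by rewrite lebesgue_cube ?ltry.
apply: le_measure; rewrite ?inE; [exact: measurable_eball|exact: measurable_cube|].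
move=> x xr i; rewrite /= in_itv/= -ler_norml.
exact: (le_trans (coord_le_enorm _ _)).
Qed.

Lemma eball_gt0 r : (0 < r)%R -> 0 < mu (eball r).
Proof.
move=> r0; pose d : R := (r / N.+1%:R)%R.
have d0 : (0 < d)%R by rewrite divr_gt0.
apply: (@lt_le_trans _ _ (mu (cube d))).
  by rewrite lebesgue_cube ?(ltW d0)// lte_fin exprn_gt0// addr_gt0.
apply: le_measure; rewrite ?inE; [exact: measurable_cube|exact: measurable_eball|].
move=> x xd; apply: (le_trans (enorm_le_sum x)).
apply: (@le_trans _ _ (\sum_(i < N) d)%R).
  by apply: ler_sum => i _; have := xd i; rewrite /= in_itv/= -ler_norml.
rewrite sumr_const card_ord -mulr_natl /d mulrC mulrAC -mulrA ler_piMr ?(ltW r0)//.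
by rewrite ler_pdivrMr// mul1r ler_nat.
Qed.

(** Uniqueness of translation invariant measures, for a linear isometry [L]
    that is its own inverse: by Tonelli's theorem the double integral of
    [f x * g (L w - x)] is the integral of [f] times that of [g \o L], and also
    the integral of [g] times that of [f \o L].  If [g] is the indicator of a
    ball then [g \o L = g]. *)
Lemma ge0_integral_householder v f :
  measurable_fun setT f -> (forall x, 0 <= f x) ->
  \int[mu]_x f (householder v x) = \int[mu]_x f x.
Proof.
move=> mf f0; pose L := householder v.
have mL : measurable_fun setT L := measurable_householder v.
have tr g : measurable_fun setT g -> (forall x, 0 <= g x) -> forall a,
    \int[mu]_w g (L w - a)%R = \int[mu]_w g (L w).
  move=> mg g0 a; rewrite -(@ge0_integral_affine _ _ 1 (- L a)%R (g \o L))//.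
  - rewrite normr1 expr1n mul1e; apply: eq_integral => w _ /=.
    by rewrite scale1r /L householderB householderK.
  - exact: measurableT_comp.
  - by move=> x; exact: g0.
have key g : measurable_fun setT g -> (forall x, 0 <= g x) ->
    \int[mu]_x f x * \int[mu]_w g (L w) = \int[mu]_x g x * \int[mu]_w f (L w).
  move=> mg g0.
  pose F (z : 'rV[R]_N * 'rV[R]_N) := f z.1 * g (L z.2 - z.1)%R.
  have mLz : measurable_fun setT (fun z : 'rV[R]_N * 'rV[R]_N => L z.2).
    exact: (measurableT_comp mL measurable_snd).
  have mF : measurable_fun setT F.
    apply: emeasurable_funM; first exact: (measurableT_comp mf measurable_fst).
    apply: (measurableT_comp mg).
    apply: measurable_rVB => //; exact: measurable_fst.
  have mgL : measurable_fun setT (g \o L) by exact: measurableT_comp.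
  have mfL : measurable_fun setT (f \o L) by exact: measurableT_comp.
  transitivity (\int[mu]_x \int[mu]_w F (x, w)).
    rewrite -ge0_integralZr//; last by apply: integral_ge0 => x _; exact: g0.
    apply: eq_integral => x _; rewrite /F/= ge0_integralZl//.
    - by rewrite tr.
    - apply: (measurableT_comp mg); apply: measurable_rVB => //.
  rewrite fubini_tonelli//; last by move=> z; rewrite /F mule_ge0.
  pose G (z : 'rV[R]_N * 'rV[R]_N) := f (L z.1 - z.2)%R * g z.2.
  have mG : measurable_fun setT G.
    apply: emeasurable_funM; last exact: (measurableT_comp mg measurable_snd).
    apply: (measurableT_comp mf); apply: measurable_rVB; last exact: measurable_snd.
    exact: (measurableT_comp mL measurable_fst).
  transitivity (\int[mu]_w \int[mu]_x G (w, x)).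
    apply: eq_integral => w _.
    rewrite -(@ge0_integral_affine _ _ (-1) (L w) (fun x => F (x, w))).
    - rewrite normrN1 expr1n mul1e; apply: eq_integral => x _.
      by rewrite /F /G/= scaleN1r (addrC (- x)%R) subKr.
    - by rewrite oppr_eq0 oner_eq0.
    - exact: measurable_fun_pair1.
    - by move=> x; rewrite /F mule_ge0.
  rewrite fubini_tonelli//; last by move=> z; rewrite /G mule_ge0.
  rewrite -ge0_integralZr//; last by apply: integral_ge0 => x _; exact: f0.
  apply: eq_integral => x _; rewrite /G/= ge0_integralZr//.
  - by rewrite tr// muleC.
  - apply: (measurableT_comp mf); apply: measurable_rVB => //.
have k1 : \int[mu]_x (\1_(eball 1) x)%:E = mu (eball 1) :> \bar R.
  by rewrite integral_indic ?setIT//; exact: measurable_eball.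
have k2 : \int[mu]_x (\1_(eball 1) (L x))%:E = mu (eball 1) :> \bar R.
  rewrite -k1; apply: eq_integral => x _ /=.
  have -> // : \1_(eball 1) (L x) = \1_(eball 1) x :> R.
  rewrite !indicE (_ : (L x \in eball 1) = (x \in eball 1))//.
  by apply/idP/idP; rewrite !inE /eball/= enorm_householder.
have fin1 : mu (eball 1) \is a fin_num by rewrite ge0_fin_numE ?eball_fin.
have p0 : 0 < mu (eball 1) by exact: eball_gt0.
have := key (EFin \o \1_(eball 1)) _ _; rewrite k1 k2 muleC => H.
have {H} : mu (eball 1) * \int[mu]_x f x = mu (eball 1) * \int[mu]_w f (L w).
  apply: H => [|x]; last by rewrite lee_fin.
  by apply/measurable_EFinP/measurable_indic; exact: measurable_eball.
by move=> H; apply/eqP; rewrite eq_le; apply/andP; split; rewrite -(lee_pmul2l fin1 p0) H.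
Qed.

End invariance.

(** * Volumes of balls and integrability of radial powers *)

Lemma dim_gt0 (R : realType) (N : nat) (s : R) : 0 < s -> 2 * s < N%:R -> (0 < N)%N.
Proof.
move=> s0; apply: contraTT; rewrite -eqn0Ngt => /eqP ->.
by rewrite -leNgt mulr_ge0// ltW.
Qed.

Section radial.
Context {R : realType} {N : nat}.
Local Notation mu := (@lebesgue_rV R N).
Implicit Types (f g : 'rV[R]_N -> \bar R).

Lemma ge0_integral_similarity (t : R) v f : 0 < t ->
  measurable_fun setT f -> (forall x, 0 <= f x)%E ->
  ((t ^+ N)%:E * \int[mu]_x f (t *: householder v x)%R = \int[mu]_x f x)%E.
Proof.
move=> t0 mf f0; have t1 : t != 0 by rewrite gt_eqF.
rewrite -[RHS](ge0_integral_affine 0 t1 mf f0) gtr0_norm//; congr (_ * _)%E.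
rewrite -(ge0_integral_householder v (f := fun x => f (t *: x + 0))) => //.
- by apply: eq_integral => x _; rewrite addr0.
- exact: (measurableT_comp mf (measurable_rV_affine t 0)).
Qed.

Lemma ge0_integral_translation (a : 'rV[R]_N) f :
  measurable_fun setT f -> (forall x, 0 <= f x)%E ->
  (\int[mu]_x f (a - x)%R = \int[mu]_x f x)%E.
Proof.
move=> mf f0; rewrite -[RHS](ge0_integral_affine (c := -1) a _ mf f0).
  rewrite normrN1 expr1n mul1e; apply: eq_integral => x _.
  by rewrite scaleN1r addrC.
by rewrite oppr_eq0 oner_eq0.
Qed.

Lemma integral_eball r : (\int[mu]_x (\1_(eball r) x)%:E = mu (eball r))%E.
Proof. by rewrite integral_indic ?setIT//; exact: measurable_eball. Qed.

Lemma eball_scale r : 0 < r -> (mu (eball r) = (r ^+ N)%:E * mu (eball 1))%E.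
Proof.
move=> r0; have r1 : r != 0 by rewrite gt_eqF.
rewrite -!integral_eball -(ge0_integral_affine 0 r1).
- rewrite gtr0_norm//; congr (_ * _)%E; apply: eq_integral => x _.
  rewrite addr0 !indicE (_ : (r *: x \in eball r) = (x \in eball 1))//.
  apply/idP/idP; rewrite !inE /eball/= enormZ gtr0_norm//.
    by rewrite -{2}(mulr1 r) ler_pM2l.
  by move=> ?; rewrite -{2}(mulr1 r) ler_pM2l.
- by apply/measurable_EFinP/measurable_indic; exact: measurable_eball.
- by move=> x; rewrite lee_fin.
Qed.

Definition vol1 : R := fine (mu (eball 1)).

Lemma vol1_gt0 : 0 < vol1.
Proof. by rewrite fine_gt0// eball_gt0// eball_fin. Qed.

Lemma eballE r : 0 < r -> (mu (eball r) = (r ^+ N * vol1)%:E)%E.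
Proof.
by move=> r0; rewrite eball_scale// EFinM fineK// ge0_fin_numE ?eball_fin.
Qed.

Lemma measurable_set1_rV (a : 'rV[R]_N) : measurable [set a].
Proof.
rewrite (_ : [set a] = [set x : 'rV[R]_N | forall i, [set a ord0 i] (x ord0 i)]).
  by apply: (measurable_box (A := fun i => [set a ord0 i])) => i; exact: measurable_set1.
apply/seteqP; split => [x ->//|x /= xa].
by apply/rowP => i; exact: xa.
Qed.

Lemma lebesgue_rV_set1 (a : 'rV[R]_N) : (0 < N)%N -> (mu [set a] = 0)%E.
Proof.
move=> N0.
rewrite (_ : [set a] = [set x : 'rV[R]_N | forall i, [set a ord0 i] (x ord0 i)]).
  rewrite (lebesgue_rV_box (A := fun i => [set a ord0 i])) => [|i]; last exact: measurable_set1.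
  by rewrite (bigD1 (Ordinal N0))//= lebesgue_measure_set1 mul0e.
apply/seteqP; split => [x ->//|x /= xa].
by apply/rowP => i; exact: xa.
Qed.

(** Domination by a sum of indicators of balls whose integrals form a geometric
    series; with dyadic radii this takes the place of polar coordinates. *)
Lemma integral_dyadic_fin (f : 'rV[R]_N -> R) (c r : nat -> R) (C q : R) :
  measurable_fun setT f -> (forall x, 0 <= f x) ->
  (forall k, 0 <= c k) -> (forall k, 0 < r k) ->
  (forall x, f x = 0 \/ exists2 k, f x <= c k & enorm x <= r k) ->
  0 <= q < 1 -> (forall k, c k * r k ^+ N <= C * q ^+ k) ->
  (\int[mu]_x (f x)%:E < +oo)%E.
Proof.
move=> mf f0 c0 r0 fcr /andP[q0 q1] crq.
pose g k (x : 'rV[R]_N) : \bar R := (c k * \1_(eball (r k)) x)%:E.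
have mg k : measurable_fun setT (g k).
  apply/measurable_EFinP; apply: measurable_funM => //.
  by apply: measurable_indic; exact: measurable_eball.
have g0 k x : (0 <= g k x)%E by rewrite lee_fin mulr_ge0.
have S0 x : (0 <= \sum_(k <oo) g k x)%E by apply: nneseries_ge0.
apply: (@le_lt_trans _ _ (\int[mu]_x \sum_(k <oo) g k x)%E).
  apply: ge0_le_integral => //.
  - by move=> x _; rewrite lee_fin.
  - exact/measurable_EFinP.
  - by apply: ge0_emeasurable_sum => // k x _ _; exact: g0.
  - move=> x _; have [->//|[k fc xr]] := fcr x.
    apply: (@le_trans _ _ (g k x)).
      by rewrite /g lee_fin indicE mem_set ?mulr1.
    apply: le_trans (@nneseries_lim_ge _ (g ^~ x) xpredT 0 k.+1 _) => //.
    by rewrite big_nat_recr//= leeDr// sume_ge0.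
rewrite integral_nneseries//.
have E k : (\int[mu]_x g k x = (c k * (r k ^+ N * vol1))%:E)%E.
  rewrite /g; under eq_integral do rewrite EFinM.
  rewrite ge0_integralZl//; last 2 first.
  - by apply/measurable_EFinP/measurable_indic; exact: measurable_eball.
  - by rewrite lee_fin.
  by rewrite integral_eball eballE// -EFinM.
under eq_eseriesr do rewrite E.
have qq : `|q| < 1 by rewrite ger0_norm.
have cv := @cvg_geometric_series R (C * vol1) q qq.
apply: (@le_lt_trans _ _ ((C * vol1) * (1 - q)^-1)%:E); last exact: ltry.
apply: (@le_trans _ _ (\sum_(k <oo) (geometric (C * vol1) q k)%:E)%E).
  apply: lee_nneseries => k *.
    by rewrite lee_fin !mulr_ge0 ?exprn_ge0// ?(ltW (r0 _)) ?(ltW vol1_gt0)//.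
  by rewrite lee_fin /geometric/= mulrA [X in _ <= X]mulrAC ler_pM2r ?vol1_gt0// crq.
rewrite le_eqVlt; apply/orP; left; apply/eqP.
apply: cvg_lim => //.
rewrite (_ : (fun n => _) = EFin \o series (geometric (C * vol1) q)).
  by apply: cvg_EFin; [exact: nearW|exact: cv].
by apply/funext => n /=; rewrite /series/= sumEFin.
Qed.

Lemma dyadic_ge1 (M : R) : 1 <= M -> exists k : nat, 2 ^+ k <= M < 2 ^+ k.+1.
Proof.
move=> M1.
have ex : exists k, M < 2 ^+ k.+1.
  have [k Mk] : exists k, M < k%:R by exists (Num.truncn M).+1; rewrite truncnS_gt.
  exists k; apply: (lt_trans Mk).
  by rewrite -natrX ltr_nat (ltn_trans (ltn_expl k (ltnSn 1)))// ltn_exp2l.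
exists (ex_minn ex); case: ex_minnP => k Mk kmin; rewrite Mk andbT.
case: k Mk kmin => [|k] Mk kmin; first by rewrite expr0.
by rewrite leNgt; apply/negP => /kmin; rewrite ltnn.
Qed.

Lemma powR_exp (a b : R) n : 0 <= a -> (a ^+ n) `^ b = (a `^ b) ^+ n.
Proof.
by move=> a0; rewrite -(powR_mulrn n a0) -(powR_mulrn n (powR_ge0 a b)) powRAC.
Qed.

Lemma ler_dist_bound (a b M : R) : 0 <= a -> a <= M -> 0 <= b -> b <= M -> `|a - b| <= M.
Proof. by move=> *; rewrite ler_norml; apply/andP; split; lra. Qed.

Lemma ler_powRN (a b c : R) : 0 <= c -> 0 < a -> a <= b -> b `^ (- c) <= a `^ (- c).
Proof.
move=> c0 a0 ab; have b0 := lt_le_trans a0 ab.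
rewrite !powRN lef_pV2 ?posrE ?powR_gt0//.
by apply: ge0_ler_powR => //; rewrite nnegrE ltW.
Qed.

Lemma ratio_lt1 (a : R) : a < N%:R -> 0 <= 2 `^ a / 2 ^+ N < 1.
Proof.
move=> aN; rewrite divr_ge0 ?powR_ge0 ?exprn_ge0//=.
rewrite ltr_pdivrMr ?exprn_gt0// mul1r -powR_mulrn//.
by rewrite /powR ?gt_eqF// ltr_expR ltr_pM2r// ln_gt0// ltr1n.
Qed.

(** The maximum with [1] removes the singularity at the origin and leaves the
    behaviour at infinity. *)
Definition tail_weight (b : R) (x : 'rV[R]_N) : R := (Num.max 1 (enorm x)) `^ (- b).

Lemma measurable_max_enorm (r : R) :
  measurable_fun setT (fun x : 'rV[R]_N => Num.max r (enorm x)).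
Proof. by apply: measurable_maxr => //; exact: measurable_enorm. Qed.

Lemma measurable_tail_weight b : measurable_fun setT (tail_weight b).
Proof. exact: (measurableT_comp (measurable_powR _) (measurable_max_enorm 1)). Qed.

Lemma tail_weight_ge0 b x : 0 <= tail_weight b x. Proof. exact: powR_ge0. Qed.

Lemma tail_weight_fin b : N%:R < b -> (\int[mu]_x (tail_weight b x)%:E < +oo)%E.
Proof.
move=> bN; have b0 : 0 < b by apply: le_lt_trans bN.
apply: (@integral_dyadic_fin _ (fun k => (2 `^ (- b)) ^+ k) (fun k => 2 ^+ k.+1)
  (2 ^+ N) (2 `^ (- b) * 2 ^+ N)).
- exact: measurable_tail_weight.
- exact: tail_weight_ge0.
- by move=> k; rewrite exprn_ge0// powR_ge0.
- by move=> k; rewrite exprn_gt0.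
- move=> x; right.
  have [|k /andP[k1 k2]] := @dyadic_ge1 (Num.max 1 (enorm x)); first by rewrite le_max lexx.
  exists k; last by rewrite (le_trans _ (ltW k2))// le_max lexx orbT.
  by rewrite /tail_weight -powR_exp// ler_powRN ?exprn_gt0// ltW.
- rewrite mulr_ge0 ?powR_ge0 ?exprn_ge0//= powRN mulrC ltr_pdivrMr ?powR_gt0// mul1r.
  rewrite -powR_mulrn//.
  by rewrite /powR ?gt_eqF// ltr_expR ltr_pM2r// ln_gt0// ltr1n.
- move=> k.
  have -> : (2 ^+ k.+1) ^+ N = 2 ^+ N * (2 ^+ N) ^+ k :> R.
    by rewrite -!exprM -exprD mulSn (mulnC k).
  by rewrite [in leRHS]exprMn mulrCA.
Qed.

(** At the origin, where [0 `^ (- a) = 0] for [a != 0], no dyadic shell is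
    needed. *)
Lemma inner_power_fin a : a < N%:R ->
  (\int[mu]_x (enorm x `^ (- a) * \1_(eball 1) x)%:E < +oo)%E.
Proof.
move=> aN.
have mf : measurable_fun setT (fun x : 'rV[R]_N => enorm x `^ (- a) * \1_(eball 1) x).
  apply: measurable_funM.
    exact: (measurableT_comp (measurable_powR _) measurable_enorm).
  by apply: measurable_indic; exact: measurable_eball.
have f0 (x : 'rV[R]_N) : 0 <= enorm x `^ (- a) * \1_(eball 1) x.
  by rewrite mulr_ge0// powR_ge0.
have [a0|a0] := leP a 0.
  apply: (@le_lt_trans _ _ (\int[mu]_x (\1_(eball 1) x)%:E)%E); last first.
    by rewrite integral_eball eball_fin.
  apply: ge0_le_integral => //.
  - by move=> x _; rewrite lee_fin.
  - exact/measurable_EFinP.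
  - by apply/measurable_EFinP/measurable_indic; exact: measurable_eball.
  - move=> x _; rewrite lee_fin indicE; case: (boolP (x \in eball 1)); last by rewrite mulr0.
    rewrite inE /eball/= mulr1 => x1.
    have := @ge0_ler_powR _ (- a) _ (enorm x) 1; rewrite powR1; apply => //.
    + by rewrite oppr_ge0.
    + by rewrite nnegrE enorm_ge0.
    + by rewrite nnegrE.
apply: (@integral_dyadic_fin _ (fun k => (2 `^ a) ^+ k.+1) (fun k => 2^-1 ^+ k)
  (2 `^ a) (2 `^ a / 2 ^+ N)); [exact: mf|exact: f0|..].
- by move=> k; rewrite exprn_ge0// powR_ge0.
- by move=> k; rewrite exprn_gt0// invr_gt0.
- move=> x; rewrite indicE; have [|x1] := boolP (x \in eball 1); last by left; rewrite mulr0.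
  rewrite inE /eball/= mulr1 => x1.
  have [->|x0] := eqVneq x 0.
    by left; rewrite enorm0 powR0// oppr_eq0 gt_eqF.
  right; have e0 : 0 < enorm x by rewrite enorm_gt0.
  have [|k /andP[k1 k2]] := @dyadic_ge1 (enorm x)^-1; first by rewrite invf_ge1.
  exists k.
    rewrite powRN -powR_inv1 ?powR_ge0// powRAC powR_inv1 ?(ltW e0)// -powR_exp//.
    apply: (ge0_ler_powR (ltW a0)); [by rewrite nnegrE invr_ge0 ltW|
      by rewrite nnegrE exprn_ge0|exact: ltW].
  by rewrite exprVn -[enorm x]invrK lef_pV2 ?posrE ?exprn_gt0// invr_gt0.
- exact: ratio_lt1.
- move=> k; rewrite exprS -mulrA ler_pM2l ?powR_gt0// exprMn exprVn.
  by rewrite -exprVn -!exprM mulnC exprM exprVn.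
Qed.

End radial.

(** * The kernel and the energy of compactly supported Lipschitz functions *)

Section real_integrals.
Context d (T : measurableType d) (R : realType) (m : {measure set T -> \bar R}).
Implicit Types f g : T -> R.

Lemma le_intR f g : measurable_fun setT f -> measurable_fun setT g ->
  (forall x, 0 <= f x) -> (forall x, f x <= g x) ->
  (\int[m]_x (f x)%:E <= \int[m]_x (g x)%:E)%E.
Proof.
move=> mf mg f0 fg; apply: ge0_le_integral => //.
- by move=> x _; rewrite lee_fin.
- exact/measurable_EFinP.
- exact/measurable_EFinP.
- by move=> x _; rewrite lee_fin.
Qed.

Lemma intRZ (c : R) f : measurable_fun setT f -> (forall x, 0 <= f x) -> 0 <= c ->
  (\int[m]_x (c * f x)%:E = c%:E * \int[m]_x (f x)%:E)%E.
Proof.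
move=> mf f0 c0; under eq_integral do rewrite EFinM.
rewrite ge0_integralZl//; first exact/measurable_EFinP.
by move=> x _; rewrite lee_fin.
Qed.

Lemma intRD f g : measurable_fun setT f -> measurable_fun setT g ->
  (forall x, 0 <= f x) -> (forall x, 0 <= g x) ->
  (\int[m]_x (f x + g x)%:E = \int[m]_x (f x)%:E + \int[m]_x (g x)%:E)%E.
Proof.
move=> mf mg f0 g0; under eq_integral do rewrite EFinD.
rewrite ge0_integralD//.
- by move=> x _; rewrite lee_fin.
- exact/measurable_EFinP.
- by move=> x _; rewrite lee_fin.
- exact/measurable_EFinP.
Qed.

Lemma intR_ge0 f : (forall x, 0 <= f x) -> (0 <= \int[m]_x (f x)%:E)%E.
Proof. by move=> f0; apply: integral_ge0 => x _; rewrite lee_fin. Qed.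

Lemma intR_fineK f : (forall x, 0 <= f x) -> (\int[m]_x (f x)%:E < +oo)%E ->
  (\int[m]_x (f x)%:E = (fine (\int[m]_x (f x)%:E))%:E)%E.
Proof. by move=> f0 foo; rewrite fineK// ge0_fin_numE// intR_ge0. Qed.

Lemma integrable_dom f g : measurable_fun setT f -> measurable_fun setT g ->
  (forall x, `|f x| <= g x) -> (\int[m]_x (g x)%:E < +oo)%E ->
  m.-integrable setT (EFin \o f).
Proof.
move=> mf mg fg goo; apply/integrableP; split; first exact/measurable_EFinP.
apply: le_lt_trans goo; apply: ge0_le_integral => //.
- exact/measurable_EFinP/measurableT_comp.
- exact/measurable_EFinP.
- by move=> x _; rewrite lee_fin.
Qed.

Lemma intR_indic_gt0 (A : set T) g :
  measurable A -> measurable_fun setT g -> (forall x, 0 < g x) ->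
  (0 < \int[m]_x (\1_A x)%:E)%E -> (0 < \int[m]_x (\1_A x * g x)%:E)%E.
Proof.
move=> mA mg g0 Apos.
have mf : measurable_fun setT (fun x => \1_A x * g x).
  by apply: measurable_funM => //; exact: measurable_indic.
have f0 x : 0 <= \1_A x * g x by rewrite mulr_ge0// ltW.
rewrite lt_def intR_ge0// andbT; apply: contraTneq Apos => fz.
rewrite -leNgt le_eqVlt; apply/orP; left; apply/eqP.
have mfE : measurable_fun setT (EFin \o (fun x => \1_A x * g x)) by exact/measurable_EFinP.
have fa : (\int[m]_x `|(EFin \o (fun x => (\1_A x * g x)%R)) x| = 0)%E.
  by rewrite -[RHS]fz; apply: eq_integral => x _; rewrite gee0_abs ?lee_fin.
have fae := (ae_eq_integral_abs m measurableT mfE).1 fa.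
rewrite -[RHS](integral0 m setT); apply: ae_eq_integral => //.
  by apply/measurable_EFinP; exact: measurable_indic.
apply: filterS fae => x /(_ I) /= [] /eqP; rewrite mulf_eq0 (gt_eqF (g0 x)) orbF.
by move=> /eqP ->.
Qed.

End real_integrals.

Section pairs.
Context {R : realType} {N : nat}.
Local Notation X := 'rV[R]_N.
Local Notation mu := (@lebesgue_rV R N).

Lemma intR_swap (F : X * X -> R) : measurable_fun setT F -> (forall z, 0 <= F z) ->
  (\int[mu \x mu]_z (F (z.2, z.1))%:E = \int[mu \x mu]_z (F z)%:E)%E.
Proof.
move=> mF F0.
rewrite (fubini_tonelli1 (fun z : X * X => (F (z.2, z.1))%:E)); last 2 first.
- apply/measurable_EFinP; apply: (measurableT_comp mF).
  by apply: measurable_fun_pair; [exact: measurable_snd|exact: measurable_fst].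
- by move=> z; rewrite lee_fin.
by rewrite (fubini_tonelli2 (EFin \o F))//; exact/measurable_EFinP.
Qed.

Lemma measurable_fst_comp (f : X -> R) : measurable_fun setT f ->
  measurable_fun setT (fun z : X * X => f z.1).
Proof. by move=> mf; exact: (measurableT_comp mf measurable_fst). Qed.

Lemma measurable_snd_comp (f : X -> R) : measurable_fun setT f ->
  measurable_fun setT (fun z : X * X => f z.2).
Proof. by move=> mf; exact: (measurableT_comp mf measurable_snd). Qed.

Lemma measurable_diff_comp (f : X -> R) : measurable_fun setT f ->
  measurable_fun setT (fun z : X * X => f (z.1 - z.2)).
Proof.
move=> mf; apply: (measurableT_comp mf).
by apply: measurable_rVB; [exact: measurable_fst|exact: measurable_snd].
Qed.

Lemma intR_pair_fst (a b : X -> R) : measurable_fun setT a -> measurable_fun setT b ->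
  (forall x, 0 <= a x) -> (forall x, 0 <= b x) ->
  (\int[mu \x mu]_z (a z.1 * b (z.1 - z.2))%:E =
   (\int[mu]_x (a x)%:E) * (\int[mu]_x (b x)%:E))%E.
Proof.
move=> ma mb a0 b0.
have B0 : (0 <= \int[mu]_x (b x)%:E)%E by exact: intR_ge0.
rewrite (fubini_tonelli1 (fun z : X * X => (a z.1 * b (z.1 - z.2))%:E)); last 2 first.
- apply/measurable_EFinP; apply: measurable_funM.
    exact: measurable_fst_comp.
  exact: measurable_diff_comp.
- by move=> z; rewrite lee_fin mulr_ge0.
rewrite -ge0_integralZr//; last 2 first.
- exact/measurable_EFinP.
- by move=> x _; rewrite lee_fin.
apply: eq_integral => x _; rewrite /fubini_F/=.
rewrite intRZ//; last first.
  apply: (measurableT_comp mb); apply: measurable_rVB;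
    [exact: measurable_cst|exact: measurable_id].
congr (_ * _)%E; apply: (ge0_integral_translation x (f := EFin \o b)).
- exact/measurable_EFinP.
- by move=> y; rewrite lee_fin.
Qed.

Lemma intR_pair_snd (a b : X -> R) : measurable_fun setT a -> measurable_fun setT b ->
  (forall x, 0 <= a x) -> (forall x, 0 <= b x) -> (forall x, b (- x) = b x) ->
  (\int[mu \x mu]_z (a z.2 * b (z.1 - z.2))%:E =
   (\int[mu]_x (a x)%:E) * (\int[mu]_x (b x)%:E))%E.
Proof.
move=> ma mb a0 b0 bN; rewrite -intR_pair_fst//.
rewrite -[RHS]intR_swap; last 2 first.
- apply: measurable_funM; first exact: measurable_fst_comp.
  exact: measurable_diff_comp.
- by move=> z; rewrite mulr_ge0.
by apply: eq_integral => z _ /=; rewrite -bN opprB.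
Qed.

Lemma intR_prod (a b : X -> R) : measurable_fun setT a -> measurable_fun setT b ->
  (forall x, 0 <= a x) -> (forall x, 0 <= b x) ->
  (\int[mu \x mu]_z (a z.1 * b z.2)%:E =
   (\int[mu]_x (a x)%:E) * (\int[mu]_x (b x)%:E))%E.
Proof.
move=> ma mb a0 b0.
have B0 : (0 <= \int[mu]_x (b x)%:E)%E by exact: intR_ge0.
rewrite (fubini_tonelli1 (fun z : X * X => (a z.1 * b z.2)%:E)); last 2 first.
- apply/measurable_EFinP; apply: measurable_funM.
    exact: measurable_fst_comp.
  exact: measurable_snd_comp.
- by move=> z; rewrite lee_fin mulr_ge0.
rewrite -ge0_integralZr//; last 2 first.
- exact/measurable_EFinP.
- by move=> x _; rewrite lee_fin.
by apply: eq_integral => x _; rewrite /fubini_F/= intRZ.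
Qed.

End pairs.

Section kernel.
Context {R : realType} {N : nat} (s : R).
Hypotheses (s_gt0 : 0 < s) (s_lt1 : s < 1).
Local Notation X := 'rV[R]_N.
Local Notation mu := (@lebesgue_rV R N).

Definition kexp : R := N%:R + 2 * s.
Definition kern (z : X) : R := (enorm z `^ kexp)^-1.

Let kexp_gt0 : 0 < kexp.
Proof. by rewrite /kexp ltr_wpDl// mulr_gt0. Qed.

Lemma kern_ge0 z : 0 <= kern z. Proof. by rewrite invr_ge0 powR_ge0. Qed.

Lemma kern0 : kern 0 = 0.
Proof. by rewrite /kern enorm0 powR0 ?invr0// gt_eqF. Qed.

Lemma kernN z : kern (- z) = kern z. Proof. by rewrite /kern enormN. Qed.

Lemma kernE z : kern z = enorm z `^ (- kexp). Proof. by rewrite /kern powRN. Qed.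

Lemma kernC (x y : X) : kern (x - y) = kern (y - x).
Proof. by rewrite -kernN opprB. Qed.

Lemma measurable_kern : measurable_fun setT kern.
Proof.
rewrite (_ : kern = (fun z => enorm z `^ (- kexp))); last exact/funext/kernE.
exact: (measurableT_comp (measurable_powR _) measurable_enorm).
Qed.

Lemma kern_similarity (t : R) v x y : 0 < t ->
  kern (t *: householder v x - t *: householder v y) = t `^ (- kexp) * kern (x - y).
Proof.
move=> t0; rewrite !kernE -scalerBr -householderB enormZ enorm_householder.
by rewrite gtr0_norm// powRM ?enorm_ge0// ltW.
Qed.

Lemma kern_le (r : R) z : 0 < r -> r <= enorm z -> kern z <= r `^ (- kexp).
Proof. by move=> r0 rz; rewrite kernE ler_powRN// ltW. Qed.

Lemma kern_ge (r : R) z : z != 0 -> enorm z <= r -> r `^ (- kexp) <= kern z.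
Proof. by move=> z0 rz; rewrite kernE ler_powRN ?enorm_gt0// ltW. Qed.

(** The kernel weighted by a bound for the product of the increments of two
    functions that are Lipschitz at short distance and grow at most like the power [b]. *)
Definition jump_weight (b : R) (z : X) : R := Num.min (enorm z ^+ 2) (enorm z `^ b) * kern z.

Lemma jump_weight_ge0 b z : 0 <= jump_weight b z.
Proof. by rewrite mulr_ge0 ?kern_ge0// le_min exprn_ge0 ?enorm_ge0// powR_ge0. Qed.

Lemma jump_weightN b z : jump_weight b (- z) = jump_weight b z.
Proof. by rewrite /jump_weight enormN kernN. Qed.

Lemma measurable_jump_weight b : measurable_fun setT (jump_weight b).
Proof.
apply: measurable_funM; last exact: measurable_kern.
apply: measurable_minr.
  by apply: measurable_funX; exact: measurable_enorm.
exact: (measurableT_comp (measurable_powR _) measurable_enorm).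
Qed.

Lemma jump_weight_fin b : b < 2 * s -> (\int[mu]_x (jump_weight b x)%:E < +oo)%E.
Proof.
move=> b2s.
pose f (x : X) := enorm x `^ (- (kexp - 2)) * \1_(eball 1) x.
have mf : measurable_fun setT f.
  apply: measurable_funM.
    exact: (measurableT_comp (measurable_powR _) measurable_enorm).
  by apply: measurable_indic; exact: measurable_eball.
apply: (@le_lt_trans _ _ (\int[mu]_x (f x + tail_weight (kexp - b) x)%:E)%E).
  apply: le_intR.
  - exact: measurable_jump_weight.
  - by apply: measurable_funD => //; exact: measurable_tail_weight.
  - exact: jump_weight_ge0.
  move=> x; have [->|x0] := eqVneq x 0.
    rewrite /jump_weight kern0 mulr0 addr_ge0 ?tail_weight_ge0// /f mulr_ge0// powR_ge0//.
  have e0 : 0 < enorm x by rewrite enorm_gt0.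
  have [x1|x1] := leP (enorm x) 1.
    apply: (@le_trans _ _ (f x)); last by rewrite lerDl tail_weight_ge0.
    rewrite /f indicE mem_set ?mulr1//.
    rewrite /jump_weight kernE opprB powRD; last by rewrite (gt_eqF e0) implybT.
    rewrite powR_mulrn ?enorm_ge0// ler_wpM2r ?powR_ge0//.
    by rewrite ge_min lexx.
  apply: (@le_trans _ _ (tail_weight (kexp - b) x)); last first.
    by rewrite lerDr /f mulr_ge0// powR_ge0.
  rewrite /tail_weight max_r ?(ltW x1)// opprB powRD; last by rewrite (gt_eqF e0) implybT.
  by rewrite /jump_weight kernE ler_wpM2r ?powR_ge0// ge_min lexx orbT.
rewrite intRD//.
- rewrite lte_add_pinfty//.
    by apply: inner_power_fin; rewrite /kexp ltrBlDr ltrD2l; have := s_lt1; lra.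
  by apply: tail_weight_fin; rewrite /kexp -addrA ltrDl; lra.
- exact: measurable_tail_weight.
- by move=> x; rewrite /f mulr_ge0// powR_ge0.
- exact: tail_weight_ge0.
Qed.

Definition jump_mass : R := fine (\int[mu]_x (jump_weight 0 x)%:E).

Lemma jump_mass_ge0 : 0 <= jump_mass.
Proof. by rewrite fine_ge0// intR_ge0// => x; exact: jump_weight_ge0. Qed.

Lemma jump_weight0_scale (r : R) : 0 < r ->
  (\int[mu]_x (Num.min 1 ((enorm x / r) ^+ 2) * kern x)%:E =
   (r `^ (- (2 * s)) * jump_mass)%:E)%E.
Proof.
move=> r0.
have mf : measurable_fun setT (fun x : X => Num.min 1 ((enorm x / r) ^+ 2) * kern x).
  apply: measurable_funM; last exact: measurable_kern.
  apply: measurable_minr => //; apply: measurable_funX; apply: measurable_funM => //.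
  exact: measurable_enorm.
rewrite -(ge0_integral_similarity 0 r0 (f := fun x => (Num.min 1 ((enorm x / r) ^+ 2) * kern x)%:E)).
- have -> : (r `^ (- (2 * s)) * jump_mass)%:E =
      ((r `^ (- (2 * s)))%:E * \int[mu]_x (jump_weight 0 x)%:E)%E.
    rewrite EFinM [in RHS]intR_fineK// ?jump_weight_fin// ?mulr_gt0// => x.
    exact: jump_weight_ge0.
  have E (x : X) : Num.min 1 ((enorm (r *: householder 0 x) / r) ^+ 2) *
      kern (r *: householder 0 x) = r `^ (- kexp) * jump_weight 0 x.
    rewrite -[r *: _]subr0 -[X in _ - X](_ : r *: householder 0 0 = 0); last first.
      by rewrite /householder scaler0 subr0 scaler0.
    rewrite kern_similarity// subr0 /jump_weight powRr0 minC mulrCA; congr (_ * (Num.min _ _ * _)).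
    rewrite -scalerBr -householderB subr0 enormZ enorm_householder gtr0_norm//.
    by rewrite mulrAC divff ?mul1r// gt_eqF.
  under eq_integral do rewrite E.
  rewrite intRZ//; last 3 first.
  - exact: measurable_jump_weight.
  - exact: jump_weight_ge0.
  - exact: powR_ge0.
  rewrite muleA -EFinM; congr (_%:E * _)%E.
  rewrite -powR_mulrn ?(ltW r0)// -powRD; last by rewrite (gt_eqF r0) implybT.
  by congr (_ `^ _); rewrite /kexp; ring.
- exact/measurable_EFinP.
- move=> x; rewrite lee_fin mulr_ge0 ?kern_ge0// le_min ler01/= exprn_ge0//.
  by rewrite divr_ge0 ?enorm_ge0// ltW.
Qed.

Definition lipschitz_energy_const : R := 2 * 2 ^+ N * @vol1 R N * jump_mass.

Lemma lipschitz_energy_const_ge0 : 0 <= lipschitz_energy_const.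
Proof.
by rewrite !mulr_ge0 ?jump_mass_ge0 ?exprn_ge0//; exact/ltW/vol1_gt0.
Qed.

(** One length [r] measures both the support and the Lipschitz constant, so the
    dependence on [r] is given by scaling alone. *)
Lemma gagliardo_lipschitz (phi : X -> R) (r M : R) : 0 < r ->
  measurable_fun setT phi ->
  (forall x y, `|phi x - phi y| ^+ 2 <= M ^+ 2 * Num.min 1 ((enorm (x - y) / r) ^+ 2)) ->
  (forall x, 2 * r < enorm x -> phi x = 0) ->
  (gagliardo_seminorm2 s phi <= (lipschitz_energy_const * M ^+ 2 * r `^ (N%:R - 2 * s))%:E)%E.
Proof.
move=> r0 mphi lip supp.
pose g (z : X) := Num.min 1 ((enorm z / r) ^+ 2) * kern z.
have g0 z : 0 <= g z.
  rewrite mulr_ge0 ?kern_ge0// le_min ler01/= exprn_ge0//.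
  by rewrite divr_ge0 ?enorm_ge0// ltW.
have gN z : g (- z) = g z by rewrite /g enormN kernN.
have mg : measurable_fun setT g.
  apply: measurable_funM; last exact: measurable_kern.
  apply: measurable_minr => //; apply: measurable_funX; apply: measurable_funM => //.
  exact: measurable_enorm.
have mi : measurable_fun setT (\1_(eball (2 * r)) : X -> R).
  by apply: measurable_indic; exact: measurable_eball.
have m1 : measurable_fun setT (fun z : X * X => M ^+ 2 * \1_(eball (2 * r)) z.1 * g (z.1 - z.2)).
  apply: measurable_funM; last exact: measurable_diff_comp.
  by apply: measurable_funM => //; exact: measurable_fst_comp.
have m2 : measurable_fun setT (fun z : X * X => M ^+ 2 * \1_(eball (2 * r)) z.2 * g (z.1 - z.2)).
  apply: measurable_funM; last exact: measurable_diff_comp.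
  by apply: measurable_funM => //; exact: measurable_snd_comp.
apply: (@le_trans _ _ (\int[mu \x mu]_z
  (M ^+ 2 * \1_(eball (2 * r)) z.1 * g (z.1 - z.2) +
   M ^+ 2 * \1_(eball (2 * r)) z.2 * g (z.1 - z.2))%:E)%E).
  apply: le_intR.
  - apply: measurable_funM; last exact: (measurable_diff_comp measurable_kern).
    apply: measurable_funX; apply: measurableT_comp => //.
    by apply: measurable_funB; [exact: measurable_fst_comp|exact: measurable_snd_comp].
  - exact: measurable_funD.
  - by move=> z; rewrite mulr_ge0 ?exprn_ge0// kern_ge0.
  move=> [x y]/=; rewrite -/(kern (x - y)).
  have H : `|phi x - phi y| ^+ 2 * kern (x - y) <= M ^+ 2 * g (x - y).
    by rewrite /g mulrA ler_wpM2r// kern_ge0.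
  have G0 : 0 <= M ^+ 2 * g (x - y) by rewrite mulr_ge0// sqr_ge0.
  rewrite !indicE; have [xb|xb] := boolP (x \in eball (2 * r)).
    by rewrite mulr1 (le_trans H)// lerDl mulr_ge0// mulr_ge0// sqr_ge0.
  have [yb|yb] := boolP (y \in eball (2 * r)).
    by rewrite mulr1 (le_trans H)// lerDr mulr_ge0// mulr_ge0// sqr_ge0.
  rewrite !mulr0 !mul0r addr0 !supp ?subrr ?normr0 ?expr0n ?mul0r//.
    by rewrite ltNge; apply: contra yb; rewrite inE.
  by rewrite ltNge; apply: contra xb; rewrite inE.
have a0 (x : X) : 0 <= M ^+ 2 * \1_(eball (2 * r)) x by rewrite mulr_ge0// sqr_ge0.
have ma : measurable_fun setT (fun x : X => M ^+ 2 * \1_(eball (2 * r)) x).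
  exact: measurable_funM.
rewrite intRD//; last 2 first.
- by move=> z; rewrite mulr_ge0.
- by move=> z; rewrite mulr_ge0.
rewrite (intR_pair_fst ma mg)// (intR_pair_snd ma mg)//.
rewrite jump_weight0_scale// intRZ// ?sqr_ge0// integral_eball eballE ?mulr_gt0//.
rewrite -!EFinM -EFinD lee_fin powRD; last by rewrite (gt_eqF r0) implybT.
rewrite powR_mulrn ?(ltW r0)// exprMn /lipschitz_energy_const le_eqVlt.
by apply/orP; left; apply/eqP; ring.
Qed.

End kernel.

(** * The energy space and a positive representative *)

Section potential.
Context {R : realType} {N : nat}.
Local Notation X := 'rV[R]_N.
Local Notation mu := (@lebesgue_rV R N).

Lemma continuous_measurable_rV (V : X -> R) : continuous V -> measurable_fun setT V.
Proof.
move=> cV; apply: (measurability _ (RGenOInfty.measurableE R)) => _ [_ [a ->] <-].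
rewrite setTI; apply: open_measurable_rV.
by move/continuousP: cV; apply; exact: rray_open.
Qed.

Lemma continuous_eball_bounded (V : X -> R) (r : R) : continuous V ->
  exists2 M, 0 < M & forall x, enorm x <= r -> V x <= M.
Proof.
move=> cV; pose A : set X := [set v | forall i : 'I_N, `[(- r), r]%classic (v ord0 i)].
have cA : compact A.
  by apply: (rV_compact (A := fun=> `[(- r), r]%classic)) => _; exact: segment_compact.
have /compact_bounded : compact (V @` A).
  by apply: continuous_compact => //; exact: continuous_subspaceT.
move=> /pinfty_ex_gt0[M M0 HM]; exists M => // x xr.
apply: le_trans (ler_norm _) _; apply: HM; exists x => // i.
by rewrite /= in_itv/= -ler_norml (le_trans (coord_le_enorm _ _)).
Qed.

Lemma ae_fst (P : X -> Prop) : {ae mu, forall x, P x} ->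
  {ae (mu \x mu)%E, forall z, P z.1}.
Proof.
move=> [A [mA A0 PA]]; exists (A `*` setT); split.
- exact: measurableX.
- by rewrite product_measure1E//= A0 mul0e.
- by move=> z /= Pz; split => //; exact: PA.
Qed.

Lemma ae_snd (P : X -> Prop) : {ae mu, forall x, P x} ->
  {ae (mu \x mu)%E, forall z, P z.2}.
Proof.
move=> [A [mA A0 PA]]; exists (setT `*` A); split.
- exact: measurableX.
- by rewrite product_measure1E//= A0 mule0.
- by move=> z /= Pz; split => //; exact: PA.
Qed.

End potential.

Section energy.
Context {R : realType} {N : nat} (s : R).
Hypotheses (s_gt0 : 0 < s) (N_gt2s : 2 * s < N%:R).
Local Notation X := 'rV[R]_N.
Local Notation mu := (@lebesgue_rV R N).
Local Notation K := (kern s).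

Let q : R := critical_exponent N s.

Lemma critical_exponent_ge1 : 1 <= q.
Proof.
rewrite /q /critical_exponent ler_pdivlMr ?subr_gt0// mul1r.
by have := s_gt0; have := N_gt2s; lra.
Qed.

Lemma Lfun_critical (f : X -> R) : measurable_fun setT f ->
  (f \in Lfun mu q%:E) <-> (\int[mu]_x (`|f x| `^ q)%:E < +oo)%E.
Proof.
move=> mf; have q0 : 0 < q by apply: lt_le_trans critical_exponent_ge1.
have E : (\int[mu]_x (`|f x| `^ q)%:E = Lnorm mu q%:E (EFin \o f) `^ q)%E.
  by rewrite poweR_Lnorm ?gt_eqF//; apply: eq_integral => x _ /=.
split => [/andP[_]|foo].
  by rewrite inE/= /finite_norm => H; rewrite E poweR_lty.
apply/andP; rewrite !inE/=; split => //; rewrite /finite_norm.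
rewrite ltey; apply: contraTneq foo => fy.
by rewrite E fy poweRyr ?gt_eqF// ltxx.
Qed.

Lemma gagliardo_integrand_ge0 (u : X -> R) (z : X * X) :
  0 <= `|u z.1 - u z.2| ^+ 2 * K (z.1 - z.2).
Proof. by rewrite mulr_ge0 ?kern_ge0// exprn_ge0. Qed.

Lemma measurable_increment (u : X -> R) : measurable_fun setT u ->
  measurable_fun setT (fun z : X * X => u z.1 - u z.2).
Proof.
by move=> mu'; apply: measurable_funB;
  [exact: measurable_fst_comp|exact: measurable_snd_comp].
Qed.

Lemma measurable_kern_diff : measurable_fun setT (fun z : X * X => K (z.1 - z.2)).
Proof. exact: (measurable_diff_comp (measurable_kern s)). Qed.

Lemma measurable_gagliardo (u : X -> R) : measurable_fun setT u ->
  measurable_fun setT (fun z : X * X => `|u z.1 - u z.2| ^+ 2 * K (z.1 - z.2)).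
Proof.
move=> mu'; apply: measurable_funM; last exact: measurable_kern_diff.
by apply: measurable_funX; apply: measurableT_comp => //; exact: measurable_increment.
Qed.

Lemma measurable_form (u phi : X -> R) : measurable_fun setT u -> measurable_fun setT phi ->
  measurable_fun setT
    (fun z : X * X => (u z.1 - u z.2) * (phi z.1 - phi z.2) * K (z.1 - z.2)).
Proof.
move=> mu' mphi; apply: measurable_funM; last exact: measurable_kern_diff.
by apply: measurable_funM; exact: measurable_increment.
Qed.

(** Young's inequality; the right side serves as integrable majorant for the
    form and for all its truncations. *)
Lemma le_form_gagliardo (u phi : X -> R) (z : X * X) :
  `|(u z.1 - u z.2) * (phi z.1 - phi z.2) * K (z.1 - z.2)| <=
  `|u z.1 - u z.2| ^+ 2 * K (z.1 - z.2) + `|phi z.1 - phi z.2| ^+ 2 * K (z.1 - z.2).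
Proof.
rewrite normrM (ger0_norm (kern_ge0 _ _)) -mulrDl ler_wpM2r ?kern_ge0//.
rewrite normrM; move: `|_| `|_| (normr_ge0 (u z.1 - u z.2)) (normr_ge0 (phi z.1 - phi z.2)).
move=> a b a0 b0; have := sqr_ge0 (a - b); rewrite sqrrB.
by have := mulr_ge0 a0 b0; rewrite !mulr2n; lra.
Qed.

Lemma form_majorant_fin (u phi : X -> R) : measurable_fun setT u -> measurable_fun setT phi ->
  (gagliardo_seminorm2 s u < +oo)%E -> (gagliardo_seminorm2 s phi < +oo)%E ->
  (\int[mu \x mu]_z (`|u z.1 - u z.2| ^+ 2 * K (z.1 - z.2) +
     `|phi z.1 - phi z.2| ^+ 2 * K (z.1 - z.2))%:E < +oo)%E.
Proof.
move=> mu' mphi uoo poo; rewrite intRD.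
- exact: lte_add_pinfty.
- exact: measurable_gagliardo.
- exact: measurable_gagliardo.
- exact: gagliardo_integrand_ge0.
- exact: gagliardo_integrand_ge0.
Qed.

Lemma form_integrable (u phi : X -> R) : measurable_fun setT u -> measurable_fun setT phi ->
  (gagliardo_seminorm2 s u < +oo)%E -> (gagliardo_seminorm2 s phi < +oo)%E ->
  (mu \x mu)%E.-integrable setT (EFin \o
    (fun z : X * X => (u z.1 - u z.2) * (phi z.1 - phi z.2) * K (z.1 - z.2))).
Proof.
move=> mu' mphi uoo poo; apply: (integrable_dom _ _ (le_form_gagliardo u phi)).
- exact: measurable_form.
- by apply: measurable_funD; exact: measurable_gagliardo.
- exact: form_majorant_fin.
Qed.

Lemma intR_indic_fin (M r : R) : 0 <= M ->
  (\int[mu]_x (M * \1_(eball r) x)%:E < +oo)%E.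
Proof.
move=> M0; rewrite intRZ//; last by apply: measurable_indic; exact: measurable_eball.
by rewrite integral_eball lte_mul_pinfty// eball_fin.
Qed.

Lemma HsV_compact_support (V phi : X -> R) (M r : R) :
  continuous V -> (forall x, 0 <= V x) -> measurable_fun setT phi ->
  (forall x, `|phi x| <= M) -> (forall x, r < enorm x -> phi x = 0) ->
  (gagliardo_seminorm2 s phi < +oo)%E -> HsV s V phi.
Proof.
move=> cV V0 mphi pM supp poo.
have M0 : 0 <= M by apply: le_trans (pM 0).
have q1 := critical_exponent_ge1; have q0 : 0 < q by apply: lt_le_trans q1.
have mi (c : R) : measurable_fun setT (fun x : X => c * \1_(eball r) x).
  by apply: measurable_funM => //; apply: measurable_indic; exact: measurable_eball.
split.
  rewrite inE; apply/(Lfun_critical mphi).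
  apply: le_lt_trans (intR_indic_fin r (powR_ge0 M q)); apply: le_intR; [|exact: mi| |].
  - by apply: (measurableT_comp (measurable_powR _)); exact: measurableT_comp.
  - by move=> x; exact: powR_ge0.
  move=> x; rewrite indicE; have [xb|xb] := boolP (x \in eball r).
    by rewrite mulr1; apply: (ge0_ler_powR (ltW q0)) => //; rewrite nnegrE.
  rewrite mulr0 supp ?normr0 ?powR0 ?gt_eqF//.
  by rewrite ltNge; apply: contra xb; rewrite inE.
rewrite lte_add_pinfty//; have [MV MV0 HV] := continuous_eball_bounded r cV.
have C0 : 0 <= MV * M ^+ 2 by rewrite mulr_ge0 ?exprn_ge0// ltW.
apply: le_lt_trans (intR_indic_fin r C0); apply: le_intR; [|exact: mi| |].
- by apply: measurable_funM; [exact: continuous_measurable_rV|exact: measurable_funX].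
- by move=> x; rewrite mulr_ge0// sqr_ge0.
move=> x; rewrite indicE; have [xb|xb] := boolP (x \in eball r).
  rewrite mulr1 ler_pM ?sqr_ge0//; first by apply: HV; move: xb; rewrite inE.
  by rewrite -real_normK ?num_real// lerXn2r ?nnegrE.
rewrite mulr0 supp ?expr0n ?mulr0//.
by rewrite ltNge; apply: contra xb; rewrite inE.
Qed.

(** Since [u > 0] holds almost everywhere only, a null set is repaired once and
    for all, so that quotients and powers of the solution can be estimated
    pointwise. *)
Lemma positive_representative (V u : X -> R) (p eps : R) :
  continuous V -> (forall x, 0 <= V x) -> positive_weak_solution s V p eps u ->
  exists w : X -> R, [/\ measurable_fun setT w, forall x, 0 < w x,
    (\int[mu]_x (w x `^ q)%:E < +oo)%E, (gagliardo_seminorm2 s w < +oo)%E &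
    forall phi, HsV s V phi ->
      ((eps `^ (2 * s))%:E * gagliardo_form s w phi +
       \int[mu]_x (V x * w x * phi x)%:E =
       \int[mu]_x (w x `^ (p - 2) * w x * phi x)%:E)%E].
Proof.
move=> cV V0 [[Lu Eu] u0 sol]; have mV := continuous_measurable_rV cV.
have mu' : measurable_fun setT u.
  by move: Lu; rewrite inE => /sub_Lfun_mfun; rewrite inE.
pose w x := if 0 < u x then u x else 1.
have mw : measurable_fun setT w.
  apply: measurable_fun_ifT => //.
  by apply: measurable_fun_ltr => //; exact: measurable_cst.
have w0 x : 0 < w x by rewrite /w; case: ifPn.
have uw : {ae mu, forall x, u x = w x}.
  by apply: filterS u0 => x ux; rewrite /w ux.
have mwq : measurable_fun setT (fun x => w x `^ q).
  exact: (measurableT_comp (measurable_powR _)).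
have uw1 := ae_fst uw; have uw2 := ae_snd uw.
have Eu1 : (gagliardo_seminorm2 s u < +oo)%E.
  by apply: le_lt_trans Eu; rewrite leeDl// intR_ge0// => x; rewrite mulr_ge0// sqr_ge0.
exists w; split => //.
- have /(Lfun_critical mu') : u \in Lfun mu q%:E by move: Lu; rewrite inE.
  apply: le_lt_trans; rewrite le_eqVlt; apply/orP; left; apply/eqP.
  apply: ae_eq_integral => //.
  + exact/measurable_EFinP.
  + apply/measurable_EFinP/(measurableT_comp (measurable_powR _)).
    exact: measurableT_comp.
  + by apply: filterS uw => x uwx _; rewrite uwx gtr0_norm.
- apply: le_lt_trans Eu1; rewrite le_eqVlt; apply/orP; left; apply/eqP.
  apply: ae_eq_integral => //.
  + apply/measurable_EFinP; exact: (measurable_gagliardo mw).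
  + apply/measurable_EFinP; exact: (measurable_gagliardo mu').
  + by apply: filterS2 uw1 uw2 => z e1 e2 _; rewrite e1 e2.
- move=> phi Hphi; have mphi : measurable_fun setT phi.
    by case: Hphi; rewrite inE => /sub_Lfun_mfun; rewrite inE.
  have := sol _ Hphi.
  have -> : gagliardo_form s u phi = gagliardo_form s w phi.
    apply: ae_eq_integral => //.
    + apply/measurable_EFinP; exact: (measurable_form mu' mphi).
    + apply/measurable_EFinP; exact: (measurable_form mw mphi).
    + by apply: filterS2 uw1 uw2 => z e1 e2 _; rewrite e1 e2.
  have -> : (\int[mu]_x (V x * u x * phi x)%:E = \int[mu]_x (V x * w x * phi x)%:E)%E.
    apply: ae_eq_integral => //.
    + by apply/measurable_EFinP; do 2 apply: measurable_funM => //.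
    + by apply/measurable_EFinP; do 2 apply: measurable_funM => //.
    + by apply: filterS uw => x e _; rewrite e.
  move=> ->; apply: ae_eq_integral => //.
  + apply/measurable_EFinP; do 2 apply: measurable_funM => //.
    apply: (measurableT_comp (measurable_powR _)); exact: measurableT_comp.
  + apply/measurable_EFinP; do 2 apply: measurable_funM => //.
    exact: (measurableT_comp (measurable_powR _)).
  + by apply: filterS uw => x e _; rewrite e gtr0_norm.
Qed.

(** Because the critical exponent is at least [1], [u <= 1 + u `^ q]
    pointwise. *)
Lemma weighted_fin (u g : X -> R) (M : R) : measurable_fun setT u ->
  measurable_fun setT g -> (forall x, 0 < u x) -> (forall x, 0 <= g x <= M) ->
  (\int[mu]_x (u x `^ q)%:E < +oo)%E -> (\int[mu]_x (g x)%:E < +oo)%E ->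
  (\int[mu]_x (u x * g x)%:E < +oo)%E.
Proof.
move=> mu' mg u0 gM uoo goo.
have M0 : 0 <= M by case/andP: (gM 0) => /le_trans; apply.
have g0 x : 0 <= g x by case/andP: (gM x).
have mq : measurable_fun setT (fun x => u x `^ q).
  exact: (measurableT_comp (measurable_powR _)).
apply: (@le_lt_trans _ _ (\int[mu]_x (g x + M * u x `^ q)%:E)%E).
  apply: le_intR.
  - exact: measurable_funM.
  - by apply: measurable_funD => //; exact: measurable_funM.
  - by move=> x; rewrite mulr_ge0// ltW.
  move=> x; have [u1|u1] := leP (u x) 1.
    by apply: (@le_trans _ _ (g x)); rewrite ?ler_piMl// lerDl mulr_ge0// powR_ge0.
  apply: (@le_trans _ _ (M * u x `^ q)); last by rewrite lerDr.
  rewrite mulrC ler_pM ?(ltW (u0 _))//; first by case/andP: (gM x).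
  by apply: le1r_powR; [exact: ltW|exact: critical_exponent_ge1].
rewrite intRD//; last 2 first.
- exact: measurable_funM.
- by move=> x; rewrite mulr_ge0// powR_ge0.
rewrite lte_add_pinfty// intRZ//; last by move=> x; exact: powR_ge0.
by rewrite lte_mul_pinfty.
Qed.

End energy.

(** * An upper bound for the mass of large balls *)

Section real_inequalities.
Context {R : realType}.
Implicit Types a b x y t : R.

Lemma picone a b x y : 0 < a -> 0 < b ->
  (a - b) * (x ^+ 2 / a - y ^+ 2 / b) <= (x - y) ^+ 2.
Proof.
move=> a0 b0; rewrite -subr_ge0.
have -> : (x - y) ^+ 2 - (a - b) * (x ^+ 2 / a - y ^+ 2 / b) =
  (b * x - a * y) ^+ 2 / (a * b) by field; rewrite !gt_eqF.
by rewrite divr_ge0 ?sqr_ge0// mulr_ge0// ltW.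
Qed.

(** Where the cutoff is constant, Picone's inequality leaves a negative
    remainder; it is what bounds the mean of [1 / u] by that of [u]. *)
Lemma picone_gain a b t (k K : R) : 0 < t -> t < a -> t < b -> 0 <= k ->
  (a != b -> k <= K) ->
  (a - b) * (a^-1 - b^-1) * K + k * ((b - t) / a) <= 2 * k.
Proof.
move=> t0 ta tb k0 kK; have a0 := lt_trans t0 ta; have b0 := lt_trans t0 tb.
have [E|/kK {}kK] := eqVneq a b.
  rewrite E subrr !mul0r add0r mulrC ler_wpM2r// ler_pdivrMr//; lra.
have H : (a - b) * (a^-1 - b^-1) = 2 - (b / a + a / b) by field; rewrite !gt_eqF.
have H2 : 2 <= b / a + a / b.
  rewrite -subr_ge0.
  have -> : b / a + a / b - 2 = (a - b) ^+ 2 / (a * b) by field; rewrite !gt_eqF.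
  by rewrite divr_ge0 ?sqr_ge0// mulr_ge0// ltW.
have h3 : (b - t) / a <= b / a by rewrite ler_pM2r ?invr_gt0//; lra.
have h4 : 0 <= a / b by rewrite divr_ge0// ltW.
have h5 : (2 - (b / a + a / b)) * K <= (2 - (b / a + a / b)) * k.
  by rewrite ler_wnM2l// subr_le0.
rewrite H (le_trans (lerD h5 (lexx _)))// -subr_ge0.
have -> : 2 * k - ((2 - (b / a + a / b)) * k + k * ((b - t) / a)) =
  k * (a / b + (b / a - (b - t) / a)) by ring.
by rewrite mulr_ge0// addr_ge0// subr_ge0.
Qed.

Definition clip (x : R) : R := Num.max 0 (Num.min 1 x).

Lemma clip_ge0 x : 0 <= clip x. Proof. by rewrite le_max lexx. Qed.
Lemma clip_le1 x : clip x <= 1. Proof. by rewrite ge_max ler01 ge_min lexx. Qed.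

Lemma clip_lipschitz x y : `|clip x - clip y| <= `|x - y|.
Proof.
wlog xy : x y / x <= y.
  move=> H; have [/H//|/ltW/H] := leP x y.
  by rewrite distrC [X in _ <= X]distrC.
rewrite /clip /Num.max /Num.min /Order.max /Order.min.
rewrite [X in _ <= X]distrC [X in _ <= X]ger0_norm ?subr_ge0//.
by rewrite ler_norml; do ! case: ifPn; rewrite -?leNgt => *; apply/andP; split; lra.
Qed.

Lemma clip_mono x y : x <= y -> clip x <= clip y.
Proof.
move=> xy; rewrite /clip /Num.max /Num.min /Order.max /Order.min.
by do ! case: ifPn; rewrite -?leNgt => *; lra.
Qed.

Lemma clip0 x : x <= 0 -> clip x = 0.
Proof. by move=> x0; rewrite /clip max_l// ge_min x0 orbT. Qed.

Lemma clip1 x : 1 <= x -> clip x = 1.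
Proof. by move=> x1; rewrite /clip min_l// max_r. Qed.

End real_inequalities.

Section cutoff.
Context {R : realType} {N : nat}.
Local Notation X := 'rV[R]_N.

Definition cutoff (r : R) (x : X) : R := clip (2 - enorm x / r).

Lemma measurable_clip_comp d (T : measurableType d) (f : T -> R) :
  measurable_fun setT f -> measurable_fun setT (fun x => clip (f x)).
Proof. by move=> mf; apply: measurable_maxr => //; apply: measurable_minr. Qed.

Lemma measurable_cutoff r : measurable_fun setT (cutoff r).
Proof.
apply: measurable_clip_comp; apply: measurable_funB => //.
by apply: measurable_funM => //; exact: measurable_enorm.
Qed.

Lemma cutoff_ge0 r x : 0 <= cutoff r x. Proof. exact: clip_ge0. Qed.
Lemma cutoff_le1 r x : cutoff r x <= 1. Proof. exact: clip_le1. Qed.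

Lemma cutoff_in r x : 0 < r -> enorm x <= r -> cutoff r x = 1.
Proof.
move=> r0 xr; apply: clip1; rewrite lerBrDr -lerBrDl.
by rewrite ler_pdivrMr// mulrBl mul1r mulr2n mulrDl mul1r addrK.
Qed.

Lemma cutoff_out r x : 0 < r -> 2 * r <= enorm x -> cutoff r x = 0.
Proof. by move=> r0 xr; apply: clip0; rewrite subr_le0 ler_pdivlMr. Qed.

Lemma cutoff_lipschitz r x y : 0 < r ->
  `|cutoff r x - cutoff r y| ^+ 2 <= 1 ^+ 2 * Num.min 1 ((enorm (x - y) / r) ^+ 2).
Proof.
move=> r0; rewrite expr1n mul1r le_min; apply/andP; split.
  rewrite exprn_ile1// ler_norml.
  have := cutoff_ge0 r x; have := cutoff_ge0 r y.
  by have := cutoff_le1 r x; have := cutoff_le1 r y; lra.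
rewrite lerXn2r ?nnegrE ?divr_ge0 ?enorm_ge0 ?(ltW r0)//.
apply: le_trans (clip_lipschitz _ _) _.
rewrite (_ : _ - _ = (enorm y - enorm x) / r); last by ring.
rewrite normrM (gtr0_norm (x := r^-1)) ?invr_gt0//.
by rewrite ler_pM2r ?invr_gt0// enorm_distC enorm_lipschitz.
Qed.

End cutoff.

Section inner_power.
Context {R : realType} {N : nat}.
Local Notation X := 'rV[R]_N.
Local Notation mu := (@lebesgue_rV R N).

Definition inner_mass (a : R) : R :=
  fine (\int[mu]_x (enorm x `^ (- a) * \1_(eball 1) x)%:E).

Lemma inner_mass_ge0 a : 0 <= inner_mass a.
Proof. by rewrite fine_ge0// intR_ge0// => x; rewrite mulr_ge0// powR_ge0. Qed.

Lemma measurable_enorm_powR (a : R) : measurable_fun setT (fun x : X => enorm x `^ a).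
Proof. exact: (measurableT_comp (measurable_powR _) measurable_enorm). Qed.

Lemma measurable_indic_eball (r : R) : measurable_fun setT (\1_(eball r) : X -> R).
Proof. by apply: measurable_indic; exact: measurable_eball. Qed.

Lemma inner_power_eball (a r : R) : 0 < r -> a < N%:R ->
  (\int[mu]_x (enorm x `^ (- a) * \1_(eball r) x)%:E =
   (r `^ (N%:R - a) * inner_mass a)%:E)%E.
Proof.
move=> r0 aN.
pose f (t : R) (x : X) := enorm x `^ (- a) * \1_(eball t) x.
have mf t : measurable_fun setT (f t).
  apply: measurable_funM; first exact: measurable_enorm_powR.
  exact: measurable_indic_eball.
have f0 t x : 0 <= f t x by rewrite mulr_ge0// powR_ge0.
rewrite -(ge0_integral_affine 0 (c := r) (f := EFin \o f r))//; last 3 first.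
- by rewrite gt_eqF.
- exact/measurable_EFinP.
- by move=> x; rewrite lee_fin.
have E x : f r (r *: x + 0) = r `^ (- a) * f 1 x.
  rewrite /f addr0 enormZ gtr0_norm// powRM ?enorm_ge0 ?(ltW r0)// -mulrA.
  congr (_ * (_ * _)); rewrite !indicE (_ : (r *: x \in eball r) = (x \in eball 1))//.
  by apply/idP/idP; rewrite !inE /eball/= enormZ gtr0_norm// -{2}(mulr1 r) ler_pM2l.
rewrite /= gtr0_norm//; under eq_integral do rewrite E.
rewrite intRZ ?powR_ge0// intR_fineK//; last exact: inner_power_fin.
rewrite -!EFinM mulrA; congr (_ * _)%:E.
by rewrite -powR_mulrn ?(ltW r0)// -powRD// (gt_eqF r0) implybT.
Qed.

End inner_power.

Section ball_mass_bound.
Context {R : realType} {N : nat} (s : R).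
Local Notation X := 'rV[R]_N.
Local Notation mu := (@lebesgue_rV R N).
Local Notation K := (kern s).
Variables (V w : X -> R) (q c omega CV : R).
Hypotheses (s_gt0 : 0 < s) (s_lt1 : s < 1) (N_gt2s : 2 * s < N%:R).
Hypotheses (V_cont : continuous V) (V_ge0 : forall x, 0 <= V x).
Hypotheses (c_gt0 : 0 < c) (q_gt0 : 0 < q).
Hypotheses (omega_le : omega <= 2 * s) (CV_ge0 : 0 <= CV).
Hypothesis V_le : forall x, x != 0 -> V x <= CV * enorm x `^ (- omega).
Hypotheses (mw : measurable_fun setT w) (w_gt0 : forall x, 0 < w x).
Hypothesis w_int : (\int[mu]_x (w x `^ critical_exponent N s)%:E < +oo)%E.
Hypothesis w_gag : (gagliardo_seminorm2 s w < +oo)%E.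
Hypothesis w_sol : forall phi, HsV s V phi ->
  (c%:E * gagliardo_form s w phi + \int[mu]_x (V x * w x * phi x)%:E =
   \int[mu]_x (w x `^ q * w x * phi x)%:E)%E.

(** Nothing bounds [w] from below, so the denominator is kept away from zero by
    [t]; the value of [t] is chosen at the end, not sent to zero. *)
Definition picone_test (r t : R) (x : X) : R := cutoff r x ^+ 2 / (w x + t).
Definition ball_mass (r : R) : R := fine (\int[mu]_x (w x * \1_(eball r) x)%:E).

Let N_gt0 : (0 < N)%N := dim_gt0 s_gt0 N_gt2s.

Lemma ball_mass_fin r : (\int[mu]_x (w x * \1_(eball r) x)%:E < +oo)%E.
Proof.
apply: (weighted_fin s_gt0 N_gt2s (M := 1)) => //.
- exact: measurable_indic_eball.
- by move=> x; rewrite indicE; case: (_ \in _); rewrite ?lexx ?ler01.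
- by rewrite integral_eball eball_fin.
Qed.

Lemma ball_mass_ge0 r : 0 <= ball_mass r.
Proof. by rewrite fine_ge0// intR_ge0// => x; rewrite mulr_ge0// ltW. Qed.

Let wt_gt0 t x : 0 < t -> 0 < w x + t. Proof. by move=> ?; rewrite addr_gt0. Qed.

Lemma measurable_wt_inv t : 0 < t -> measurable_fun setT (fun x => (w x + t)^-1).
Proof.
move=> t0.
rewrite (_ : (fun x => _) = (fun x => (w x + t) `^ (-1))); last first.
  by apply/funext => x; rewrite powR_inv1// ltW// wt_gt0.
by apply: (measurableT_comp (measurable_powR _)); exact: measurable_funD.
Qed.

Lemma measurable_picone_test r t : 0 < t -> measurable_fun setT (picone_test r t).
Proof.
move=> t0; apply: measurable_funM; last exact: measurable_wt_inv.
by apply: measurable_funX; exact: measurable_cutoff.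
Qed.

Lemma picone_test_ge0 r t x : 0 < t -> 0 <= picone_test r t x.
Proof. by move=> t0; rewrite divr_ge0 ?sqr_ge0// ltW// wt_gt0. Qed.


Lemma picone_test_le r t x : 0 < t -> picone_test r t x <= t^-1.
Proof.
move=> t0; rewrite /picone_test -[leRHS]mul1r ler_pM ?sqr_ge0//.
- by rewrite invr_ge0 ltW// wt_gt0.
- by rewrite exprn_ile1 ?cutoff_ge0 ?cutoff_le1.
- by rewrite lef_pV2 ?posrE ?wt_gt0// lerDr ltW.
Qed.

Lemma picone_test_out r t x : 0 < r -> 2 * r < enorm x -> picone_test r t x = 0.
Proof. by move=> r0 /ltW xr; rewrite /picone_test cutoff_out// expr0n mul0r. Qed.

Lemma picone_test_increment r t x y : 0 < t ->
  `|picone_test r t x - picone_test r t y| ^+ 2 <=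
  8 / t ^+ 2 * `|cutoff r x - cutoff r y| ^+ 2 + 2 / t ^+ 4 * `|w x - w y| ^+ 2.
Proof.
move=> t0; have a0 := wt_gt0 x t0; have b0 := wt_gt0 y t0.
rewrite /picone_test; set al := cutoff r x; set be := cutoff r y.
set a := w x + t in a0 *; set b := w y + t in b0 *.
have ta : t <= a by rewrite lerDr ltW.
have tb : t <= b by rewrite lerDr ltW.
set P := (al ^+ 2 - be ^+ 2) / a; set Q := be ^+ 2 * (w y - w x) / (a * b).
have -> : al ^+ 2 / a - be ^+ 2 / b = P + Q.
  by rewrite /P /Q /a /b; field; rewrite !gt_eqF.
have HP : `|P| ^+ 2 <= 4 / t ^+ 2 * `|al - be| ^+ 2.
  have -> : 4 / t ^+ 2 * `|al - be| ^+ 2 = (`|al - be| * 2 / t) ^+ 2.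
    by field; rewrite gt_eqF.
  rewrite lerXn2r ?nnegrE ?mulr_ge0 ?invr_ge0 ?(ltW t0)//.
  rewrite /P normrM subr_sqr normrM (gtr0_norm (x := a^-1)) ?invr_gt0//.
  rewrite ler_pM ?mulr_ge0 ?invr_ge0 ?(ltW a0)//; last by rewrite lef_pV2.
  rewrite ler_wpM2l// ger0_norm ?addr_ge0 ?cutoff_ge0//.
  by rewrite (_ : 2 = 1 + 1) ?lerD ?cutoff_le1.
have HQ : `|Q| ^+ 2 <= 1 / t ^+ 4 * `|w x - w y| ^+ 2.
  have -> : 1 / t ^+ 4 * `|w x - w y| ^+ 2 = (`|w x - w y| * (t * t)^-1) ^+ 2.
    by field; rewrite gt_eqF.
  rewrite lerXn2r ?nnegrE ?mulr_ge0 ?invr_ge0 ?mulr_ge0 ?(ltW t0)//.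
  rewrite /Q normrM (normrM (be ^+ 2)) (distrC (w y)) (ger0_norm (x := be ^+ 2)) ?sqr_ge0//.
  rewrite (gtr0_norm (x := (a * b)^-1)) ?invr_gt0 ?mulr_gt0//.
  apply: ler_pM.
  - by rewrite mulr_ge0 ?sqr_ge0.
  - by rewrite invr_ge0 mulr_ge0// ltW.
  - by rewrite ler_piMl// exprn_ile1 ?cutoff_ge0 ?cutoff_le1.
  - by rewrite lef_pV2 ?posrE ?mulr_gt0// ler_pM// ltW.
have H : `|P + Q| ^+ 2 <= 2 * `|P| ^+ 2 + 2 * `|Q| ^+ 2.
  rewrite !real_normK ?num_real// -subr_ge0.
  have -> : 2 * P ^+ 2 + 2 * Q ^+ 2 - (P + Q) ^+ 2 = (P - Q) ^+ 2 by ring.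
  exact: sqr_ge0.
apply: le_trans H _.
have -> : 8 / t ^+ 2 * `|al - be| ^+ 2 = 2 * (4 / t ^+ 2 * `|al - be| ^+ 2).
  by field; rewrite gt_eqF.
have -> : 2 / t ^+ 4 * `|w x - w y| ^+ 2 = 2 * (1 / t ^+ 4 * `|w x - w y| ^+ 2).
  by field; rewrite gt_eqF.
by rewrite lerD// ler_pM2l.
Qed.

Lemma cutoff_gagliardo r : 0 < r ->
  (gagliardo_seminorm2 s (@cutoff R N r) <=
   (@lipschitz_energy_const R N s * r `^ (N%:R - 2 * s))%:E)%E.
Proof.
move=> r0; have := @gagliardo_lipschitz R N s s_gt0 s_lt1 (cutoff r) r 1 r0.
rewrite expr1n mulr1; apply.
- exact: measurable_cutoff.
- by move=> x y; have := cutoff_lipschitz x y r0; rewrite expr1n.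
- by move=> x /ltW xr; rewrite cutoff_out.
Qed.

Lemma picone_test_gagliardo r t : 0 < r -> 0 < t ->
  (gagliardo_seminorm2 s (picone_test r t) < +oo)%E.
Proof.
move=> r0 t0.
have c1 : 0 <= 8 / t ^+ 2 by rewrite divr_ge0// exprn_ge0// ltW.
have c2 : 0 <= 2 / t ^+ 4 by rewrite divr_ge0// exprn_ge0// ltW.
have mg1 := measurable_gagliardo s (measurable_cutoff r : measurable_fun setT (@cutoff R N r)).
have mg2 := measurable_gagliardo s mw.
apply: (@le_lt_trans _ _ (\int[mu \x mu]_z
   (8 / t ^+ 2 * (`|cutoff r z.1 - cutoff r z.2| ^+ 2 * K (z.1 - z.2)) +
    2 / t ^+ 4 * (`|w z.1 - w z.2| ^+ 2 * K (z.1 - z.2)))%:E)%E).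
  apply: le_intR.
  - by apply: (measurable_gagliardo s); exact: measurable_picone_test.
  - by apply: measurable_funD; exact: measurable_funM.
  - by move=> z; exact: gagliardo_integrand_ge0.
  - move=> z; apply: le_trans (ler_wpM2r (kern_ge0 _ _) (picone_test_increment r z.1 z.2 t0)) _.
    by rewrite mulrDl !mulrA.
rewrite intRD; last 4 first.
- exact: measurable_funM.
- exact: measurable_funM.
- by move=> z; rewrite mulr_ge0// gagliardo_integrand_ge0.
- by move=> z; rewrite mulr_ge0// gagliardo_integrand_ge0.
rewrite lte_add_pinfty//.
- rewrite intRZ//; last by move=> z; exact: gagliardo_integrand_ge0.
  rewrite lte_mul_pinfty//.
  exact: le_lt_trans (cutoff_gagliardo r0) (ltry _).
- rewrite intRZ//; last by move=> z; exact: gagliardo_integrand_ge0.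
  by rewrite lte_mul_pinfty.
Qed.

(** Membership uses the finite energy of [w] itself, which enters through the
    increments of the denominator. *)
Lemma picone_test_HsV r t : 0 < r -> 0 < t -> HsV s V (picone_test r t).
Proof.
move=> r0 t0; apply: (@HsV_compact_support R N s s_gt0 N_gt2s V (picone_test r t) t^-1 (2 * r)) => //.
- exact: measurable_picone_test.
- by move=> x; rewrite ger0_norm ?picone_test_ge0// picone_test_le.
- by move=> x; exact: picone_test_out.
- exact: picone_test_gagliardo.
Qed.

Definition inv_mass (r t : R) : R :=
  fine (\int[mu]_x (\1_(eball r) x * (w x + t)^-1)%:E).

Lemma inv_mass_fin r t : 0 < t ->
  (\int[mu]_x (\1_(eball r) x * (w x + t)^-1)%:E < +oo)%E.
Proof.
move=> t0; have ti : 0 <= t^-1 by rewrite invr_ge0 ltW.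
apply: le_lt_trans (intR_indic_fin (N := N) r ti); apply: le_intR.
- by apply: measurable_funM; [exact: measurable_indic_eball|exact: measurable_wt_inv].
- by apply: measurable_funM => //; exact: measurable_indic_eball.
- by move=> x; rewrite mulr_ge0// invr_ge0 ltW// wt_gt0.
- move=> x; rewrite mulrC ler_wpM2r// lef_pV2 ?posrE ?wt_gt0//.
  by rewrite lerDr ltW.
Qed.

Lemma inv_mass_ge0 r t : 0 < t -> 0 <= inv_mass r t.
Proof.
move=> t0; rewrite fine_ge0// intR_ge0// => x.
by rewrite mulr_ge0// invr_ge0 ltW// wt_gt0.
Qed.

(** On [eball r] squared the kernel is at least [(2 * r) `^ (- kexp)], so the
    gain in Picone's inequality dominates a product of two integrals over the
    ball. *)
Lemma energy_inequality r t : 0 < r -> 0 < t ->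
  (gagliardo_form s w (picone_test r t) +
     ((2 * r) `^ (- @kexp R N s) * (inv_mass r t * ball_mass r))%:E <=
   (@lipschitz_energy_const R N s * r `^ (N%:R - 2 * s) +
     2 * (2 * r) `^ (- @kexp R N s) * (r ^+ N * @vol1 R N) ^+ 2)%:E)%E.
Proof.
move=> r0 t0; set k := (2 * r) `^ _.
have k0 : 0 <= k by exact: powR_ge0.
have mi := measurable_indic_eball (N := N) r.
pose A (z : X * X) := (w z.1 - w z.2) * (picone_test r t z.1 - picone_test r t z.2) * K (z.1 - z.2).
pose B (z : X * X) := (k * (\1_(eball r) z.1 * (w z.1 + t)^-1)) * (w z.2 * \1_(eball r) z.2).
pose C (z : X * X) := `|cutoff r z.1 - cutoff r z.2| ^+ 2 * K (z.1 - z.2).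
pose D (z : X * X) := (2 * k * \1_(eball r) z.1) * \1_(eball r) z.2.
have mb1 : measurable_fun setT (fun x : X => k * (\1_(eball r) x * (w x + t)^-1)).
  by apply: measurable_funM => //; apply: measurable_funM => //; exact: measurable_wt_inv.
have b1 x : 0 <= \1_(eball r) x * (w x + t)^-1 by rewrite mulr_ge0// invr_ge0 ltW// wt_gt0.
have mb2 : measurable_fun setT (fun x : X => w x * \1_(eball r) x) by exact: measurable_funM.
have b2 x : 0 <= w x * \1_(eball r) x by rewrite mulr_ge0// ltW.
have mB : measurable_fun setT B.
  by apply: measurable_funM; [exact: (measurable_fst_comp mb1)|exact: (measurable_snd_comp mb2)].
have IB : (\int[mu \x mu]_z (B z)%:E = (k * (inv_mass r t * ball_mass r))%:E)%E.
  rewrite /B (intR_prod mb1 mb2)//; last by move=> x; rewrite mulr_ge0.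
  rewrite intRZ//; last first.
    by apply: measurable_funM => //; exact: measurable_wt_inv.
  rewrite (intR_fineK b1 (inv_mass_fin r t0)) (intR_fineK b2 (ball_mass_fin r)).
  by rewrite -!EFinM mulrA.
have md1 : measurable_fun setT (fun x : X => 2 * k * \1_(eball r) x) by exact: measurable_funM.
have mD : measurable_fun setT D.
  by apply: measurable_funM; [exact: (measurable_fst_comp md1)|exact: (measurable_snd_comp mi)].
have ID : (\int[mu \x mu]_z (D z)%:E = (2 * k * (r ^+ N * @vol1 R N) ^+ 2)%:E)%E.
  rewrite /D (intR_prod md1 mi)//; last by move=> x; rewrite !mulr_ge0.
  rewrite intRZ ?mulr_ge0// integral_eball eballE// -!EFinM.
  by congr EFin; rewrite expr2 !mulrA.
have mC : measurable_fun setT C by apply: measurable_gagliardo; exact: measurable_cutoff.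
have IC : (\int[mu \x mu]_z (C z)%:E < +oo)%E.
  exact: le_lt_trans (cutoff_gagliardo r0) (ltry _).
have iA : (mu \x mu)%E.-integrable setT (EFin \o A).
  by apply: form_integrable => //; [exact: measurable_picone_test|exact: picone_test_gagliardo].
have B0 z : 0 <= B z := mulr_ge0 (mulr_ge0 k0 (b1 _)) (b2 _).
have C0 z : 0 <= C z by exact: gagliardo_integrand_ge0.
have D0 z : 0 <= D z by rewrite !mulr_ge0.
have iB : (mu \x mu)%E.-integrable setT (EFin \o B).
  by apply: (integrable_dom mB mB) => [z|]; [rewrite ger0_norm|rewrite IB ltry].
have iC : (mu \x mu)%E.-integrable setT (EFin \o C).
  by apply: (integrable_dom mC mC) => [z|//]; rewrite ger0_norm.
have iD : (mu \x mu)%E.-integrable setT (EFin \o D).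
  by apply: (integrable_dom mD mD) => [z|]; [rewrite ger0_norm|rewrite ID ltry].
rewrite -IB EFinD -ID.
apply: (@le_trans _ _ (\int[mu \x mu]_z (C z)%:E + \int[mu \x mu]_z (D z)%:E)%E); last first.
  by rewrite leeD2r//; exact: cutoff_gagliardo.
rewrite -[X in (X + _ <= _)%E]/(\int[mu \x mu]_z (A z)%:E)%E.
rewrite -integralD// -integralD//; apply: le_integral => //.
- exact: integrableD.
- exact: integrableD.
move=> [x y] _; rewrite -!EFinD lee_fin /A /B /C /D/= {iA iB iC iD IB ID IC mB mC mD}.
rewrite !indicE.
have a0 := wt_gt0 x t0; have b0 := wt_gt0 y t0.
have [xb|xb] := boolP (x \in eball r); last first.
  rewrite !(mulr0, mul0r) !addr0 ler_wpM2r ?kern_ge0// real_normK ?num_real//.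
  have := picone (cutoff r x) (cutoff r y) a0 b0.
  by rewrite /picone_test (_ : w x + t - (w y + t) = w x - w y)//; ring.
have [yb|yb] := boolP (y \in eball r); last first.
  rewrite !(mulr0, mul0r) !addr0 ler_wpM2r ?kern_ge0// real_normK ?num_real//.
  have := picone (cutoff r x) (cutoff r y) a0 b0.
  by rewrite /picone_test (_ : w x + t - (w y + t) = w x - w y)//; ring.
move: xb yb; rewrite !inE /eball/= => xb yb.
rewrite /picone_test !cutoff_in// subrr normr0 expr0n mul0r add0r !mulr1 expr1n !mul1r.
have := @picone_gain R (w x + t) (w y + t) t k (K (x - y)) t0.
rewrite (_ : w x + t - (w y + t) = w x - w y); last by ring.
rewrite (_ : w y + t - t = w y); last by ring.
move=> H; rewrite (_ : k / (w x + t) * w y = k * (w y / (w x + t))); last by ring.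
apply: H => //.
- by rewrite ltrDr.
- by rewrite ltrDr.
- move=> ab; apply: kern_ge => //.
    by rewrite subr_eq0; apply: contraNneq ab => ->.
  by apply: le_trans (enormD _ _) _; rewrite enormN; lra.
Qed.


Definition harnack_const : R :=
  c * (@lipschitz_energy_const R N s + 2 * 2 `^ (- @kexp R N s) * @vol1 R N ^+ 2) +
  CV * (2 `^ (N%:R - omega) * @inner_mass R N omega) + 1.

Lemma harnack_const_gt0 : 0 < harnack_const.
Proof.
rewrite /harnack_const ltr_wpDl// addr_ge0//.
- rewrite mulr_ge0 ?(ltW c_gt0)// addr_ge0 ?lipschitz_energy_const_ge0//.
  by rewrite !mulr_ge0 ?powR_ge0// ltW// vol1_gt0.
- by rewrite !mulr_ge0 ?powR_ge0// inner_mass_ge0.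
Qed.

Lemma measurable_nonlinearity t : 0 < t ->
  measurable_fun setT (fun x => w x `^ q * w x / (w x + t)).
Proof.
move=> t0; apply: measurable_funM; last exact: measurable_wt_inv.
apply: measurable_funM => //; exact: (measurableT_comp (measurable_powR _)).
Qed.

Let omega_ltN : omega < N%:R.
Proof. exact: le_lt_trans omega_le N_gt2s. Qed.

(** The quotient [w / (w + t)] is at most [1], so only the mass of [V] in the
    ball of radius [2 * r] counts. *)
Lemma potential_term r t : 0 < r -> 0 < t ->
  (\int[mu]_x (V x * w x * picone_test r t x)%:E <=
   (CV * ((2 * r) `^ (N%:R - omega) * @inner_mass R N omega))%:E)%E.
Proof.
move=> r0 t0; have r2 : 0 < 2 * r by rewrite mulr_gt0.
have mf : measurable_fun setT (fun x : X => enorm x `^ (- omega) * \1_(eball (2 * r)) x).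
  apply: measurable_funM; first exact: measurable_enorm_powR.
  exact: measurable_indic_eball.
have f0 (x : X) : 0 <= enorm x `^ (- omega) * \1_(eball (2 * r)) x.
  by rewrite mulr_ge0// powR_ge0.
rewrite EFinM -inner_power_eball// -intRZ//.
apply: ae_ge0_le_integral => //.
- by move=> x _; rewrite lee_fin mulr_ge0 ?picone_test_ge0// mulr_ge0// ltW.
- apply/measurable_EFinP; apply: measurable_funM; last exact: measurable_picone_test.
  by apply: measurable_funM => //; exact: continuous_measurable_rV.
- by move=> x _; rewrite lee_fin mulr_ge0.
- by apply/measurable_EFinP; exact: measurable_funM.
exists [set 0]; split; [exact: measurable_set1_rV|exact: lebesgue_rV_set1|].
move=> x /=; apply: contra_notP => /eqP x0 _; rewrite lee_fin.
have a0 := wt_gt0 x t0.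
have H : w x * picone_test r t x <= \1_(eball (2 * r)) x.
  rewrite indicE; have [xb|xb] := boolP (x \in eball (2 * r)).
    rewrite /picone_test mulrCA -[leRHS]mul1r ler_pM ?sqr_ge0//.
    - by rewrite divr_ge0// ltW.
    - by rewrite exprn_ile1 ?cutoff_ge0 ?cutoff_le1.
    - by rewrite ler_pdivrMr// mul1r lerDl ltW.
  rewrite picone_test_out ?mulr0// ltNge; apply: contra xb; rewrite inE//.
rewrite -mulrA [leRHS]mulrA ler_pM//; last exact: V_le.
by rewrite mulr_ge0 ?picone_test_ge0// ltW.
Qed.

(** The energy of the cutoff and the remainder scale like [r `^ (N - 2 * s)],
    the potential term like [r `^ (N - omega)], which is the larger one since
    [r >= 1] and [omega <= 2 * s]. *)
Lemma harnack_inequality r t : 1 <= r -> 0 < t ->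
  (\int[mu]_x (\1_(eball r) x * (w x `^ q * w x / (w x + t)))%:E +
     (c * (2 * r) `^ (- @kexp R N s) * (inv_mass r t * ball_mass r))%:E <=
   (harnack_const * r `^ (N%:R - omega))%:E)%E.
Proof.
move=> r1 t0; have r0 : 0 < r by apply: lt_le_trans r1.
have H1 := energy_inequality r0 t0; have H2 := potential_term r0 t0.
have H3 := w_sol (picone_test_HsV r0 t0).
have ff : gagliardo_form s w (picone_test r t) \is a fin_num.
  apply: integrable_fin_num => //.
  exact: (form_integrable mw (measurable_picone_test r t0) w_gag (picone_test_gagliardo r0 t0)).
have W0 : (0 <= \int[mu]_x (V x * w x * picone_test r t x)%:E)%E.
  by apply: intR_ge0 => x; rewrite mulr_ge0 ?picone_test_ge0// mulr_ge0// ltW.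
have Wf : (\int[mu]_x (V x * w x * picone_test r t x)%:E)%E \is a fin_num.
  by rewrite ge0_fin_numE//; exact: le_lt_trans H2 (ltry _).
apply: (@le_trans _ _ (\int[mu]_x (w x `^ q * w x * picone_test r t x)%:E +
  (c * (2 * r) `^ (- @kexp R N s) * (inv_mass r t * ball_mass r))%:E)%E).
  rewrite leeD2r//; apply: le_intR.
  - apply: measurable_funM; first exact: measurable_indic_eball.
    exact: measurable_nonlinearity.
  - apply: measurable_funM; last exact: measurable_picone_test.
    by apply: measurable_funM => //; exact: (measurableT_comp (measurable_powR _)).
  - by move=> x; rewrite !mulr_ge0 ?powR_ge0 ?invr_ge0 ?(ltW (wt_gt0 x t0)) ?(ltW (w_gt0 x)).
  - move=> x; rewrite indicE; have [xb|xb] := boolP (x \in eball r).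
      rewrite mul1r /picone_test cutoff_in//; last by move: xb; rewrite inE.
      by rewrite expr1n mul1r.
    by rewrite mul0r mulr_ge0 ?picone_test_ge0// mulr_ge0 ?powR_ge0// ltW.
rewrite -H3 -(fineK ff) -(fineK Wf).
move: H1 H2; rewrite -{1}(fineK ff) -{1}(fineK Wf).
set F := fine (gagliardo_form _ _ _); set W := fine (\int[mu]_x (V x * w x * picone_test r t x)%:E)%E.
set I := inv_mass r t * ball_mass r; set k := (2 * r) `^ _.
rewrite -!EFinM -!EFinD !lee_fin => H1 H2.
have -> : c * F + W + c * k * I = c * (F + k * I) + W by ring.
apply: le_trans (lerD (ler_wpM2l (ltW c_gt0) H1) H2) _.
have E1 : r `^ (N%:R - 2 * s) <= r `^ (N%:R - omega).
  by apply: ler_powR => //; rewrite lerB.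
have E2 : k * (r ^+ N) ^+ 2 = 2 `^ (- @kexp R N s) * r `^ (N%:R - 2 * s).
  rewrite /k powRM ?(ltW r0)// -mulrA; congr (_ * _).
  rewrite -exprM -powR_mulrn ?(ltW r0)// -powRD; last by rewrite (gt_eqF r0) implybT.
  by congr (_ `^ _); rewrite /kexp natrM; ring.
have E3 : (2 * r) `^ (N%:R - omega) = 2 `^ (N%:R - omega) * r `^ (N%:R - omega).
  by rewrite powRM// ltW.
rewrite E3 exprMn (_ : 2 * k * ((r ^+ N) ^+ 2 * @vol1 R N ^+ 2) =
  2 * (k * (r ^+ N) ^+ 2) * @vol1 R N ^+ 2); last by ring.
rewrite E2 /harnack_const.
set x := r `^ (N%:R - omega) in E1 *; set y := r `^ (N%:R - 2 * s) in E1 *.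
set b := @lipschitz_energy_const R N s; set v := @vol1 R N; set m := @inner_mass R N omega.
set p1 := 2 `^ (- @kexp R N s); set p2 := 2 `^ (N%:R - omega).
have -> : c * (b * y + 2 * (p1 * y) * v ^+ 2) = c * (b + 2 * p1 * v ^+ 2) * y by ring.
have -> : (c * (b + 2 * p1 * v ^+ 2) + CV * (p2 * m) + 1) * x =
  c * (b + 2 * p1 * v ^+ 2) * x + CV * (p2 * x * m) + x by ring.
rewrite -addrA lerD//; last by rewrite lerDl powR_ge0.
apply: ler_wpM2l => //; rewrite mulr_ge0 ?(ltW c_gt0)// addr_ge0 ?lipschitz_energy_const_ge0//.
by rewrite !mulr_ge0 ?powR_ge0// ltW// vol1_gt0.
Qed.

(** The level [t] is chosen so that the part of the ball where [w >= t] carries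
    at most half of the volume; on the rest [1 / (w + t) >= 1 / (2 * t)]. *)
Lemma ball_mass_bound : exists2 C, 0 < C & forall r, 1 <= r ->
  ball_mass r <= C * r `^ (N%:R + 2 * s - omega - omega / q).
Proof.
have C1 := harnack_const_gt0; have v0 := @vol1_gt0 R N.
set C0 := harnack_const in C1 *; set v := @vol1 R N in v0 *.
(* This makes 2 / t `^ q times the bound C0 * r `^ (N - omega) of the
   nonlinear term equal to half of the volume of the ball. *)
pose D := (4 * C0 / v) `^ q^-1.
have D0 : 0 < D by rewrite powR_gt0 ?divr_gt0 ?mulr_gt0.
have k0 : 0 < 2 `^ @kexp R N s by rewrite powR_gt0.
exists (4 * C0 / (c * v) * D * 2 `^ @kexp R N s).
  by rewrite !mulr_gt0 ?invr_gt0 ?mulr_gt0.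
move=> r r1; have r0 : 0 < r by apply: lt_le_trans r1.
pose t := D * r `^ (- (omega / q)).
have t0 : 0 < t := mulr_gt0 D0 (powR_gt0 _ r0).
have tq : t `^ q = (4 * C0 / v) * r `^ (- omega).
  rewrite /t powRM ?powR_ge0 ?(ltW D0)// /D -!powRrM mulVf ?gt_eqF// powRr1.
    by congr (_ * _ `^ _); field; rewrite gt_eqF.
  by rewrite divr_ge0 ?mulr_ge0 ?ltW.
have H := harnack_inequality r1 t0; rewrite -/C0 in H.
pose f (x : X) := \1_(eball r) x * (w x `^ q * w x / (w x + t)).
pose g (x : X) := \1_(eball r) x * (w x + t)^-1.
have mf : measurable_fun setT f.
  apply: measurable_funM; first exact: measurable_indic_eball.
  exact: measurable_nonlinearity.
have mg : measurable_fun setT g.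
  by apply: measurable_funM; [exact: measurable_indic_eball|exact: measurable_wt_inv].
have f0 x : 0 <= f x.
  by rewrite !mulr_ge0 ?powR_ge0 ?invr_ge0 ?(ltW (wt_gt0 x t0)) ?(ltW (w_gt0 x)).
have g0 x : 0 <= g x by rewrite mulr_ge0// invr_ge0 (ltW (wt_gt0 x t0)).
have M0 := ball_mass_ge0 r; have I0 := inv_mass_ge0 r t0.
have k1 : 0 < (2 * r) `^ (- @kexp R N s) by rewrite powR_gt0 ?mulr_gt0.
have foo : (\int[mu]_x (f x)%:E < +oo)%E.
  apply: (@le_lt_trans _ _ (C0 * r `^ (N%:R - omega))%:E); last exact: ltry.
  apply: le_trans H; rewrite leeDl// lee_fin !mulr_ge0// ltW//.
have t1 : 0 < t `^ q by rewrite powR_gt0.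
have tc1 : 0 <= 2 / t `^ q by rewrite divr_ge0// ltW.
have tc2 : 0 <= 2 * t by rewrite mulr_ge0// ltW.
have cover : (\int[mu]_x (\1_(eball r) x)%:E <=
    \int[mu]_x (2 / t `^ q * f x + 2 * t * g x)%:E)%E.
  apply: le_intR.
  - exact: measurable_indic_eball.
  - by apply: measurable_funD; exact: measurable_funM.
  - by [].
  - move=> x; rewrite /f /g mulrCA [X in _ + X]mulrCA -mulrDr -[leLHS]mulr1.
    apply: ler_wpM2l => //; have a0 := wt_gt0 x t0; have wx := w_gt0 x.
    have [tw|wt] := leP t (w x).
      apply: (@le_trans _ _ (2 / t `^ q * (w x `^ q * w x / (w x + t)))); last first.
        by rewrite lerDl mulr_ge0// invr_ge0 ltW.
      have h1 : 1 <= w x `^ q / t `^ q.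
        rewrite ler_pdivlMr// mul1r.
        by apply: (ge0_ler_powR (ltW q_gt0)) => //; rewrite nnegrE ltW.
      have h2 : 1 <= 2 * (w x / (w x + t)).
        by rewrite mulrA ler_pdivlMr// mul1r; lra.
      have -> : 2 / t `^ q * (w x `^ q * w x / (w x + t)) =
          (w x `^ q / t `^ q) * (2 * (w x / (w x + t))).
        by field; rewrite !gt_eqF.
      by rewrite -[leLHS]mulr1 ler_pM.
    apply: (@le_trans _ _ (2 * t / (w x + t))); last first.
      by rewrite lerDr mulr_ge0// !mulr_ge0 ?powR_ge0 ?invr_ge0 ?(ltW a0) ?(ltW wx).
    by rewrite ler_pdivlMr// mul1r; lra.
move: cover H; rewrite integral_eball eballE// intRD//; last 4 first.
- exact: measurable_funM.
- exact: measurable_funM.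
- by move=> x; rewrite mulr_ge0.
- by move=> x; rewrite mulr_ge0.
rewrite intRZ// intRZ// (intR_fineK f0 foo) (intR_fineK g0 (inv_mass_fin r t0)).
rewrite -/(inv_mass r t) -!EFinM -!EFinD !lee_fin -/v.
set A := fine _; set I := inv_mass r t in I0 *; set k := (2 * r) `^ _ in k1 *.
have A0 : 0 <= A by rewrite fine_ge0// intR_ge0.
set x := r `^ (N%:R - omega) => cover H.
have xE : x = r ^+ N * r `^ (- omega).
  by rewrite /x -powR_mulrn ?(ltW r0)// -powRD// (gt_eqF r0) implybT.
have y0 : 0 < r `^ (- omega) by rewrite powR_gt0.
have rN : 0 < r ^+ N by rewrite exprn_gt0.
have kE : k = (2 `^ @kexp R N s * r `^ @kexp R N s)^-1.
  by rewrite /k powRN powRM// ltW.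
have z0 : 0 < r `^ @kexp R N s by rewrite powR_gt0.
have HA : A <= C0 * x.
  by apply: le_trans H; rewrite lerDl !mulr_ge0// ltW.
have HM : c * k * (I * ball_mass r) <= C0 * x by apply: le_trans H; rewrite lerDr.
have half : 2 / t `^ q * A <= v / 2 * r ^+ N.
  apply: le_trans (ler_wpM2l tc1 HA) _; rewrite tq xE le_eqVlt.
  by apply/orP; left; apply/eqP; field; rewrite !gt_eqF.
have t4 : 0 < 4 * t by rewrite (mulr_gt0 _ t0).
have HI : r ^+ N * v / (4 * t) <= I.
  rewrite ler_pdivrMr//.
  have := le_trans cover (lerD half (lexx _)); lra.
have HIM : c * k * (r ^+ N * v / (4 * t)) * ball_mass r <= C0 * x.
  apply: le_trans HM; rewrite -[leLHS]mulrA; apply: ler_wpM2l.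
    by rewrite mulr_ge0// ltW.
  exact: (ler_wpM2r M0 HI).
have c2 : 0 < c * k * (r ^+ N * v / (4 * t)).
  by rewrite mulr_gt0 ?(mulr_gt0 c_gt0 k1)// divr_gt0// mulr_gt0.
move: HIM; rewrite mulrC -ler_pdivlMr// => /le_trans; apply.
rewrite (_ : N%:R + 2 * s - omega - omega / q =
  @kexp R N s + - omega + - (omega / q)); last by rewrite /kexp; ring.
rewrite powRD; last by rewrite (gt_eqF r0) implybT.
rewrite powRD; last by rewrite (gt_eqF r0) implybT.
rewrite xE kE /t; set a := r `^ (- (omega / q)).
have a0 : 0 < a by rewrite powR_gt0.
rewrite le_eqVlt; apply/orP; left; apply/eqP.
by field; rewrite !gt_eqF.
Qed.

End ball_mass_bound.

(** * The quadratic form away from pairs of comparable norm *)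

Section far_kernel.
Context {R : realType} {N : nat} (s : R).
Local Notation X := 'rV[R]_N.
Local Notation mu := (@lebesgue_rV R N).
Local Notation K := (kern s).
Hypotheses (s_gt0 : 0 < s).

(** The norms [a] and [b] differ by more than the factor [l].  The smaller one
    has to be positive: at the origin homogeneity carries no information. *)
Definition far (l a b : R) : bool :=
  (0 < a) && (l * a < b) || (0 < b) && (l * b < a).

Definition far_kern (l : R) (x y : X) : R :=
  if far l (enorm x) (enorm y) then K (x - y) else 0.

Lemma farC l a b : far l a b = far l b a. Proof. by rewrite /far orbC. Qed.

Lemma far_scale l t a b : 0 < t -> far l (t * a) (t * b) = far l a b.
Proof. by move=> t0; rewrite /far !pmulr_rgt0// !(mulrCA l) !ltr_pM2l. Qed.

Lemma far_kernC l x y : far_kern l x y = far_kern l y x.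
Proof. by rewrite /far_kern farC kernC. Qed.

Lemma far_kern_ge0 l x y : 0 <= far_kern l x y.
Proof. by rewrite /far_kern; case: ifPn => // _; exact: kern_ge0. Qed.

Lemma far_kern_le l x y : far_kern l x y <= K (x - y).
Proof. by rewrite /far_kern; case: ifPn => // _; exact: kern_ge0. Qed.

Lemma far_kern_anti l l' x y : l <= l' -> far_kern l' x y <= far_kern l x y.
Proof.
move=> ll; rewrite /far_kern; case: ifPn => [|_]; last by case: ifPn => // _; exact: kern_ge0.
case/orP => /andP[a b].
  by rewrite /far a (le_lt_trans _ b)// ler_wpM2r// enorm_ge0.
by rewrite /far orbC a (le_lt_trans _ b)// ler_wpM2r// enorm_ge0.
Qed.

Lemma far_kern_origin l y : 0 <= l -> far_kern l 0 y = 0.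
Proof.
move=> l0; rewrite /far_kern /far enorm0 ltxx/= (ltNge (l * _)) mulr_ge0 ?enorm_ge0//.
by rewrite andbF.
Qed.

Lemma far_kern_similarity l t v x y : 0 < t ->
  far_kern l (t *: householder v x) (t *: householder v y) =
  t `^ (- @kexp R N s) * far_kern l x y.
Proof.
move=> t0; rewrite /far_kern !enormZ !enorm_householder gtr0_norm// far_scale//.
case: (far l (enorm x) (enorm y)); last by rewrite mulr0.
by rewrite (kern_similarity s v x y t0).
Qed.

Lemma measurable_far_kern l : measurable_fun setT (fun z : X * X => far_kern l z.1 z.2).
Proof.
have m1 : measurable_fun setT (fun z : X * X => enorm z.1).
  exact: (measurable_fst_comp (@measurable_enorm R N)).
have m2 : measurable_fun setT (fun z : X * X => enorm z.2).
  exact: (measurable_snd_comp (@measurable_enorm R N)).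
apply: measurable_fun_ifT => //; last exact: measurable_kern_diff.
apply: measurable_or; apply: measurable_and; apply: measurable_fun_ltr => //;
  exact: measurable_funM.
Qed.

Lemma measurable_far_kern2 l x : measurable_fun setT (far_kern l x).
Proof. exact: (measurable_fun_pair2 x (measurable_far_kern l)). Qed.

(** The triangle inequality: points whose norms are not comparable are at a
    distance comparable to the larger norm. *)
Lemma far_kern_bound l x y : 1 < l ->
  far_kern l x y <= (1 - l^-1) `^ (- @kexp R N s) *
    Num.max (enorm x) (enorm y) `^ (- @kexp R N s).
Proof.
move=> l1; have l0 : 0 < l by apply: lt_trans l1.
have c0 : 0 < 1 - l^-1 by rewrite subr_gt0 invf_lt1.
have kx : 0 < @kexp R N s by rewrite ltr_wpDl// mulr_gt0.
rewrite /far_kern; case: ifPn => [|_]; last by rewrite mulr_ge0 ?powR_ge0.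
wlog H : x y / (0 < enorm x) && (l * enorm x < enorm y) => [W|].
  case/orP => [xy|yx]; first by apply: W => //; rewrite /far xy.
  by rewrite maxC kernC; apply: W => //; rewrite /far yx.
move=> _; case/andP: H => x0 xy.
have y0 : 0 < enorm y by apply: lt_trans xy; rewrite mulr_gt0.
have xy' : enorm x <= l^-1 * enorm y by rewrite mulrC ler_pdivlMr// mulrC ltW.
have le : enorm x <= enorm y.
  by apply: (le_trans xy'); rewrite ler_piMl ?(ltW y0)// invf_le1// ltW.
rewrite max_r// -powRM ?(ltW c0) ?(ltW y0)//.
apply: (kern_le s_gt0 (mulr_gt0 c0 y0)).
have := enorm_lipschitz x y; rewrite distrC ger0_norm ?subr_ge0//.
by apply: le_trans; rewrite mulrBl mul1r lerB.
Qed.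

End far_kernel.

Section far_form_splitting.
Context {R : realType} {N : nat} (s l : R).
Local Notation X := 'rV[R]_N.
Local Notation mu := (@lebesgue_rV R N).
Local Notation Kt := (far_kern s l).
Hypotheses (s_gt0 : 0 < s).

(** Up to a factor [2], the fractional Laplacian with integration restricted to
    the points whose norm is not comparable to that of [x]. *)
Definition far_operator (g : X -> R) (x : X) : R :=
  fine (\int[mu]_y ((g x - g y) * Kt x y)%:E)%E.

Lemma integral_swap (F : X * X -> R) : (mu \x mu)%E.-integrable setT (EFin \o F) ->
  (mu \x mu)%E.-integrable setT (EFin \o (fun z => F (z.2, z.1))) /\
  (\int[mu \x mu]_z (F (z.2, z.1))%:E = \int[mu \x mu]_z (F z)%:E)%E.
Proof.
move=> iF; have mF : measurable_fun setT F.
  by apply/measurable_EFinP; exact: measurable_int iF.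
have mS : measurable_fun setT (fun z : X * X => F (z.2, z.1)).
  apply: (measurableT_comp mF).
  by apply: measurable_fun_pair; [exact: measurable_snd|exact: measurable_fst].
have iS : (mu \x mu)%E.-integrable setT (EFin \o (fun z => F (z.2, z.1))).
  apply: (integrable_dom (g := fun z => `|F (z.2, z.1)|) mS) => //.
    exact: measurableT_comp.
  rewrite (intR_swap (F := fun z => `|F z|))//; last exact: measurableT_comp.
  by have /integrableP[_] := iF.
split => //; rewrite -[LHS]/(\int[mu \x mu]_z (EFin \o (fun z => F (z.2, z.1))) z)%E.
by rewrite -(integral12_prod_meas1 iS) -[RHS](integral21_prod_meas1 iF).
Qed.

Lemma measurable_far_increment (g : X -> R) : measurable_fun setT g ->
  measurable_fun setT (fun z : X * X => (g z.1 - g z.2) * Kt z.1 z.2).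
Proof.
by move=> mg; apply: measurable_funM;
  [exact: measurable_increment|exact: measurable_far_kern].
Qed.

(** Exchanging the two variables turns the contribution of [f y] into that of
    [f x]; after truncation each of them converges absolutely. *)
Lemma far_form_splitting (f g : X -> R) : measurable_fun setT f -> measurable_fun setT g ->
  (forall x, 0 <= f x) ->
  (forall x, mu.-integrable setT (fun y => ((g x - g y) * Kt x y)%:E)) ->
  (\int[mu \x mu]_z (f z.1 * (`|g z.1 - g z.2| * Kt z.1 z.2))%:E < +oo)%E ->
  mu.-integrable setT (fun x => (f x * far_operator g x)%:E) /\
  (\int[mu \x mu]_z ((f z.1 - f z.2) * (g z.1 - g z.2) * Kt z.1 z.2)%:E =
   2%:E * \int[mu]_x (f x * far_operator g x)%:E)%E.
Proof.
move=> mf mg f0 ig foo.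
pose a (z : X * X) := f z.1 * ((g z.1 - g z.2) * Kt z.1 z.2).
have mfz : measurable_fun setT (fun z : X * X => f z.1) by exact: measurable_fst_comp.
have ma : measurable_fun setT a.
  by apply: measurable_funM => //; exact: measurable_far_increment.
have ia : (mu \x mu)%E.-integrable setT (EFin \o a).
  apply: (integrable_dom ma _ _ foo).
    apply: measurable_funM => //; apply: measurable_funM; last exact: measurable_far_kern.
    by apply: measurableT_comp => //; exact: measurable_increment.
  by move=> z; rewrite !normrM (ger0_norm (f0 _)) (ger0_norm (far_kern_ge0 _ _ _ _)).
have FE : fubini_F mu (EFin \o a) = (fun x => (f x * far_operator g x)%:E).
  apply/funext => x; rewrite /fubini_F/= /a/=.
  under eq_integral do rewrite EFinM.
  rewrite (integralZl measurableT (ig x)).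
  by rewrite EFinM /far_operator fineK//; exact: (integrable_fin_num measurableT (ig x)).
split; first by rewrite -FE; exact: integrable_fubini_F.
have [iS eS] := integral_swap ia.
have E z : ((f z.1 - f z.2) * (g z.1 - g z.2) * Kt z.1 z.2)%:E =
    ((a z)%:E + (a (z.2, z.1))%:E)%E.
  rewrite -EFinD /a/= (far_kernC _ _ z.2); congr EFin; ring.
have D := etrans (integralD measurableT ia iS)
  (congr1 (fun t => (\int[mu \x mu]_z (EFin \o a) z + t)%E) eS).
transitivity (\int[mu \x mu]_z ((EFin \o a) z +
    (EFin \o (fun z => a (z.2, z.1))) z))%E.
  by apply: eq_integral => z _; exact: E.
rewrite {}D -FE (integral12_prod_meas1 ia).
rewrite -[X in (X + X)%E]/(\int[mu \x mu]_z (EFin \o a) z)%E.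
rewrite -(fineK (integrable_fin_num measurableT ia)) -EFinD -EFinM.
by rewrite mulr_natl mulr2n.
Qed.

End far_form_splitting.

(** * Radial powers under the truncated operator *)

Section power_inequalities.
Context {R : realType}.

(** For [0 <= t <= 1] and [d <= 2] one has
    [1 - t `^ d <= 1 - t ^+ 2 <= 2 * (1 - t)]; here [t = a / b]. *)
Lemma powR_increment (d a b : R) : 0 < d -> d <= 2 -> 0 <= a -> a <= b -> 1 <= b ->
  b `^ d - a `^ d <= 2 * b `^ d * (b - a).
Proof.
move=> d0 d2 a0 ab b1; have b0 : 0 < b by apply: lt_le_trans b1.
have -> : a `^ d = b `^ d * (a / b) `^ d.
  by rewrite -powRM ?divr_ge0 ?(ltW b0)//; congr (_ `^ _); field; rewrite gt_eqF.
rewrite -[X in X - _]mulr1 -mulrBr (mulrC 2) -mulrA ler_wpM2l ?powR_ge0//.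
set t := a / b.
have t0 : 0 <= t by rewrite divr_ge0// ltW.
have t1 : t <= 1 by rewrite ler_pdivrMr// mul1r.
have tt : t ^+ 2 <= t `^ d.
  have [->|tn] := eqVneq t 0; first by rewrite expr0n/= powR_ge0.
  by rewrite -powR_mulrn//; apply: ger_powR => //; rewrite lt_def tn t0.
have h1 : 1 - t <= b - a.
  rewrite -subr_ge0 (_ : b - a - (1 - t) = (b - 1) * (1 - t)).
    by rewrite mulr_ge0// subr_ge0.
  by rewrite /t; field; rewrite gt_eqF.
have h2 : 1 - t ^+ 2 <= 2 * (1 - t).
  by have := sqr_ge0 (1 - t); rewrite sqrrB expr1n mul1r mulr2n; lra.
apply: (@le_trans _ _ (1 - t ^+ 2)); first by rewrite lerB.
by apply: (le_trans h2); rewrite ler_pM2l.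
Qed.

End power_inequalities.

Section annulus.
Context {R : realType} {N : nat}.
Local Notation X := 'rV[R]_N.
Local Notation mu := (@lebesgue_rV R N).

Definition annulus (a b : R) : set X := eball b `\` eball a.

Lemma measurable_annulus a b : measurable (annulus a b).
Proof. by apply: measurableD; exact: measurable_eball. Qed.

Lemma in_annulus a b (x : X) : (x \in annulus a b) = (a < enorm x <= b).
Proof.
apply/idP/idP; rewrite inE /annulus /eball/=.
  by move=> [-> /negP]; rewrite -ltNge => ->.
by move=> /andP[ax xb]; split => //; apply/negP; rewrite -ltNge.
Qed.

Lemma annulus_gt0 a b : (0 < N)%N -> 0 < a -> a < b ->
  (0 < \int[mu]_x (\1_(annulus a b) x)%:E)%E.
Proof.
move=> N0 a0 ab; have b0 := lt_trans a0 ab.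
rewrite integral_indic ?setIT//; last exact: measurable_annulus.
rewrite /annulus measureD; [|exact: measurable_eball|exact: measurable_eball|exact: eball_fin].
rewrite (_ : eball b `&` eball a = eball a); last first.
  by apply/seteqP; split => [x []//|x xa]; split => //; exact: le_trans (ltW ab).
change (0 < mu (eball b) - mu (eball a))%E.
rewrite !eballE// -EFinB lte_fin subr_gt0 ltr_pM2r ?vol1_gt0//.
by rewrite ltrXn2r ?gtn_eqF// ltW.
Qed.

Lemma measurable_indic_annulus a b : measurable_fun setT (\1_(annulus a b) : X -> R).
Proof. by apply: measurable_indic; exact: measurable_annulus. Qed.

End annulus.

Section power_functions.
Context {R : realType} {N : nat} (s : R).
Local Notation X := 'rV[R]_N.
Local Notation mu := (@lebesgue_rV R N).
Local Notation K := (kern s).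
Hypotheses (s_gt0 : 0 < s) (N_gt2s : 2 * s < N%:R).

Let N_gt0 : (0 < N)%N := dim_gt0 s_gt0 N_gt2s.

Definition unit_vector : X := delta_mx ord0 (Ordinal N_gt0).

Lemma enorm_unit_vector : enorm unit_vector = 1.
Proof.
rewrite enormE /dot (bigD1 (Ordinal N_gt0))//= big1 ?addr0.
  by rewrite !mxE !eqxx mulr1 sqrtr1.
by move=> i iN; rewrite !mxE (negbTE iN) andbF mulr0.
Qed.

Lemma unit_vector_similar (x : X) : x != 0 ->
  exists v, x = enorm x *: householder v unit_vector.
Proof.
move=> x0; have e0 : 0 < enorm x by rewrite enorm_gt0.
exists (unit_vector - (enorm x)^-1 *: x).
rewrite householder_move; first by rewrite scalerA divff ?scale1r// gt_eqF.
by rewrite enorm_unit_vector enormZ gtr0_norm ?invr_gt0// mulVf// gt_eqF.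
Qed.

(** With this sign the function decreases in the norm, as a cutoff does. *)
Definition npow (d : R) (x : X) : R := - enorm x `^ d.

Lemma measurable_npow d : measurable_fun setT (npow d).
Proof. exact: (measurableT_comp (@oppr_measurable R setT) (measurable_enorm_powR d)). Qed.

Variables (d l : R).
Hypotheses (d_gt0 : 0 < d) (d_lt2s : d < 2 * s) (l_gt1 : 1 < l).
Local Notation Kt := (far_kern s l).

Let l_gt0 : 0 < l. Proof. exact: lt_trans l_gt1. Qed.

Let b : R := @kexp R N s - d.
Let b_gtN : N%:R < b. Proof. by rewrite /b /kexp -addrA ltrDl subr_gt0. Qed.

Definition tail_mass (e : R) : R := fine (\int[mu]_x (tail_weight e x)%:E).

Lemma tail_mass_ge0 e : 0 <= tail_mass e.
Proof. by rewrite fine_ge0// intR_ge0// => x; exact: tail_weight_ge0. Qed.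

Lemma measurable_max_powR (x : X) (e : R) :
  measurable_fun setT (fun y : X => Num.max (enorm x) (enorm y) `^ e).
Proof. exact: (measurableT_comp (measurable_powR _) (measurable_max_enorm _)). Qed.

Lemma integral_max_powR (x : X) : x != 0 ->
  (\int[mu]_y (Num.max (enorm x) (enorm y) `^ (- b))%:E =
   (enorm x `^ (d - 2 * s) * tail_mass b)%:E)%E.
Proof.
move=> x0; have e0 : 0 < enorm x by rewrite enorm_gt0.
rewrite -(ge0_integral_similarity 0 e0
  (f := fun y => (Num.max (enorm x) (enorm y) `^ (- b))%:E)); last 2 first.
- by apply/measurable_EFinP; exact: measurable_max_powR.
- by move=> y; rewrite lee_fin powR_ge0.
have E (y : X) : Num.max (enorm x) (enorm (enorm x *: householder 0 y)) `^ (- b) =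
    enorm x `^ (- b) * tail_weight b y.
  rewrite /tail_weight -powRM ?le_max ?ler01 ?(ltW e0)// maxr_pMr ?(ltW e0)// mulr1.
  by rewrite enormZ enorm_householder gtr0_norm.
under eq_integral do rewrite E.
rewrite intRZ ?powR_ge0//; last 2 first.
- exact: measurable_tail_weight.
- exact: tail_weight_ge0.
rewrite intR_fineK; [|exact: tail_weight_ge0|exact: tail_weight_fin].
rewrite -!EFinM mulrA; congr (_ * _)%:E.
rewrite -powR_mulrn ?(ltW e0)// -powRD; last by rewrite (gt_eqF e0) implybT.
by congr (_ `^ _); rewrite /b /kexp; ring.
Qed.

Let Cl : R := (1 - l^-1) `^ (- @kexp R N s).

(** With a single power of the larger norm on the right side, the integral in
    [y] is determined by scaling. *)
Lemma npow_bound (x y : X) :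
  `|npow d x - npow d y| * Kt x y <= Cl * Num.max (enorm x) (enorm y) `^ (- b).
Proof.
have Cl0 : 0 <= Cl by exact: powR_ge0.
set m := Num.max (enorm x) (enorm y).
have m0 : 0 <= m by rewrite le_max enorm_ge0.
have [mz|mn] := eqVneq m 0.
  have x0 : enorm x = 0.
    by apply/eqP; rewrite eq_le enorm_ge0 andbT -mz le_max lexx.
  have -> : x = 0 by apply/eqP; rewrite -enorm_eq0 x0.
  by rewrite far_kern_origin ?(ltW l_gt0)// mulr0 mulr_ge0// powR_ge0.
have mp : 0 < m by rewrite lt_def mn.
have H : `|npow d x - npow d y| <= m `^ d.
  have hx : enorm x `^ d <= m `^ d.
    apply: (ge0_ler_powR (ltW d_gt0)); rewrite ?nnegrE ?enorm_ge0//.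
    by rewrite le_max lexx.
  have hy : enorm y `^ d <= m `^ d.
    apply: (ge0_ler_powR (ltW d_gt0)); rewrite ?nnegrE ?enorm_ge0//.
    by rewrite le_max lexx orbT.
  rewrite /npow opprK addrC.
  by apply: ler_dist_bound; rewrite ?powR_ge0.
apply: le_trans (ler_pM _ _ H (far_kern_bound _ _ _ _)) _ => //.
  exact: far_kern_ge0.
rewrite -/m -/Cl mulrCA ler_wpM2l// -powRD; last by rewrite (gt_eqF mp) implybT.
by rewrite /b opprB.
Qed.

Lemma measurable_npow_integrand (x : X) :
  measurable_fun setT (fun y => (npow d x - npow d y) * Kt x y).
Proof.
apply: measurable_funM; last exact: measurable_far_kern2.
by apply: measurable_funB => //; exact: measurable_npow.
Qed.

Lemma npow_abs_integral (x : X) : x != 0 ->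
  (\int[mu]_y (`|npow d x - npow d y| * Kt x y)%:E <=
   (Cl * (enorm x `^ (d - 2 * s) * tail_mass b))%:E)%E.
Proof.
move=> x0; rewrite EFinM -integral_max_powR// -intRZ; last 3 first.
- exact: (measurable_max_powR x (- b)).
- by move=> y; exact: powR_ge0.
- exact: powR_ge0.
apply: le_intR.
- apply: measurable_funM; last exact: measurable_far_kern2.
  apply: measurableT_comp => //; apply: measurable_funB => //; exact: measurable_npow.
- by apply: measurable_funM => //; exact: measurable_max_powR.
- by move=> y; rewrite mulr_ge0// far_kern_ge0.
- by move=> y; exact: npow_bound.
Qed.

Lemma npow_integrable (x : X) :
  mu.-integrable setT (fun y => ((npow d x - npow d y) * Kt x y)%:E).
Proof.
have [->|x0] := eqVneq x 0.
  rewrite (_ : (fun _ => _) = cst 0%E); first exact: integrable0.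
  by apply/funext => y; rewrite far_kern_origin ?(ltW l_gt0)// mulr0.
apply: (@integrable_dom _ _ _ mu _ (fun y => `|npow d x - npow d y| * Kt x y)).
- exact: measurable_npow_integrand.
- apply: measurable_funM; last exact: measurable_far_kern2.
  apply: measurableT_comp => //; apply: measurable_funB => //; exact: measurable_npow.
- by move=> y; rewrite normrM (ger0_norm (far_kern_ge0 _ _ _ _)).
- exact: le_lt_trans (npow_abs_integral x0) (ltry _).
Qed.

Lemma integral_similarity (t : R) v (f : X -> R) : 0 < t ->
  mu.-integrable setT (EFin \o f) ->
  ((t ^+ N)%:E * \int[mu]_x (f (t *: householder v x))%:E = \int[mu]_x (f x)%:E)%E.
Proof.
move=> t0 fi; set L := fun x => t *: householder v x.
rewrite [in RHS]integralE [in LHS]integralE.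
have mfE := measurable_int mu fi.
rewrite -[RHS]/(\int[mu]_x (EFin \o f)^\+ x - \int[mu]_x (EFin \o f)^\- x)%E.
rewrite -(ge0_integral_similarity v t0 (measurable_funepos mfE))//.
rewrite -(ge0_integral_similarity v t0 (measurable_funeneg mfE))//.
rewrite -[(fun x => (f _)%:E)]/((EFin \o f) \o L) funepos_comp funeneg_comp.
rewrite -[X in (_ * X)%E]/(\int[mu]_x (EFin \o f)^\+ (L x) - \int[mu]_x (EFin \o f)^\- (L x))%E.
rewrite muleBr//.
have H (g : X -> \bar R) : measurable_fun setT g -> (forall x, 0 <= g x)%E ->
    (\int[mu]_x g x < +oo)%E -> (\int[mu]_x g (L x))%E \is a fin_num.
  move=> mg g0 goo; rewrite ge0_fin_numE; last by apply: integral_ge0.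
  rewrite -(@lte_pmul2l _ (t ^+ N)%:E)//; last by rewrite lte_fin exprn_gt0.
  rewrite (ge0_integral_similarity v t0 mg g0); apply: (lt_le_trans goo).
  by rewrite gt0_muley// lte_fin exprn_gt0.
apply: fin_num_adde_defr; apply: H.
- exact: measurable_funepos.
- by [].
- exact: integral_funepos_lt_pinfty.
Qed.

Definition far_const : R := far_operator s l (npow d) unit_vector.

(** Every nonzero [x] is the image of one fixed unit vector under a similarity
    of ratio [enorm x], and both the region of integration and the kernel are
    covariant under similarities. *)
Lemma far_operator_npow (x : X) : far_operator s l (npow d) x = far_const * enorm x `^ (d - 2 * s).
Proof.
have [->|x0] := eqVneq x 0.
  rewrite enorm0 powR0 ?mulr0; last by rewrite subr_eq0 lt_eqF.
  rewrite /far_operator (_ : (\int[mu]_y _)%E = 0%E)//.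
  rewrite -[RHS](integral0 mu setT); apply: eq_integral => y _.
  by rewrite far_kern_origin ?(ltW l_gt0)// mulr0.
have e0 : 0 < enorm x by rewrite enorm_gt0.
have [v xE] := unit_vector_similar x0.
rewrite /far_operator -(integral_similarity v e0 (npow_integrable x)).
have E y : (npow d x - npow d (enorm x *: householder v y)) * Kt x (enorm x *: householder v y) =
    enorm x `^ (- b) * ((npow d unit_vector - npow d y) * Kt unit_vector y).
  rewrite {3}xE far_kern_similarity// /npow {1}xE !enormZ !enorm_householder.
  rewrite (gtr0_norm e0) !powRM ?enorm_ge0 ?(ltW e0)//.
  have -> : enorm x `^ (- b) = enorm x `^ d * enorm x `^ (- @kexp R N s).
    rewrite -powRD; last by rewrite (gt_eqF e0) implybT.
    by rewrite /b opprB.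
  by rewrite -!mulrN -mulrDr mulrACA.
under eq_integral do rewrite E EFinM.
rewrite (integralZl measurableT (npow_integrable unit_vector)).
rewrite muleA -EFinM fineM//; last exact: (integrable_fin_num measurableT (npow_integrable _)).
rewrite /far_const mulrC; congr (_ * _).
rewrite /= -powR_mulrn ?(ltW e0)// -powRD; last by rewrite (gt_eqF e0) implybT.
by congr (_ `^ _); rewrite /b /kexp; ring.
Qed.

End power_functions.

(** * Sign and size of the constants on radial powers *)

Section pairing.
Context {R : realType} {N : nat} (s : R).
Local Notation X := 'rV[R]_N.
Local Notation mu := (@lebesgue_rV R N).
Local Notation K := (kern s).
Hypotheses (s_gt0 : 0 < s) (s_lt1 : s < 1) (N_gt2s : 2 * s < N%:R).
Variable d : R.
Hypotheses (d_gt0 : 0 < d) (d_lt2s : d < 2 * s).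

Local Notation h := (@cutoff R N 1).
Local Notation g := (@npow R N d).

Let N_gt0 : (0 < N)%N := dim_gt0 s_gt0 N_gt2s.

Let d_le2 : d <= 2. Proof. by have := d_lt2s; have := s_lt1; lra. Qed.

Lemma cutoff_anti (x y : X) : enorm x <= enorm y -> h y <= h x.
Proof. by move=> xy; apply: clip_mono; rewrite lerB// ler_pM2r. Qed.

Lemma npow_anti (x y : X) : enorm x <= enorm y -> g y <= g x.
Proof.
move=> xy; rewrite lerN2; apply: (ge0_ler_powR (ltW d_gt0)) => //;
  by rewrite nnegrE enorm_ge0.
Qed.

(** Both functions decrease in the norm. *)
Lemma comonotone (x y : X) : 0 <= (h x - h y) * (g x - g y).
Proof.
have [xy|/ltW yx] := leP (enorm x) (enorm y).
  by rewrite mulr_ge0 ?subr_ge0 ?cutoff_anti ?npow_anti.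
by rewrite mulr_le0 ?subr_le0 ?cutoff_anti ?npow_anti.
Qed.

(** Short increments are controlled by the Lipschitz constants, which for the
    power is available because the cutoff only varies between the radii 1 and 2;
    long increments are controlled by the growth of the power. *)
Lemma pairing_bound (x y : X) : (h x - h y) * (g x - g y) <=
  18 * (\1_(eball 2) x + \1_(eball 2) y) *
  Num.min (enorm (x - y) ^+ 2) (enorm (x - y) `^ d).
Proof.
have far_norm (a b c : R) : b <= a + c -> a <= 2 -> 1 <= c -> b <= 3 * c by lra.
have near_norm (a b c : R) : b <= a + c -> a <= 2 -> c <= 1 -> b <= 3 by lra.
wlog xy : x y / enorm x <= enorm y => [H|].
  have [/H//|/ltW/H {}H] := leP (enorm x) (enorm y).
  rewrite enorm_distC (addrC (\1_(eball 2) x)).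
  by rewrite -[leLHS]mulrNN !opprB.
set D := enorm (x - y); have D0 : 0 <= D by exact: enorm_ge0.
set m := Num.min _ _; have m0 : 0 <= m by rewrite le_min exprn_ge0// powR_ge0.
have rhs0 : 0 <= 18 * (\1_(eball 2) x + \1_(eball 2) y) * m :> R.
  by rewrite !mulr_ge0// addr_ge0.
have [x2|x2] := ltP 2 (enorm x).
  have -> : h x = 0 by apply: cutoff_out => //; rewrite mulr1 ltW.
  have -> : h y = 0 by apply: cutoff_out => //; rewrite mulr1 (le_trans (ltW x2)).
  by rewrite subrr mul0r.
have [y1|y1] := leP (enorm y) 1.
  rewrite !cutoff_in ?subrr ?mul0r//; exact: le_trans xy y1.
have i1 : \1_(eball 2) x = 1 :> R by rewrite indicE mem_set.
apply: (@le_trans _ _ (18 * m)); last first.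
  by rewrite i1 ler_wpM2r// -[leLHS]mulr1 ler_wpM2l// lerDl.
have h0 : 0 <= h x - h y by rewrite subr_ge0 cutoff_anti.
have g0 : 0 <= g x - g y by rewrite subr_ge0 npow_anti.
have gE : g x - g y = enorm y `^ d - enorm x `^ d by rewrite /npow opprK addrC.
have h1 : h x - h y <= 1.
  by rewrite -[leRHS]subr0 lerB ?cutoff_le1 ?cutoff_ge0.
have yD : enorm y <= enorm x + D.
  by have := enormD x (y - x); rewrite subrKC /D enorm_distC.
have y0 : 0 <= enorm y by exact: enorm_ge0.
have nine : (3 : R) `^ d <= 9.
  apply: (@le_trans _ _ (3 `^ 2)); first by apply: ler_powR; [rewrite ler1n|exact: d_le2].
  by rewrite powR_mulrn ?ler0n// -natrX ler_nat.
have [D1|D1] := ltP 1 D.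
  have mE : m = D `^ d.
    rewrite /m min_r// -powR_mulrn//; apply: ler_powR => //; exact: ltW.
  have yb : enorm y `^ d <= 9 * D `^ d.
    apply: (@le_trans _ _ ((3 * D) `^ d)).
      apply: (ge0_ler_powR (ltW d_gt0)); rewrite ?nnegrE ?mulr_ge0//.
      exact: far_norm yD x2 (ltW D1).
    by rewrite powRM// ler_wpM2r// powR_ge0.
  have gb : g x - g y <= 9 * D `^ d.
    by rewrite gE; apply: le_trans yb; rewrite lerBlDr lerDl powR_ge0.
  rewrite mE; apply: le_trans (ler_pM h0 g0 h1 gb) _.
  by rewrite mul1r ler_wpM2r ?powR_ge0// ler_nat.
have mE : m = D ^+ 2.
  have [Dz|Dn] := eqVneq D 0.
    by rewrite /m -/D Dz expr0n/= min_l// powR_ge0.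
  rewrite /m min_l// -powR_mulrn//; apply: ger_powR => //.
  by rewrite lt_def Dn D0.
have hD : h x - h y <= D.
  have := cutoff_lipschitz x y (ltr01 : 0 < 1 :> R); rewrite expr1n mul1r divr1.
  rewrite le_min => /andP[_]; rewrite ler_pXn2r ?nnegrE// => H.
  exact: le_trans (ler_norm _) H.
have gb : g x - g y <= 18 * D.
  rewrite gE; apply: le_trans (powR_increment d_gt0 d_le2 (enorm_ge0 x) xy (ltW y1)) _.
  have y3 : enorm y `^ d <= 9.
    apply: le_trans nine; apply: (ge0_ler_powR (ltW d_gt0)); rewrite ?nnegrE//.
    exact: near_norm yD x2 D1.
  have hh : 0 <= enorm y - enorm x by rewrite subr_ge0.
  apply: (@le_trans _ _ (2 * 9 * (enorm y - enorm x))).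
    by rewrite ler_wpM2r// ler_wpM2l.
  by rewrite -natrM ler_wpM2l// lerBlDl.
rewrite mE; apply: le_trans (ler_pM h0 g0 hD gb) _.
by rewrite expr2 mulrCA.
Qed.

Definition pair_kernel (z : X * X) : R := (h z.1 - h z.2) * (g z.1 - g z.2).

Lemma measurable_pair_kernel : measurable_fun setT pair_kernel.
Proof.
apply: measurable_funM; apply: measurable_increment.
  exact: measurable_cutoff.
exact: measurable_npow.
Qed.

Lemma pair_kernel_fin : (\int[mu \x mu]_z (pair_kernel z * K (z.1 - z.2))%:E < +oo)%E.
Proof.
have mi := measurable_indic_eball (N := N) (2 : R).
have ma : measurable_fun setT (fun x : X => 18 * \1_(eball 2) x : R) by exact: measurable_funM.
have mj := @measurable_jump_weight R N s d.
have a0 (x : X) : 0 <= 18 * \1_(eball 2) x :> R by rewrite mulr_ge0.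
apply: (@le_lt_trans _ _ (\int[mu \x mu]_z
   (18 * \1_(eball 2) z.1 * jump_weight s d (z.1 - z.2) +
    18 * \1_(eball 2) z.2 * jump_weight s d (z.1 - z.2))%:E)%E).
  apply: le_intR.
  - by apply: measurable_funM; [exact: measurable_pair_kernel|exact: measurable_kern_diff].
  - apply: measurable_funD; apply: measurable_funM; try exact: measurable_diff_comp.
      exact: (measurable_fst_comp ma).
    exact: (measurable_snd_comp ma).
  - by move=> z; rewrite mulr_ge0 ?comonotone ?kern_ge0.
  - move=> z; rewrite -mulrDl -mulrDr /jump_weight mulrA ler_wpM2r ?kern_ge0//.
    exact: pairing_bound.
rewrite intRD.
- rewrite (intR_pair_fst ma mj)//; last exact: jump_weight_ge0.
  rewrite (intR_pair_snd ma mj)//; [|exact: jump_weight_ge0|exact: jump_weightN].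
  have joo := jump_weight_fin (N := N) s_gt0 s_lt1 d_lt2s.
  have Joo : (\int[mu]_x (18 * \1_(eball 2) x : R)%:E < +oo)%E by exact: intR_indic_fin.
  rewrite (intR_fineK a0 Joo) (intR_fineK (jump_weight_ge0 s d) joo).
  by rewrite -EFinM -EFinD ltry.
- by apply: measurable_funM; [exact: (measurable_fst_comp ma)|exact: (measurable_diff_comp mj)].
- by apply: measurable_funM; [exact: (measurable_snd_comp ma)|exact: (measurable_diff_comp mj)].
- by move=> z; rewrite mulr_ge0// jump_weight_ge0.
- by move=> z; rewrite mulr_ge0// jump_weight_ge0.
Qed.

Definition pair_mass : R := fine (\int[mu]_x (h x * enorm x `^ (d - 2 * s))%:E).

Lemma measurable_pair_mass : measurable_fun setT (fun x : X => h x * enorm x `^ (d - 2 * s)).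
Proof. by apply: measurable_funM; [exact: measurable_cutoff|exact: measurable_enorm_powR]. Qed.

Lemma pair_mass_pt_ge0 (x : X) : 0 <= h x * enorm x `^ (d - 2 * s).
Proof. by rewrite mulr_ge0 ?cutoff_ge0// powR_ge0. Qed.

Lemma pair_mass_fin : (\int[mu]_x (h x * enorm x `^ (d - 2 * s))%:E < +oo)%E.
Proof.
apply: (@le_lt_trans _ _ (\int[mu]_x (enorm x `^ (- (2 * s - d)) * \1_(eball 2) x)%:E)%E).
  apply: le_intR.
  - exact: measurable_pair_mass.
  - by apply: measurable_funM; [exact: measurable_enorm_powR|exact: measurable_indic_eball].
  - exact: pair_mass_pt_ge0.
  - move=> x; rewrite opprB mulrC ler_wpM2l ?powR_ge0// indicE.
    have [xb|xb] := boolP (x \in eball 2); first exact: cutoff_le1.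
    rewrite cutoff_out// mulr1 leNgt; apply: contra xb => /ltW; by rewrite inE.
rewrite inner_power_eball ?ltry//.
by have := d_gt0; have := N_gt2s; lra.
Qed.

Lemma pair_mass_gt0 : 0 < pair_mass.
Proof.
rewrite fine_gt0// pair_mass_fin andbT.
have hlf : (2^-1 : R) < 1 by rewrite invf_lt1// ltr1n.
apply: lt_le_trans (annulus_gt0 N_gt0 _ hlf) _; first by rewrite invr_gt0.
apply: le_intR.
- exact: measurable_indic_annulus.
- exact: measurable_pair_mass.
- by [].
move=> x; rewrite indicE; have [|_] := boolP (x \in annulus 2^-1 1); last exact: pair_mass_pt_ge0.
rewrite in_annulus => /andP[x1 x2].
have x0 : 0 < enorm x by apply: lt_trans x1; rewrite invr_gt0.
rewrite cutoff_in// mul1r.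
apply: (@le_trans _ _ (enorm x `^ 0)); first by rewrite powRr0.
apply: ger_powR; first by rewrite x0.
by rewrite subr_le0 ltW.
Qed.

Section level.
Variables (l : R).
Hypothesis l_gt1 : 1 < l.
Local Notation Kt := (far_kern s l).

Lemma pairing_far_form :
  (\int[mu \x mu]_z (pair_kernel z * Kt z.1 z.2)%:E =
   (2 * (far_const s_gt0 N_gt2s d l * pair_mass))%:E)%E.
Proof.
have mh : measurable_fun setT h := measurable_cutoff 1.
have mg : measurable_fun setT g := measurable_npow d.
pose Cm := (1 - l^-1) `^ (- @kexp R N s) * @tail_mass R N (@kexp R N s - d).
have Cm0 : 0 <= Cm by rewrite mulr_ge0 ?powR_ge0// tail_mass_ge0.
have mF : measurable_fun setT (fun z : X * X => h z.1 * (`|g z.1 - g z.2| * Kt z.1 z.2)).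
  apply: measurable_funM; first exact: measurable_fst_comp.
  apply: measurable_funM; last exact: measurable_far_kern.
  by apply: measurableT_comp => //; exact: measurable_increment.
have foo : (\int[mu \x mu]_z (h z.1 * (`|g z.1 - g z.2| * Kt z.1 z.2))%:E < +oo)%E.
  rewrite (fubini_tonelli1 (fun z : X * X => (h z.1 * (`|g z.1 - g z.2| * Kt z.1 z.2))%:E)); last 2 first.
  - exact/measurable_EFinP.
  - by move=> z; rewrite lee_fin !mulr_ge0 ?cutoff_ge0 ?far_kern_ge0.
  apply: (@le_lt_trans _ _ (\int[mu]_x (Cm * (h x * enorm x `^ (d - 2 * s)))%:E)%E); last first.
    rewrite intRZ//; last 2 first.
    - exact: measurable_pair_mass.
    - exact: pair_mass_pt_ge0.
    by rewrite lte_mul_pinfty// pair_mass_fin.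
  apply: ge0_le_integral => //.
  - move=> x _; apply: integral_ge0 => y _.
    by rewrite lee_fin !mulr_ge0 ?cutoff_ge0 ?far_kern_ge0.
  - apply: (measurable_fun_fubini_tonelli_F (m2 := mu)
      (fun z : X * X => (h z.1 * (`|g z.1 - g z.2| * Kt z.1 z.2))%:E)).
      exact/measurable_EFinP.
    by move=> z; rewrite lee_fin !mulr_ge0 ?cutoff_ge0 ?far_kern_ge0.
  - by apply/measurable_EFinP; apply: measurable_funM => //; exact: measurable_pair_mass.
  move=> x _; rewrite /fubini_F/=.
  have [->|x0] := eqVneq x 0.
    under eq_integral do rewrite far_kern_origin ?(ltW (lt_trans ltr01 l_gt1))// !mulr0.
    by rewrite integral0 lee_fin mulr_ge0// pair_mass_pt_ge0.
  rewrite intRZ ?cutoff_ge0//; last 2 first.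
  - apply: measurable_funM; last exact: measurable_far_kern2.
    apply: (measurableT_comp (@normr_measurable R setT)).
    exact: (measurable_funB (measurable_cst _) mg).
  - by move=> y; rewrite mulr_ge0// far_kern_ge0.
  have := npow_abs_integral s_gt0 d_gt0 d_lt2s l_gt1 x0 => H.
  apply: le_trans (lee_wpmul2l _ H) _; first by rewrite lee_fin cutoff_ge0.
  by rewrite -EFinM lee_fin /Cm le_eqVlt; apply/orP; left; apply/eqP; ring.
have [_ ->] := far_form_splitting mh mg (cutoff_ge0 1) (npow_integrable s_gt0 d_gt0 d_lt2s l_gt1) foo.
under eq_integral do rewrite (far_operator_npow s_gt0 N_gt2s d_gt0 d_lt2s l_gt1) mulrCA EFinM.
rewrite integralZl//; last first.
  apply: (integrable_dom measurable_pair_mass measurable_pair_mass) => [x|].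
    by rewrite ger0_norm// pair_mass_pt_ge0.
  exact: pair_mass_fin.
by rewrite (intR_fineK pair_mass_pt_ge0 pair_mass_fin) -!EFinM.
Qed.

End level.

Lemma measurable_pair_far l :
  measurable_fun setT (fun z : X * X => pair_kernel z * far_kern s l z.1 z.2).
Proof. by apply: measurable_funM; [exact: measurable_pair_kernel|exact: measurable_far_kern]. Qed.

(** All increments have the same sign, so it suffices to look at the pairs of
    points taken from two separated annuli. *)
Lemma pair_far_gt0 : (0 < \int[mu \x mu]_z (pair_kernel z * far_kern s 2 z.1 z.2)%:E)%E.
Proof.
have hlf : (4^-1 : R) < 2^-1 by rewrite ltf_pV2 ?posrE// ltr_nat.
have q0 : 0 < 4^-1 :> R by rewrite invr_gt0.
have A1 := annulus_gt0 N_gt0 q0 hlf.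
have A2 := annulus_gt0 N_gt0 (ltr0n R 2) (ltr_nat R 2 3).
have m1 := @measurable_indic_annulus R N 4^-1 2^-1.
have m2 := @measurable_indic_annulus R N 2 3.
pose k : R := (2 `^ d - 1) * 4 `^ (- @kexp R N s).
have pd : 1 < 2 `^ d.
  by rewrite -[ltLHS](powRr0 2) /powR !gt_eqF// ltr_expR mul0r mulr_gt0// ln_gt0// ltr1n.
have k0 : 0 < k by rewrite mulr_gt0 ?powR_gt0// subr_gt0.
have mk : measurable_fun setT (fun x : X => k * \1_(annulus 4^-1 2^-1) x).
  exact: measurable_funM.
apply: (@lt_le_trans _ _ (\int[mu \x mu]_z
   (k * \1_(annulus 4^-1 2^-1) z.1 * \1_(annulus 2 3) z.2)%:E)%E).
  rewrite (intR_prod mk m2)//; last by move=> x; rewrite mulr_ge0// ltW.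
  rewrite intRZ ?(ltW k0)//.
  by rewrite mule_gt0// mule_gt0.
apply: le_intR.
- by apply: measurable_funM; [exact: (measurable_fst_comp mk)|exact: (measurable_snd_comp m2)].
- exact: measurable_pair_far.
- by move=> z; rewrite mulr_ge0// mulr_ge0// ltW.
move=> [x y]/=; have P0 : 0 <= pair_kernel (x, y) * far_kern s 2 x y.
  by rewrite mulr_ge0 ?comonotone ?far_kern_ge0.
rewrite !indicE; have [xa|_] := boolP (x \in annulus 4^-1 2^-1); last by rewrite mulr0 mul0r.
have [ya|_] := boolP (y \in annulus 2 3); last by rewrite mulr0.
move: xa ya; rewrite !in_annulus => /andP[x1 x2] /andP[y1 y2]; rewrite !mulr1.
have x0 : 0 < enorm x by apply: lt_trans x1.
have x3 : enorm x <= 1 by apply: (le_trans x2); rewrite invf_le1// ler1n.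
rewrite /pair_kernel/= cutoff_in// (@cutoff_out _ _ 1 y) ?ltr01 ?mulr1 ?(ltW y1)// subr0 mul1r.
rewrite /far_kern /far x0 (le_lt_trans _ y1)/=; last by lra.
apply: ler_pM.
- by rewrite subr_ge0 ltW.
- exact: powR_ge0.
- rewrite /npow opprK [leRHS]addrC lerB//.
    by apply: (ge0_ler_powR (ltW d_gt0)); rewrite ?nnegrE ?enorm_ge0// ltW.
  have := @ge0_ler_powR _ d (ltW d_gt0) (enorm x) 1; rewrite powR1; apply => //.
    by rewrite nnegrE enorm_ge0.
  by rewrite nnegrE.
- apply: (kern_ge s_gt0).
    rewrite subr_eq0; apply: contraTneq x3 => ->; rewrite -ltNge.
    by apply: lt_trans y1; rewrite ltr1n.
  apply: le_trans (enormD _ _) _; rewrite enormN; lra.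
Qed.

(** Pairing with the cutoff gives the constant as a quotient with fixed positive
    denominator.  The numerator is an integral of products of increments of
    equal sign over a region that grows as [l] decreases: its value for [l = 2]
    bounds it from below, and the integral over all pairs, which is finite,
    bounds it from above. *)
Lemma far_const_bounds : exists c1 c2 : R, 0 < c1 /\
  forall l, 1 < l -> l <= 2 -> c1 <= far_const s_gt0 N_gt2s d l <= c2.
Proof.
have m0 := pair_mass_gt0; have m2 : 0 < 2 * pair_mass by rewrite mulr_gt0.
pose Q := fine (\int[mu \x mu]_z (pair_kernel z * K (z.1 - z.2))%:E).
have c20 : 0 < far_const s_gt0 N_gt2s d 2.
  have := pair_far_gt0; rewrite pairing_far_form ?ltr1n// lte_fin mulrCA.
  by rewrite pmulr_lgt0.
exists (far_const s_gt0 N_gt2s d 2), (Q / (2 * pair_mass)); split => // l l1 l2.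
have pk0 z : 0 <= pair_kernel z * K (z.1 - z.2).
  by rewrite mulr_ge0 ?comonotone ?kern_ge0.
apply/andP; split.
  rewrite -(ler_pM2r m2) !(mulrCA _ 2) -lee_fin.
  rewrite -(pairing_far_form l1) -(@pairing_far_form 2 (ltr1n R 2)).
  apply: le_intR.
  - exact: measurable_pair_far.
  - exact: measurable_pair_far.
  - by move=> z; rewrite mulr_ge0 ?comonotone ?far_kern_ge0.
  - by move=> z; rewrite ler_wpM2l ?comonotone// far_kern_anti.
rewrite ler_pdivlMr// mulrCA -lee_fin -(pairing_far_form l1) /Q.
rewrite -intR_fineK//; last exact: pair_kernel_fin.
apply: le_intR => //.
- exact: measurable_pair_far.
- by apply: measurable_funM; [exact: measurable_pair_kernel|exact: measurable_kern_diff].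
- by move=> z; rewrite mulr_ge0 ?comonotone ?far_kern_ge0.
- by move=> z; rewrite ler_wpM2l ?comonotone// far_kern_le.
Qed.

End pairing.

(** * A radial test function with compact support *)

Lemma max0_lipschitz {R : realType} (u v : R) :
  `|Num.max 0 u - Num.max 0 v| <= `|u - v|.
Proof.
wlog uv : u v / u <= v => [H|].
  have [/H//|/ltW/H] := leP u v.
  by rewrite distrC [X in _ <= X]distrC.
rewrite [X in _ <= X]distrC [X in _ <= X]ger0_norm ?subr_ge0//.
rewrite /Num.max /Order.max ler_norml.
by do ! case: ifPn; rewrite -?leNgt => *; apply/andP; split; lra.
Qed.

Section profile.
Context {R : realType} {N : nat} (s : R).
Local Notation X := 'rV[R]_N.
Local Notation mu := (@lebesgue_rV R N).
Local Notation K := (kern s).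
Hypotheses (s_gt0 : 0 < s) (s_lt1 : s < 1) (N_gt2s : 2 * s < N%:R).
Variables (d e rho r : R).
Hypotheses (d_gt0 : 0 < d) (d_lte : d < e) (e_lt2s : e < 2 * s).
Hypotheses (rho_ge1 : 1 <= rho) (rho_le : rho <= r).

Let rho_gt0 : 0 < rho. Proof. exact: lt_le_trans rho_ge1. Qed.
Let r_ge1 : 1 <= r. Proof. exact: le_trans rho_le. Qed.
Let r_gt0 : 0 < r. Proof. exact: lt_le_trans r_ge1. Qed.
Let e_gt0 : 0 < e. Proof. exact: lt_trans d_lte. Qed.
Let d_lt2s : d < 2 * s. Proof. exact: lt_trans e_lt2s. Qed.
Let e_le2 : e <= 2. Proof. by have := e_lt2s; have := s_lt1; lra. Qed.
Let d_le2 : d <= 2. Proof. by have := e_le2; have := d_lte; lra. Qed.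

(** The last term vanishes for small radii and dominates beyond [r]: it confines
    the positive part to radii between [rho] and [r] without a cutoff function,
    for which the operator would not be explicit. *)
Definition profile (t : R) : R := t `^ d - rho `^ d - r `^ (d - e) * t `^ e.

Definition bump (x : X) : R := Num.max 0 (profile (enorm x)).

Lemma bump_ge0 x : 0 <= bump x. Proof. by rewrite le_max lexx. Qed.

Lemma profile_le_rho t : 0 <= t -> t <= rho -> profile t <= 0.
Proof.
move=> t0 tr; rewrite /profile subr_le0 (@le_trans _ _ 0) ?mulr_ge0 ?powR_ge0//.
by rewrite subr_le0; apply: (ge0_ler_powR (ltW d_gt0)) => //; rewrite nnegrE ltW.
Qed.

Lemma profile_ge_r t : r <= t -> profile t <= 0.
Proof.
move=> rt; have t0 : 0 < t by apply: lt_le_trans rt.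
rewrite /profile -addrA -opprD subr_le0.
apply: (@le_trans _ _ (r `^ (d - e) * t `^ e)); last by rewrite lerDr powR_ge0.
rewrite -opprB powRN ler_pdivlMl ?powR_gt0//.
rewrite {2}(_ : e = (e - d) + d); last by ring.
rewrite powRD; last by rewrite (gt_eqF t0) implybT.
rewrite ler_wpM2r ?powR_ge0//.
by apply: ge0_ler_powR; rewrite ?nnegrE ?subr_ge0 ?(ltW r_gt0) ?(ltW t0) ?(ltW d_lte).
Qed.

Lemma bump_support x : 0 < bump x -> rho < enorm x < r.
Proof.
rewrite /bump lt_max ltxx/= => H; apply/andP; split.
  by rewrite ltNge; apply: contraL H => xr; rewrite -leNgt profile_le_rho ?enorm_ge0.
by rewrite ltNge; apply: contraL H => xr; rewrite -leNgt profile_ge_r.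
Qed.

Lemma bump_out x : ~~ (rho < enorm x < r) -> bump x = 0.
Proof.
move=> H; apply/eqP; rewrite eq_le bump_ge0 andbT leNgt.
exact: contra (@bump_support x) H.
Qed.

Lemma bump_le_powR x : bump x <= enorm x `^ d.
Proof.
rewrite /bump ge_max powR_ge0/= /profile -addrA -opprD lerBlDr lerDl.
by rewrite addr_ge0 ?powR_ge0// mulr_ge0 ?powR_ge0.
Qed.

Lemma bump_le x : bump x <= r `^ d.
Proof.
have [/andP[_ xr]|H] := boolP (rho < enorm x < r); last by rewrite bump_out ?powR_ge0.
apply: (le_trans (bump_le_powR x)); apply: (ge0_ler_powR (ltW d_gt0)).
- by rewrite nnegrE enorm_ge0.
- by rewrite nnegrE ltW.
- exact: ltW.
Qed.

Let clamp (t : R) : R := Num.min r (Num.max rho t).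

Let bump_clamp x : bump x = Num.max 0 (profile (clamp (enorm x))).
Proof.
rewrite /clamp; case/orP: (le_total (enorm x) rho) => xr.
  rewrite (max_l xr) (min_r rho_le) bump_out; last by rewrite ltNge xr.
  by rewrite max_l// profile_le_rho// ltW.
rewrite (max_r xr); case/orP: (le_total (enorm x) r) => rx.
  by rewrite (min_r rx).
rewrite (min_l rx) bump_out; last by rewrite (ltNge _ r) rx andbF.
by rewrite max_l// profile_ge_r.
Qed.

Let clamp_mono t u : t <= u -> [/\ rho <= clamp t, clamp t <= clamp u,
  clamp u <= r & clamp u - clamp t <= u - t].
Proof.
move=> tu; rewrite /clamp /Num.max /Num.min /Order.max /Order.min.
have rr := rho_le.
by split; do ! case: ifPn; rewrite -?leNgt => *; lra.
Qed.

Let profile_lipschitz t u : rho <= t -> t <= u -> u <= r ->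
  `|profile u - profile t| <= 4 * r `^ d * (u - t).
Proof.
move=> rt tu ur; have t0 : 0 < t by apply: lt_le_trans rt.
have u0 : 0 < u by apply: lt_le_trans tu.
have u1 : 1 <= u by apply: le_trans tu; apply: le_trans rt.
have ut : 0 <= u - t by rewrite subr_ge0.
have mono (k : R) : 0 < k -> u `^ k <= r `^ k.
  by move=> k0; apply: (ge0_ler_powR (ltW k0)) => //; rewrite nnegrE ltW.
have H (k : R) : 0 < k -> k <= 2 -> 0 <= u `^ k - t `^ k <= 2 * r `^ k * (u - t).
  move=> k0 k2; apply/andP; split.
    by rewrite subr_ge0; apply: (ge0_ler_powR (ltW k0)) => //; rewrite nnegrE ltW.
  apply: le_trans (powR_increment k0 k2 (ltW t0) tu u1) _.
  by rewrite ler_wpM2r// ler_wpM2l// mono.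
have /andP[h1 h2] := H d d_gt0 d_le2.
have /andP[h3 h4] := H e e_gt0 e_le2.
have A0 : 0 < r `^ (d - e) by rewrite powR_gt0.
have Ae : r `^ (d - e) * r `^ e = r `^ d.
  by rewrite -powRD ?subrK// (gt_eqF r_gt0) implybT.
have h5 : r `^ (d - e) * (u `^ e - t `^ e) <= 2 * r `^ d * (u - t).
  apply: le_trans (ler_wpM2l (ltW A0) h4) _.
  by rewrite -Ae le_eqVlt; apply/orP; left; apply/eqP; ring.
have h6 : 0 <= r `^ (d - e) * (u `^ e - t `^ e) by rewrite mulr_ge0// ltW.
have -> : profile u - profile t =
  (u `^ d - t `^ d) - r `^ (d - e) * (u `^ e - t `^ e) by rewrite /profile; ring.
by rewrite ler_norml; apply/andP; split; lra.
Qed.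

(** Outside the radii between [rho] and [r] the bump vanishes, so the norms may
    be clamped to this interval, where the powers are Lipschitz. *)
Lemma bump_lipschitz x y : `|bump x - bump y| <= 4 * r `^ d * enorm (x - y).
Proof.
wlog xy : x y / enorm x <= enorm y => [H|].
  have [/H//|/ltW/H] := leP (enorm x) (enorm y).
  by rewrite (distrC (bump x)) (enorm_distC x).
have [h1 h2 h3 h4] := clamp_mono xy.
have H := profile_lipschitz h1 h2 h3.
rewrite !bump_clamp; set a := profile _ in H *; set b := profile (clamp (enorm x)) in H *.
apply: (@le_trans _ _ `|a - b|).
  by rewrite distrC max0_lipschitz.
apply: (le_trans H); rewrite ler_wpM2l ?mulr_ge0 ?powR_ge0//.
apply: (le_trans h4); have := enorm_lipschitz y x.
by rewrite enorm_distC; apply: le_trans; exact: ler_norm.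
Qed.

Lemma measurable_bump : measurable_fun setT bump.
Proof.
apply: measurable_maxr => //; apply: measurable_funB.
  by apply: measurable_funB => //; exact: measurable_enorm_powR.
by apply: measurable_funM => //; exact: measurable_enorm_powR.
Qed.

Lemma bump_gagliardo : (gagliardo_seminorm2 s bump < +oo)%E.
Proof.
pose M := 4 * r `^ d * r.
have M0 : 0 <= M by rewrite !mulr_ge0 ?powR_ge0// ltW.
apply: le_lt_trans (@gagliardo_lipschitz R N s s_gt0 s_lt1 bump r M r_gt0 measurable_bump _ _) (ltry _).
- move=> x y; have h1 := bump_lipschitz x y.
  have h2 : `|bump x - bump y| <= M.
    apply: (@le_trans _ _ (r `^ d)).
      by apply: ler_dist_bound; rewrite ?bump_ge0 ?bump_le.
    rewrite /M mulrAC -[leLHS]mul1r ler_wpM2r ?powR_ge0//.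
    by have := r_ge1; lra.
  have h3 : `|bump x - bump y| <= M * (enorm (x - y) / r).
    rewrite (_ : M * _ = 4 * r `^ d * enorm (x - y))//.
    by rewrite /M; field; rewrite gt_eqF.
  have [m1|m1] := leP 1 ((enorm (x - y) / r) ^+ 2).
    by rewrite mulr1 lerXn2r ?nnegrE.
  have h4 : 0 <= enorm (x - y) / r by rewrite divr_ge0 ?enorm_ge0// ltW.
  by rewrite -exprMn lerXn2r ?nnegrE ?(mulr_ge0 M0 h4).
- move=> x xr; apply: bump_out; rewrite negb_and orbC -leNgt.
  by rewrite (le_trans _ (ltW xr))//; have := r_gt0; lra.
Qed.

Lemma bump_HsV (V : X -> R) : continuous V -> (forall x, 0 <= V x) -> HsV s V bump.
Proof.
move=> cV V0; apply: (@HsV_compact_support R N s s_gt0 N_gt2s V bump (r `^ d) r) => //.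
- exact: measurable_bump.
- by move=> x; rewrite ger0_norm ?bump_ge0// bump_le.
- by move=> x xr; apply: bump_out; rewrite negb_and orbC -leNgt ltW.
- exact: bump_gagliardo.
Qed.

Section level.
Variable l : R.
Hypothesis l_gt1 : 1 < l.
Local Notation Kt := (far_kern s l).
Let Cl : R := (1 - l^-1) `^ (- @kexp R N s).
Let tw : X -> R := @tail_weight R N (@kexp R N s).

Let kexp_gtN : N%:R < @kexp R N s. Proof. by rewrite ltrDl mulr_gt0. Qed.

Lemma bump_far_bound x y : `|bump x - bump y| * Kt x y <=
  r `^ d * Cl * (\1_(eball r) x * tw y + \1_(eball r) y * tw x).
Proof.
have Cl0 : 0 <= Cl by exact: powR_ge0.
have k0 : 0 < @kexp R N s by apply: le_lt_trans kexp_gtN.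
have rd0 : 0 <= r `^ d by exact: powR_ge0.
have tw0 z : 0 <= tw z by exact: tail_weight_ge0.
wlog xs : x y / rho < enorm x < r => [H|].
  have [xs|nx] := boolP (rho < enorm x < r); first exact: H.
  have [ys|ny] := boolP (rho < enorm y < r).
    by rewrite (distrC (bump x)) (far_kernC _ _ x) (addrC (\1_(eball r) x * _)); exact: H.
  rewrite !bump_out// subrr normr0 mul0r.
  by rewrite !mulr_ge0// addr_ge0// mulr_ge0.
have h : `|bump x - bump y| <= r `^ d.
  by apply: ler_dist_bound; rewrite ?bump_ge0 ?bump_le.
apply: le_trans (ler_pM _ (far_kern_ge0 _ _ _ _) h (far_kern_bound s_gt0 x y l_gt1)) _ => //.
rewrite -/Cl mulrA ler_wpM2l ?mulr_ge0//.
case/andP: xs => x1 x2.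
rewrite indicE mem_set; last exact: ltW.
rewrite mul1r; apply: (@le_trans _ _ (tw y)); last by rewrite lerDl mulr_ge0.
apply: ler_powRN; first exact: ltW.
  by rewrite lt_max ltr01.
rewrite ge_max !le_max lexx orbT andbT (le_trans _ (ltW x1))//.
Qed.

Lemma measurable_bump_far (x : X) :
  measurable_fun setT (fun y => (bump x - bump y) * Kt x y).
Proof.
apply: measurable_funM; last exact: measurable_far_kern2.
by apply: measurable_funB => //; exact: measurable_bump.
Qed.

Lemma bump_far_integrable (x : X) :
  mu.-integrable setT (fun y => ((bump x - bump y) * Kt x y)%:E).
Proof.
have Cl0 : 0 <= Cl by exact: powR_ge0.
have mtw : measurable_fun setT tw by exact: measurable_tail_weight.
have tw0 z : 0 <= tw z by exact: tail_weight_ge0.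
have mi := measurable_indic_eball (N := N) r.
apply: (@integrable_dom _ _ _ mu _
  (fun y => r `^ d * Cl * (\1_(eball r) x * tw y + \1_(eball r) y * tw x))).
- exact: measurable_bump_far.
- apply: (measurable_funM (measurable_cst _)); apply: measurable_funD.
    exact: (measurable_funM (measurable_cst _) mtw).
  exact: (measurable_funM mi (measurable_cst _)).
- move=> y; rewrite normrM (ger0_norm (far_kern_ge0 _ _ _ _)).
  exact: bump_far_bound.
have m1 : measurable_fun setT (fun y : X => \1_(eball r) x * tw y).
  by exact: (measurable_funM (measurable_cst _) mtw).
have m2 : measurable_fun setT (fun y : X => tw x * \1_(eball r) y).
  by exact: (measurable_funM (measurable_cst _) mi).
under eq_integral do rewrite (mulrC (\1_(eball r) _) (tw x)).
rewrite intRZ ?mulr_ge0 ?powR_ge0//; last 2 first.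
- exact: measurable_funD.
- by move=> y; rewrite addr_ge0 ?mulr_ge0.
rewrite lte_mul_pinfty ?lee_fin ?mulr_ge0 ?powR_ge0//.
rewrite intRD//; last 2 first.
- by move=> y; rewrite mulr_ge0.
- by move=> y; rewrite mulr_ge0.
rewrite lte_add_pinfty//.
  rewrite intRZ// lte_mul_pinfty// ?lee_fin//; exact: tail_weight_fin.
by rewrite intRZ// lte_mul_pinfty// ?lee_fin// integral_eball eball_fin.
Qed.

Lemma bump_far_form (w : X -> R) : measurable_fun setT w -> (forall x, 0 < w x) ->
  (\int[mu]_x (w x `^ critical_exponent N s)%:E < +oo)%E ->
  mu.-integrable setT (fun x => (w x * far_operator s l bump x)%:E) /\
  (\int[mu \x mu]_z ((w z.1 - w z.2) * (bump z.1 - bump z.2) * Kt z.1 z.2)%:E =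
   2%:E * \int[mu]_x (w x * far_operator s l bump x)%:E)%E.
Proof.
move=> mw w0 woo.
have mtw : measurable_fun setT tw by exact: measurable_tail_weight.
have tw0 z : 0 <= tw z by exact: tail_weight_ge0.
have mi := measurable_indic_eball (N := N) r.
have Cl0 : 0 <= Cl by exact: powR_ge0.
apply: far_form_splitting => //.
- exact: measurable_bump.
- by move=> x; rewrite ltW.
- exact: bump_far_integrable.
pose c := r `^ d * Cl; have c0 : 0 <= c by rewrite mulr_ge0 ?powR_ge0.
pose a1 x := c * (w x * \1_(eball r) x).
pose a2 x := c * (w x * tw x).
have mwi : measurable_fun setT (fun x => w x * \1_(eball r) x) by exact: measurable_funM.
have mwt : measurable_fun setT (fun x => w x * tw x) by exact: measurable_funM.
have ma1 : measurable_fun setT a1 by exact: measurable_funM.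
have ma2 : measurable_fun setT a2 by exact: measurable_funM.
have w1 x : 0 <= w x by rewrite ltW.
have a10 x : 0 <= a1 x by rewrite mulr_ge0// mulr_ge0.
have a20 x : 0 <= a2 x by rewrite mulr_ge0// mulr_ge0.
have m1 : measurable_fun setT (fun z : X * X => a1 z.1 * tw z.2).
  by apply: measurable_funM; [exact: measurable_fst_comp|exact: measurable_snd_comp].
have m2 : measurable_fun setT (fun z : X * X => a2 z.1 * \1_(eball r) z.2).
  by apply: measurable_funM; [exact: measurable_fst_comp|exact: measurable_snd_comp].
apply: (@le_lt_trans _ _ (\int[mu \x mu]_z (a1 z.1 * tw z.2 + a2 z.1 * \1_(eball r) z.2)%:E)%E).
  apply: le_intR.
  - apply: measurable_funM; first exact: measurable_fst_comp.
    apply: measurable_funM; last exact: measurable_far_kern.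
    by apply: measurableT_comp => //; apply: measurable_increment; exact: measurable_bump.
  - exact: measurable_funD.
  - by move=> z; rewrite mulr_ge0// mulr_ge0// far_kern_ge0.
  - move=> z; apply: le_trans (ler_wpM2l (w1 _) (bump_far_bound z.1 z.2)) _.
    have E (p i1 t2 i2 t1 k : R) :
      p * (k * (i1 * t2 + i2 * t1)) = k * (p * i1) * t2 + k * (p * t1) * i2 by ring.
    by rewrite E.
rewrite intRD//; last 2 first.
- by move=> z; rewrite mulr_ge0.
- by move=> z; rewrite mulr_ge0.
rewrite (intR_prod ma1 mtw)// (intR_prod ma2 mi)//.
have fin1 : (\int[mu]_x (w x * \1_(eball r) x)%:E < +oo)%E.
  exact: (ball_mass_fin s_gt0 N_gt2s mw w0 woo).
have fin2 : (\int[mu]_x (w x * tw x)%:E < +oo)%E.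
  apply: (weighted_fin s_gt0 N_gt2s (M := 1)) => //.
  - move=> x; rewrite tw0/= /tw /tail_weight.
    apply: (@le_trans _ _ (1 `^ (- @kexp R N s))); last by rewrite powR1.
    apply: ler_powRN => //; last by rewrite le_max lexx.
    by rewrite ltW// (le_lt_trans _ kexp_gtN).
  - exact: tail_weight_fin.
have fa1 : (\int[mu]_x (a1 x)%:E < +oo)%E.
  rewrite /a1 intRZ//; last by move=> x; rewrite mulr_ge0.
  by rewrite lte_mul_pinfty.
have fa2 : (\int[mu]_x (a2 x)%:E < +oo)%E.
  rewrite /a2 intRZ//; last by move=> x; rewrite mulr_ge0.
  by rewrite lte_mul_pinfty.
rewrite (intR_fineK a10 fa1) (intR_fineK a20 fa2) integral_eball eballE//.
rewrite (intR_fineK tw0 (tail_weight_fin kexp_gtN)).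
by rewrite -!EFinM -EFinD ltry.
Qed.

(** At points where the bump is positive it equals the profile, and it lies above
    the profile everywhere: its increments are at most those of the profile, on
    which the operator is explicit.  At the other points it is minimal. *)
Lemma far_operator_bump x : far_operator s l bump x <=
  if 0 < bump x then
    - far_const s_gt0 N_gt2s d l * enorm x `^ (d - 2 * s) +
    r `^ (d - e) * (far_const s_gt0 N_gt2s e l * enorm x `^ (e - 2 * s))
  else 0.
Proof.
case: ifPn => [bx|]; last first.
  rewrite -leNgt => bx; have b0 : bump x = 0 by apply/eqP; rewrite eq_le bx bump_ge0.
  have : (\int[mu]_y ((bump x - bump y) * Kt x y)%:E <= \int[mu]_y (cst 0%E y))%E.
    apply: le_integral => //.
    - exact: bump_far_integrable.
    - exact: integrable0.
    - move=> y _; rewrite lee_fin b0 sub0r mulNr oppr_le0.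
      by rewrite mulr_ge0 ?bump_ge0 ?far_kern_ge0.
  rewrite integral0 => H; rewrite /far_operator -[leRHS]/(fine 0%E) fine_le//.
  exact: (integrable_fin_num measurableT (bump_far_integrable x)).
have id := npow_integrable s_gt0 d_gt0 d_lt2s l_gt1 x.
have ie := npow_integrable s_gt0 e_gt0 e_lt2s l_gt1 x.
pose A := r `^ (d - e).
have iG : mu.-integrable setT (fun y => (- 1)%:E * ((npow d x - npow d y) * Kt x y)%:E)%E.
  exact: integrableZl.
have iH : mu.-integrable setT (fun y => A%:E * ((npow e x - npow e y) * Kt x y)%:E)%E.
  exact: integrableZl.
have -> : - far_const s_gt0 N_gt2s d l * enorm x `^ (d - 2 * s) +
    r `^ (d - e) * (far_const s_gt0 N_gt2s e l * enorm x `^ (e - 2 * s)) =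
    fine (\int[mu]_y ((- 1)%:E * ((npow d x - npow d y) * Kt x y)%:E +
      A%:E * ((npow e x - npow e y) * Kt x y)%:E))%E.
  rewrite integralD// fineD; last 2 first.
  - exact: (integrable_fin_num measurableT iG).
  - exact: (integrable_fin_num measurableT iH).
  rewrite (integralZl measurableT id) (integralZl measurableT ie).
  rewrite !fineM//; last 2 first.
  - exact: (integrable_fin_num measurableT ie).
  - exact: (integrable_fin_num measurableT id).
  rewrite -[X in _ = _ * X + _]/(far_operator s l (npow d) x) -[X in _ = _ + _ * X]/(far_operator s l (npow e) x).
  rewrite (far_operator_npow s_gt0 N_gt2s d_gt0 d_lt2s l_gt1).
  by rewrite (far_operator_npow s_gt0 N_gt2s e_gt0 e_lt2s l_gt1) /= mulN1r mulNr.
rewrite /far_operator fine_le//.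
- exact: (integrable_fin_num measurableT (bump_far_integrable x)).
- by apply: (integrable_fin_num measurableT); exact: integrableD.
apply: le_integral => //.
- exact: bump_far_integrable.
- exact: integrableD.
move=> y _; rewrite -!EFinM -EFinD lee_fin !mulrA -mulrDl ler_wpM2r ?far_kern_ge0//.
have -> : bump x = profile (enorm x).
  by rewrite /bump max_r//; move: bx; rewrite /bump lt_max ltxx => /ltW.
have : profile (enorm y) <= bump y by rewrite /bump le_max lexx orbT.
rewrite /profile /npow -/A; move: (bump y) (rho `^ d) (enorm x `^ d) (enorm y `^ d)
  (enorm x `^ e) (enorm y `^ e) => b p xd yd xe ye.
rewrite (mulrBr A) !mulrN; move: (A * xe) (A * ye) => Ax Ay.
by lra.
Qed.

End level.

Lemma ae_neq0 : {ae mu, forall x : X, x != 0}.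
Proof.
have N0 := dim_gt0 s_gt0 N_gt2s.
exists [set 0]; split; [exact: measurable_set1_rV|exact: lebesgue_rV_set1|].
by move=> x /=; apply: contra_notP => /eqP.
Qed.

(** The pairs that the truncation never reaches have equal norms, where the bump
    has no increment, or involve the origin, a null set. *)
Lemma form_bump_limit (w : X -> R) (B : R) : measurable_fun setT w ->
  (gagliardo_seminorm2 s w < +oo)%E ->
  (forall l, 1 < l -> l <= 2 ->
    (\int[mu \x mu]_z ((w z.1 - w z.2) * (bump z.1 - bump z.2) * far_kern s l z.1 z.2)%:E
      <= B%:E)%E) ->
  (gagliardo_form s w bump <= B%:E)%E.
Proof.
move=> mw wg HB.
(* The truncations lie in the range in which the constants are uniform. *)
pose lam (n : nat) : R := 1 + n.+1%:R^-1.
have lam1 n : 1 < lam n by rewrite ltrDl invr_gt0.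
have lam2 n : lam n <= 2 by rewrite -[leRHS]/(1 + 1) lerD2l invf_le1// ler1n.
pose F n (z : X * X) : \bar R :=
  ((w z.1 - w z.2) * (bump z.1 - bump z.2) * far_kern s (lam n) z.1 z.2)%:E.
pose G (z : X * X) : \bar R :=
  ((w z.1 - w z.2) * (bump z.1 - bump z.2) * K (z.1 - z.2))%:E.
pose M (z : X * X) : R := `|w z.1 - w z.2| ^+ 2 * K (z.1 - z.2) +
     `|bump z.1 - bump z.2| ^+ 2 * K (z.1 - z.2).
have mM : measurable_fun setT M.
  apply: measurable_funD; apply: measurable_gagliardo => //; exact: measurable_bump.
have M0 z : 0 <= M z by rewrite addr_ge0// gagliardo_integrand_ge0.
have iM : (mu \x mu)%E.-integrable setT (EFin \o M).
  apply: (integrable_dom mM mM) => [z|]; first by rewrite ger0_norm.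
  by apply: form_majorant_fin => //; [exact: measurable_bump|exact: bump_gagliardo].
have mF n : measurable_fun setT (F n).
  apply/measurable_EFinP; apply: measurable_funM; last exact: measurable_far_kern.
  by apply: measurable_funM; apply: measurable_increment => //; exact: measurable_bump.
have mG : measurable_fun setT G.
  by apply/measurable_EFinP; apply: measurable_form => //; exact: measurable_bump.
have FM : {ae (mu \x mu)%E, forall z n, setT z -> (`|F n z| <= (EFin \o M) z)%E}.
  apply/nearW => z n _; rewrite /F abse_EFin lee_fin.
  apply: le_trans (le_form_gagliardo s w bump z).
  by rewrite !normrM ler_wpM2l// !ger0_norm ?far_kern_ge0 ?kern_ge0// far_kern_le.
have FG : {ae (mu \x mu)%E, forall z, setT z -> F n z @[n --> \oo] --> G z}.
  apply: filterS2 (ae_fst ae_neq0) (ae_snd ae_neq0) => -[x y] /= x0 y0 _.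
  apply: cvg_near_cst.
  have [xy|nxy] := eqVneq (enorm x) (enorm y).
    by near=> n; rewrite /F /G/= /bump xy subrr mulr0 !mul0r.
  have px : 0 < enorm x by rewrite enorm_gt0.
  have py : 0 < enorm y by rewrite enorm_gt0.
  have key (a b : R) : 0 < a -> a < b -> \forall n \near \oo, lam n * a < b.
    move=> a0 ab; have ba : 0 < (b - a) / a by rewrite divr_gt0// subr_gt0.
    have := near_infty_natSinv_lt (PosNum ba); apply: filterS => n /=.
    by rewrite ltr_pdivlMr// /lam mulrDl mul1r -ltrBrDl.
  suff : \forall n \near \oo, far (lam n) (enorm x) (enorm y).
    by apply: filterS => n H; rewrite /F /G /far_kern/= H.
  move: nxy; rewrite neq_lt => /orP[xy|yx].
    by apply: filterS (key _ _ px xy) => n H; rewrite /far px H.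
  by apply: filterS (key _ _ py yx) => n H; rewrite /far py H orbT.
have [_ _ cvgI] := dominated_convergence measurableT mF mG FG iM FM.
rewrite -[leLHS]/(\int[mu \x mu]_z G z)%E -(cvg_lim _ cvgI)//.
apply: lime_le; first by apply/cvg_ex; eexists; exact: cvgI.
by apply: nearW => n; exact: HB.
Unshelve. all: by end_near.
Qed.

End profile.

(** * Potentials that decay faster than the critical power *)

Lemma powR_unbounded (R : realType) (a M : R) : 0 < a ->
  exists2 r1, 1 <= r1 & forall r, r1 <= r -> M <= r `^ a.
Proof.
move=> a0; pose m := Num.max 1 M.
have m1 : 1 <= m by rewrite le_max lexx.
have m0 : 0 < m by apply: lt_le_trans m1.
exists (Num.max 1 (m `^ a^-1)); first by rewrite le_max lexx.
move=> r; rewrite ge_max => /andP[r1 mr].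
apply: (@le_trans _ _ m); first by rewrite le_max lexx orbT.
have mE : m = (m `^ a^-1) `^ a by rewrite -powRrM mulVf ?powRr1 ?gt_eqF// ltW.
rewrite mE; apply: (ge0_ler_powR (ltW a0)) => //; rewrite nnegrE ?powR_ge0//.
exact: le_trans r1.
Qed.

Section contradiction.
Context {R : realType} {N : nat} (s : R).
Local Notation X := 'rV[R]_N.
Local Notation mu := (@lebesgue_rV R N).
Variables (V w : X -> R) (q c gamma C : R).
Hypotheses (s_gt0 : 0 < s) (s_lt1 : s < 1) (N_gt2s : 2 * s < N%:R).
Hypotheses (V_cont : continuous V) (V_ge0 : forall x, 0 <= V x).
Hypotheses (c_gt0 : 0 < c).
Hypothesis V_decay : forall k, 0 < k -> exists2 rho, 1 <= rho &
  forall x, rho < enorm x -> V x <= k * enorm x `^ (- (2 * s)).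
Hypotheses (mw : measurable_fun setT w) (w_gt0 : forall x, 0 < w x).
Hypothesis w_int : (\int[mu]_x (w x `^ critical_exponent N s)%:E < +oo)%E.
Hypothesis w_gag : (gagliardo_seminorm2 s w < +oo)%E.
Hypothesis w_sol : forall phi, HsV s V phi ->
  (c%:E * gagliardo_form s w phi + \int[mu]_x (V x * w x * phi x)%:E =
   \int[mu]_x (w x `^ q * w x * phi x)%:E)%E.
Hypothesis gamma_lt : gamma < 2 * s.
Hypothesis mass_le : forall r, 1 <= r -> ball_mass w r <= C * r `^ gamma.

Let N_gt0 : (0 < N)%N := dim_gt0 s_gt0 N_gt2s.

Let g0 : R := Num.max 0 gamma.
(* With d small and e close to 2 * s, the gap e - d exceeds gamma. *)
Let d : R := (2 * s - g0) / 4.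
Let e : R := 2 * s - d.

Let g0_ge0 : 0 <= g0. Proof. by rewrite le_max lexx. Qed.
Let g0_lt : g0 < 2 * s. Proof. by rewrite gt_max gamma_lt mulr_gt0. Qed.
Let d_gt0 : 0 < d. Proof. by rewrite divr_gt0// subr_gt0. Qed.
Let e_lt2s : e < 2 * s. Proof. by rewrite gtrBl. Qed.
Let d_lte : d < e.
Proof. by rewrite /e /d; have := g0_lt; have := g0_ge0; lra. Qed.
Let gap : gamma < e - d.
Proof.
have : gamma <= g0 by rewrite le_max lexx orbT.
by rewrite /e /d; have := g0_lt; have := g0_ge0; lra.
Qed.
Let d_lt2s : d < 2 * s. Proof. exact: lt_trans d_lte e_lt2s. Qed.
Let e_gt0 : 0 < e. Proof. exact: lt_trans d_gt0 d_lte. Qed.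

Section radius.
Variables (c1 c2 rho r : R).
Hypotheses (c1_gt0 : 0 < c1) (c2_ge0 : 0 <= c2).
Hypothesis c1_le : forall l, 1 < l -> l <= 2 -> c1 <= far_const s_gt0 N_gt2s d l.
Hypothesis c2_ge : forall l, 1 < l -> l <= 2 -> far_const s_gt0 N_gt2s e l <= c2.
Hypotheses (rho_ge1 : 1 <= rho) (rho_le : rho <= r).
Hypothesis V_le : forall x, rho < enorm x ->
  V x <= 2 * c * c1 * enorm x `^ (- (2 * s)).

Local Notation phi := (@bump R N d e rho r).

(** Where the bump is positive the potential term is absorbed by the first power;
    only the second power is left, and it is at most [1] there because
    [e < 2 * s] and [rho >= 1]. *)
Lemma pointwise_balance l x : 1 < l -> l <= 2 ->
  2 * c * (w x * far_operator s l phi x) + V x * w x * phi x <=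
  2 * c * (r `^ (d - e) * c2) * (w x * \1_(eball r) x).
Proof.
move=> l1 l2; have w0 := ltW (w_gt0 x); have r0 : 0 < r.
  by apply: lt_le_trans rho_le; apply: lt_le_trans rho_ge1.
have A0 : 0 <= r `^ (d - e) by exact: powR_ge0.
have := far_operator_bump s_gt0 N_gt2s d_gt0 d_lte e_lt2s rho_ge1 rho_le l1 x.
have [px|px] := ltP 0 (phi x); last first.
  have -> : phi x = 0 by apply/eqP; rewrite eq_le px bump_ge0.
  move=> fx; rewrite mulr0 addr0.
  apply: (@le_trans _ _ 0).
    by rewrite mulr_ge0_le0 ?mulr_ge0_le0 ?mulr_ge0// ltW.
  by rewrite !mulr_ge0// ltW.
have /andP[x1 x2] := bump_support d_gt0 d_lte rho_ge1 rho_le px.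
have x0 : 1 < enorm x by apply: le_lt_trans x1.
have xp : 0 < enorm x by apply: lt_trans x0.
rewrite indicE mem_set ?mulr1; last exact: ltW.
set F := far_operator s l phi x; set k1 := far_const s_gt0 N_gt2s d l.
set k2 := far_const s_gt0 N_gt2s e l; set A := r `^ (d - e).
set a := enorm x `^ (d - 2 * s); set b := enorm x `^ (e - 2 * s) => HF.
have a0 : 0 <= a by exact: powR_ge0.
have b0 : 0 <= b by exact: powR_ge0.
have b1 : b <= 1.
  rewrite -(powRr0 (enorm x)); apply: ler_powR; first exact: ltW.
  by rewrite subr_le0 ltW.
have h1 : c1 * a <= k1 * a by rewrite ler_wpM2r// c1_le.
have h2 : A * (k2 * b) <= A * c2.
  rewrite ler_wpM2l// (@le_trans _ _ (c2 * b))//.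
    by rewrite ler_wpM2r// c2_ge.
  by rewrite -[leRHS]mulr1 ler_wpM2l.
have h3 : V x * phi x <= 2 * c * c1 * a.
  apply: (@le_trans _ _ (2 * c * c1 * enorm x `^ (- (2 * s)) * enorm x `^ d)).
    by rewrite ler_pM ?bump_ge0 ?V_le ?bump_le_powR.
  rewrite -mulrA -powRD; last by rewrite (gt_eqF xp) implybT.
  by rewrite (addrC (- _) d).
have h4 : 2 * c * F <= 2 * c * (- (c1 * a) + A * c2).
  rewrite ler_wpM2l ?mulr_ge0 ?(ltW c_gt0)//.
  by apply: (le_trans HF); rewrite mulNr; lra.
have -> : 2 * c * (w x * F) + V x * w x * phi x = w x * (2 * c * F + V x * phi x) by ring.
rewrite (mulrC _ (w x)) ler_wpM2l//.
have -> : 2 * c * (A * c2) = 2 * c * (- (c1 * a) + A * c2) + 2 * c * c1 * a by ring.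
exact: lerD.
Qed.

Lemma bump_estimate :
  (\int[mu]_x (w x `^ q * w x * phi x)%:E <=
   (2 * c * (r `^ (d - e) * c2) * ball_mass w r)%:E)%E.
Proof.
have r1 : 1 <= r by exact: le_trans rho_le.
set B := 2 * c * (r `^ (d - e) * c2).
have B0 : 0 <= B by rewrite !mulr_ge0 ?powR_ge0// ltW.
have Hphi := bump_HsV s_gt0 s_lt1 N_gt2s d_gt0 d_lte e_lt2s rho_ge1 rho_le V_cont V_ge0.
have mphi := @measurable_bump R N d e rho r.
have gphi := bump_gagliardo (N := N) s_gt0 s_lt1 d_gt0 d_lte e_lt2s rho_ge1 rho_le.
have mV := continuous_measurable_rV V_cont.
have mW : measurable_fun setT (fun x => V x * w x * phi x).
  by do 2 apply: measurable_funM => //.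
have W0 x : 0 <= V x * w x * phi x.
  by rewrite mulr_ge0 ?bump_ge0// mulr_ge0// ltW.
have mwi : measurable_fun setT (fun x => w x * \1_(eball r) x).
  by apply: measurable_funM => //; exact: measurable_indic_eball.
have wi0 x : 0 <= w x * \1_(eball r) x by rewrite mulr_ge0// ltW.
have mfin := ball_mass_fin s_gt0 N_gt2s mw w_gt0 w_int r.
(* The potential term is finite because the bump has compact support. *)
have [MV MV0 HV] := continuous_eball_bounded r V_cont.
have Woo : (\int[mu]_x (V x * w x * phi x)%:E < +oo)%E.
  have k0 : 0 <= MV * r `^ d by rewrite mulr_ge0 ?powR_ge0// ltW.
  apply: (@le_lt_trans _ _ (\int[mu]_x (MV * r `^ d * (w x * \1_(eball r) x))%:E)%E).
    apply: le_intR => //; first exact: measurable_funM.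
    move=> x; have [xr|xr] := boolP (rho < enorm x < r); last first.
      rewrite (bump_out d_gt0 d_lte rho_ge1 rho_le xr) mulr0.
      by rewrite mulr_ge0.
    case/andP: xr => _ /ltW xr; rewrite indicE mem_set// mulr1 mulrAC ler_wpM2r ?(ltW (w_gt0 x))//.
    rewrite ler_pM ?bump_ge0//; first exact: HV.
    exact: (bump_le d_gt0 d_lte rho_ge1 rho_le).
  by rewrite intRZ// lte_mul_pinfty.
have ff : gagliardo_form s w phi \is a fin_num.
  apply: integrable_fin_num => //; exact: (form_integrable mw mphi w_gag gphi).
have WE := intR_fineK W0 Woo.
set W := fine _ in WE.
have formB : (gagliardo_form s w phi <= ((B * ball_mass w r - W) / c)%:E)%E.
  apply: (form_bump_limit s_gt0 s_lt1 N_gt2s d_gt0 d_lte e_lt2s rho_ge1 rho_le mw w_gag) => l l1 l2.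
  have [iI ->] := bump_far_form s_gt0 N_gt2s d_gt0 d_lte rho_ge1 rho_le l1 mw w_gt0 w_int.
  have iW : mu.-integrable setT (EFin \o (fun x => V x * w x * phi x)).
    by apply: (integrable_dom mW mW) => // x; rewrite ger0_norm.
  have iM : mu.-integrable setT (EFin \o (fun x => w x * \1_(eball r) x)).
    by apply: (integrable_dom mwi mwi) => // x; rewrite ger0_norm.
  have iI2 := integrableZl measurableT (2 * c) iI.
  have iM2 := integrableZl measurableT B iM.
  have : (\int[mu]_x ((2 * c)%:E * (w x * far_operator s l phi x)%:E + (V x * w x * phi x)%:E) <=
      \int[mu]_x (B%:E * (w x * \1_(eball r) x)%:E))%E.
    apply: le_integral => //.
      exact: (integrableD measurableT iI2 iW).
    by move=> x _; rewrite -!EFinM -EFinD lee_fin; exact: pointwise_balance.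
  rewrite (integralD measurableT iI2 iW) (integralZl measurableT iI) (integralZl measurableT iM).
  rewrite -[X in (_ + X <= _)%E]/(\int[mu]_x (V x * w x * phi x)%:E)%E WE.
  rewrite -[X in (_ <= _ * X)%E]/(\int[mu]_x (w x * \1_(eball r) x)%:E)%E.
  rewrite (intR_fineK wi0 mfin) -/(ball_mass w r).
  rewrite -(fineK (integrable_fin_num measurableT iI)); set I := fine _.
  rewrite -!EFinM -EFinD !lee_fin => H.
  by rewrite ler_pdivlMr// lerBrDr mulrAC.
rewrite -(w_sol Hphi) WE; move: formB; rewrite -(fineK ff).
rewrite -EFinM -EFinD !lee_fin ler_pdivlMr// lerBrDr => H.
by rewrite (mulrC c).
Qed.

End radius.

(** As the radius grows, the bumps stay above a positive constant on a fixed
    annulus, while the bound of [bump_estimate] tends to zero. *)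
Lemma slow_ball_mass_absurd : False.
Proof.
have [c1 [c1' [c10 Hc1]]] := far_const_bounds s_gt0 s_lt1 N_gt2s d_gt0 d_lt2s.
have [c2' [c2 [c20 Hc2]]] := far_const_bounds s_gt0 s_lt1 N_gt2s e_gt0 e_lt2s.
have c2_ge0 : 0 <= c2.
  have /andP[h1 h2] := Hc2 2 (ltr1n R 2) (lexx _).
  exact: le_trans (ltW c20) (le_trans h1 h2).
have [rho rho1 Vrho] := V_decay (k := 2 * c * c1) (mulr_gt0 (mulr_gt0 (ltr0n R 2) c_gt0) c10).
have rho0 : 0 < rho by apply: lt_le_trans rho1.
have r23 : 2 * rho < 3 * rho by rewrite ltr_pM2r// ltr_nat.
pose S := @annulus R N (2 * rho) (3 * rho).
have Spos := @annulus_gt0 R N (2 * rho) (3 * rho) N_gt0 (mulr_gt0 (ltr0n R 2) rho0) r23.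
have pd : 1 < 2 `^ d.
  by rewrite -[ltLHS](powRr0 2) /powR !gt_eqF// ltr_expR mul0r mulr_gt0// ln_gt0// ltr1n.
pose m0 := (2 `^ d - 1) * rho `^ d / 2.
have m00 : 0 < m0 by rewrite divr_gt0// mulr_gt0 ?powR_gt0// subr_gt0.
have mi := @measurable_indic_annulus R N (2 * rho) (3 * rho).
have mq : measurable_fun setT (fun x => w x `^ q * w x).
  by apply: measurable_funM => //; exact: (measurableT_comp (measurable_powR _)).
have wq0 x : 0 < w x `^ q * w x by rewrite mulr_gt0// powR_gt0.
pose f (x : X) := \1_S x * (w x `^ q * w x).
have mf : measurable_fun setT f by exact: measurable_funM.
have f0 x : 0 <= f x by rewrite mulr_ge0// ltW.
have fpos : (0 < \int[mu]_x (f x)%:E)%E.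
  by apply: intR_indic_gt0 => //; exact: measurable_annulus.
have ed0 : 0 < e - d by rewrite subr_gt0.
have [ra ra1 Hra] := powR_unbounded ((3 * rho) `^ e / m0) ed0.
pose B r := 2 * c * (r `^ (d - e) * c2) * ball_mass w r.
have lower r : rho <= r -> ra <= r -> ((m0)%:E * \int[mu]_x (f x)%:E <= (B r)%:E)%E.
  move=> rr rar; have r0 : 0 < r by apply: lt_le_trans rr.
  have c1_le l : 1 < l -> l <= 2 -> c1 <= far_const s_gt0 N_gt2s d l.
    by move=> l1 l2; case/andP: (Hc1 l l1 l2).
  have c2_le l : 1 < l -> l <= 2 -> far_const s_gt0 N_gt2s e l <= c2.
    by move=> l1 l2; case/andP: (Hc2 l l1 l2).
  apply: le_trans (bump_estimate c2_ge0 c1_le c2_le rho1 rr Vrho).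
  rewrite -intRZ ?(ltW m00)//; apply: le_intR.
  - exact: measurable_funM.
  - by apply: measurable_funM => //; exact: measurable_bump.
  - by move=> x; rewrite mulr_ge0// ltW.
  move=> x; rewrite /f indicE; have [xS|_] := boolP (x \in S); last first.
    by rewrite mul0r mulr0 mulr_ge0 ?bump_ge0// ltW.
  rewrite mul1r mulrC ler_wpM2l ?(ltW (wq0 x))//.
  move: xS; rewrite in_annulus => /andP[x1 x2].
  rewrite /bump le_max /profile; apply/orP; right.
  have h1 : 2 `^ d * rho `^ d <= enorm x `^ d.
    rewrite -powRM ?(ltW rho0)//; apply: (ge0_ler_powR (ltW d_gt0)).
    - by rewrite nnegrE mulr_ge0// ltW.
    - by rewrite nnegrE enorm_ge0.
    - exact: ltW.
  have h2 : r `^ (d - e) * enorm x `^ e <= m0.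
    apply: (@le_trans _ _ (r `^ (d - e) * (3 * rho) `^ e)).
      rewrite ler_wpM2l ?powR_ge0//; apply: (ge0_ler_powR (ltW e_gt0)) => //.
      - by rewrite nnegrE enorm_ge0.
      - by rewrite nnegrE mulr_ge0// ltW.
    rewrite -opprB powRN mulrC ler_pdivrMr ?powR_gt0//.
    by have := Hra r rar; rewrite ler_pdivrMr// [leRHS]mulrC.
  have h3 : (2 `^ d - 1) * rho `^ d = 2 * m0.
    by rewrite /m0 mulrC; field.
  by move: h3; rewrite mulrBl mul1r; lra.
pose r0 := Num.max rho ra.
have r0rho : rho <= r0 by rewrite le_max lexx.
have r0a : ra <= r0 by rewrite le_max lexx orbT.
have foo : (\int[mu]_x (f x)%:E < +oo)%E.
  rewrite ltey; apply/negP => /eqP fy; have := lower r0 r0rho r0a.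
  by rewrite fy gt0_muley ?lte_fin// leNgt ltry.
have fE := intR_fineK f0 foo; set L := fine _ in fE.
have L0 : 0 < L by move: fpos; rewrite fE lte_fin.
pose Y := 2 * c * c2 * C / (m0 * L).
have mL : 0 < m0 * L by rewrite mulr_gt0.
have gap0 : 0 < e - d - gamma by rewrite subr_gt0.
have [rb rb1 Hrb] := powR_unbounded (Y + 1) gap0.
pose r := Num.max r0 rb.
have rr0 : r0 <= r by rewrite le_max lexx.
have rrb : rb <= r by rewrite le_max lexx orbT.
have r1 : 1 <= r by apply: le_trans rrb.
have rp : 0 < r by apply: lt_le_trans r1.
have := lower r (le_trans r0rho rr0) (le_trans r0a rr0).
rewrite fE -EFinM lee_fin => H.
have H2 : m0 * L <= 2 * c * c2 * C * r `^ (- (e - d - gamma)).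
  apply: (le_trans H); rewrite /B.
  have -> : - (e - d - gamma) = (d - e) + gamma by ring.
  rewrite [r `^ (d - e + gamma)]powRD; last by rewrite (gt_eqF rp) implybT.
  have -> : 2 * c * c2 * C * (r `^ (d - e) * r `^ gamma) =
    2 * c * (r `^ (d - e) * c2) * (C * r `^ gamma) by ring.
  apply: ler_wpM2l (mass_le r1).
  by rewrite mulr_ge0 ?mulr_ge0 ?powR_ge0// ltW.
have pw : 0 < r `^ (e - d - gamma) by rewrite powR_gt0.
move: H2; rewrite powRN ler_pdivlMr// mulrC -ler_pdivlMr// -/Y.
by have := Hrb r rrb; lra.
Qed.

End contradiction.

(** * Nonexistence *)

Section hypotheses.
Context {R : realType} {N : nat}.
Local Notation X := 'rV[R]_N.

Lemma decay_of_cvg (s : R) (V : X -> R) : (forall x, 0 <= V x) ->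
  (1 + enorm x `^ (2 * s)) * V x @[x --> enorm_pinfty] --> (0 : R) ->
  forall k, 0 < k -> exists2 rho, 1 <= rho &
    forall x, rho < enorm x -> V x <= k * enorm x `^ (- (2 * s)).
Proof.
move=> V0 VV k k0; have [r _ Hr] := VV _ (nbhsx_ballx (0 : R) k k0).
exists (Num.max 1 r); first by rewrite le_max lexx.
move=> x; rewrite gt_max => /andP[x1 xr].
have := Hr x xr; rewrite /= -ball_normE/= sub0r normrN.
have p0 : 0 < enorm x `^ (2 * s) by rewrite powR_gt0// (lt_trans ltr01).
move=> /(le_lt_trans (ler_norm _)) /ltW H.
rewrite powRN ler_pdivlMr//; apply: le_trans H.
by rewrite mulrC ler_wpM2r// lerDr.
Qed.

(** On the ball where the decay says nothing, continuity bounds [V], and the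
    power is bounded from below. *)
Lemma decay_global (s : R) (V : X -> R) : 0 < s -> continuous V -> (forall x, 0 <= V x) ->
  (forall k, 0 < k -> exists2 rho, 1 <= rho &
    forall x, rho < enorm x -> V x <= k * enorm x `^ (- (2 * s))) ->
  exists2 C, 0 <= C & forall x, x != 0 -> V x <= C * enorm x `^ (- (2 * s)).
Proof.
move=> s0 cV V0 /(_ 1 ltr01)[rho rho1 Hrho].
have [M M0 HM] := continuous_eball_bounded rho cV.
have rho0 : 0 < rho by apply: lt_le_trans rho1.
have B0 : 0 <= M * rho `^ (2 * s) by rewrite mulr_ge0 ?powR_ge0// ltW.
exists (1 + M * rho `^ (2 * s)); first by rewrite addr_ge0.
move=> x x0; have xp : 0 < enorm x by rewrite enorm_gt0.
have e0 : 0 <= enorm x `^ (- (2 * s)) by exact: powR_ge0.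
have [xr|xr] := leP (enorm x) rho; last first.
  by apply: (le_trans (Hrho x xr)); rewrite ler_wpM2r// lerDl.
apply: (@le_trans _ _ (M * rho `^ (2 * s) * enorm x `^ (- (2 * s)))); last first.
  by rewrite ler_wpM2r// lerDr.
apply: (le_trans (HM x xr)); rewrite -mulrA ler_peMr ?(ltW M0)//.
rewrite powRN ler_pdivlMr ?powR_gt0// mul1r.
by apply: ge0_ler_powR => //; rewrite ?nnegrE ?enorm_ge0 ?mulr_ge0 ?(ltW rho0) ?(ltW s0).
Qed.

Lemma decay_of_sup (omega : R) (V : X -> R) : (forall x, 0 <= V x) ->
  (ereal_sup (range (fun x : X => ((1 + enorm x `^ omega) * V x)%:E)) < +oo)%E ->
  exists2 C, 0 <= C & forall x, x != 0 -> V x <= C * enorm x `^ (- omega).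
Proof.
move=> V0; set S := ereal_sup _ => Soo.
have HS x : (((1 + enorm x `^ omega) * V x)%:E <= S)%E.
  by apply: ereal_sup_ubound; exists x.
have S0 : (0 <= S)%E.
  by apply: le_trans (HS 0); rewrite lee_fin mulr_ge0// addr_ge0// powR_ge0.
have Sf : S \is a fin_num by rewrite ge0_fin_numE.
exists (fine S); first exact: fine_ge0.
move=> x x0; have xp : 0 < enorm x by rewrite enorm_gt0.
have := HS x; rewrite -(fineK Sf) lee_fin => H.
rewrite powRN ler_pdivlMr ?powR_gt0//; apply: le_trans H.
by rewrite mulrC ler_wpM2r// lerDr.
Qed.

Lemma ball_mass1_gt0 (w : X -> R) (s : R) : 0 < s -> 2 * s < N%:R ->
  measurable_fun setT w -> (forall x, 0 < w x) ->
  (\int[lebesgue_rV N]_x (w x `^ critical_exponent N s)%:E < +oo)%E ->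
  0 < ball_mass w 1.
Proof.
move=> s0 Ns mw w0 woo; rewrite fine_gt0//.
rewrite (ball_mass_fin s0 Ns mw w0 woo) andbT.
under eq_integral do rewrite mulrC.
apply: intR_indic_gt0 => //; first exact: measurable_eball.
by rewrite integral_eball eball_gt0.
Qed.

Lemma ball_mass_mono (w : X -> R) (s r : R) : 0 < s -> 2 * s < N%:R ->
  measurable_fun setT w -> (forall x, 0 < w x) ->
  (\int[lebesgue_rV N]_x (w x `^ critical_exponent N s)%:E < +oo)%E ->
  1 <= r -> ball_mass w 1 <= ball_mass w r.
Proof.
move=> s0 Ns mw w0 woo r1.
have pt (t : R) (x : X) : 0 <= w x * \1_(eball t) x by rewrite mulr_ge0// ltW.
rewrite -lee_fin /ball_mass -!intR_fineK//; [|exact: (ball_mass_fin s0 Ns mw w0 woo)..].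
have mi (t : R) : measurable_fun setT (fun x => w x * \1_(eball t) x).
  by apply: measurable_funM => //; exact: measurable_indic_eball.
apply: le_intR => // x; rewrite ler_wpM2l ?(ltW (w0 x))// !indicE.
have [xb|//] := boolP (x \in eball 1).
rewrite mem_set//; move: xb; rewrite inE /eball/= => /le_trans; exact.
Qed.

End hypotheses.

Theorem theorem1p3 (R : realType) (N : nat) (s p : R) (V : 'rV[R]_N -> R)
    (N_ge1 : (1 <= N)%N) (s_gt0 : 0 < s) (s_lt1 : s < 1)
    (N_gt2s : 2 * s < N%:R)
    (V_cont : continuous V) (V_ge0 : forall x, 0 <= V x)
    (hyp :
      [/\ 2 < p, p < 2 + 2 * s / (N%:R - 2 * s) &
          (1 + enorm x `^ (2 * s)) * V x @[x --> enorm_pinfty] --> (0 : R)]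
      \/
      exists omega : R,
        [/\ 0 < omega, omega <= 2 * s,
            2 < p, p < 2 + omega / (N%:R + 2 * s - omega) &
            (ereal_sup (range (fun x : 'rV[R]_N =>
               ((1 + enorm x `^ omega) * V x)%:E)) < +oo)%E]) :
  forall eps : R, 0 < eps ->
    ~ exists u : 'rV[R]_N -> R, positive_weak_solution s V p eps u.
Proof.
move=> eps eps0 [u Hu].
have [w [mw w0 w_int w_gag w_sol]] := positive_representative s_gt0 N_gt2s V_cont V_ge0 Hu.
have c0 : 0 < eps `^ (2 * s) by rewrite powR_gt0.
case: hyp => [[p2 pN VV]|[omega [om0 om2s p2 pN VV]]].
- have q0 : 0 < p - 2 by rewrite subr_gt0.
  have Vd := decay_of_cvg V_ge0 VV.
  have [CV CV0 HCV] := decay_global s_gt0 V_cont V_ge0 Vd.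
  have [C C0 HC] := ball_mass_bound s_gt0 s_lt1 N_gt2s V_cont V_ge0 c0 q0 (lexx _)
    CV0 HCV mw w0 w_int w_gag w_sol.
  apply: (slow_ball_mass_absurd s_gt0 s_lt1 N_gt2s V_cont V_ge0 c0 Vd mw w0 w_int w_gag w_sol _ HC).
  rewrite addrK ltrBlDr -ltrBlDl ltr_pdivlMr// mulrC -ltr_pdivlMr ?subr_gt0//.
  by rewrite ltrBlDl.
- have q0 : 0 < p - 2 by rewrite subr_gt0.
  have [CV CV0 HCV] := decay_of_sup V_ge0 VV.
  have [C C0 HC] := ball_mass_bound s_gt0 s_lt1 N_gt2s V_cont V_ge0 c0 q0 om2s
    CV0 HCV mw w0 w_int w_gag w_sol.
  have D0 : 0 < N%:R + 2 * s - omega.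
    by rewrite -addrA ltr_pwDl ?ltr0n// subr_ge0.
  have gap : 0 < omega / (p - 2) - (N%:R + 2 * s - omega).
    by rewrite subr_gt0 ltr_pdivlMr// mulrC -ltr_pdivlMr// ltrBlDl.
  have m1 := ball_mass1_gt0 s_gt0 N_gt2s mw w0 w_int.
  have [r r1 /(_ r (lexx _)) Hr] := powR_unbounded (C / ball_mass w 1 + 1) gap.
  have rp : 0 < r by apply: lt_le_trans r1.
  have := le_trans (ball_mass_mono s_gt0 N_gt2s mw w0 w_int r1) (HC r r1).
  rewrite -opprB powRN ler_pdivlMr ?powR_gt0// mulrC -ler_pdivlMr//.
  by move: Hr; lra.
Qed.
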